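(* Let $s>2$, let $u_0\in H^s(\mathbb{T}^2)$ be a zero-average divergence-free vector field with $\omega_0:=\operatorname{curl}u_0$, and let $T>0$ be arbitrary and finite. Let $u$ be the unique solution of the Euler equations with initial datum $u_0$ in $C([0,T];H^s(\mathbb{T}^2))$, and let $\omega:=\operatorname{curl}u$. Let $\{u_0^\alpha\}_{\alpha>0}$ be a family of zero-average divergence-free vector fields on $\mathbb{T}^2$, with $\omega_0^\alpha:=\operatorname{curl}u_0^\alpha$, such that $u_0^\alpha\in C^\infty(\mathbb{T}^2)$ for each fixed $\alpha>0$, and such that $\{u_0^\alpha\}_\alpha$ is bounded in $H^1(\mathbb{T}^2)$ and $\{\sqrt{\alpha}\,\nabla\omega_0^\alpha\}_\alpha$ is bounded in $L^2(\mathbb{T}^2)$, both uniformly in $\alpha>0$. For each $\alpha>0$ let $u^\alpha$ be the solution of the Euler-Voigt equations with parameter $\alpha$ and initial datum $u_0^\alpha$, and let $\omega^\alpha:=\operatorname{curl}u^\alpha$. Then $$\sup_{0\le t\le T}\|u^\alpha-u\|_2\lesssim\left(\alpha+\|u_0^\alpha-u_0\|_2^2\right)^{\frac12}.$$ Moreover, if $s\ge3$, $$\sup_{0\le t\le T}\|\omega^\alpha-\omega\|_2\lesssim\left(\alpha+\|\omega_0^\alpha-\omega_0\|_2^2+\alpha\|\nabla\omega_0^\alpha-\nabla\omega_0\|_2^2\right)^{\frac12},$$ while if $2<s<3$, $$\sup_{0\le t\le T}\|\omega^\alpha-\omega\|_2\lesssim\left(\alpha^{\frac{s-1}{2}}+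\|\omega_0^\alpha-\omega_0\|_2^2+\alpha\|\nabla\omega_0^\alpha-\nabla\omega_0\|_2^2\right)^{\frac12}.$$
   Context: $\mathbb{T}^2=\mathbb{R}^2/2\pi\mathbb{Z}^2$ is the flat torus; $\|\cdot\|_2$ is the $L^2(\mathbb{T}^2)$ norm. For a planar vector field $v$, $\operatorname{curl}v=\partial_1v_2-\partial_2v_1$. The notation $A\lesssim B$ means $A\le CB$ with a constant $C>0$ independent of $\alpha$. Euler equations: $\partial_tu+u\cdot\nabla u=-\nabla p$, $\operatorname{div}u=0$ on $(0,T)\times\mathbb{T}^2$, $u(0,\cdot)=u_0$. For $s>2$ and zero-average divergence-free $u_0\in H^s(\mathbb{T}^2)$ there is a unique solution $u\in C([0,T];H^s(\mathbb{T}^2))\cap C^1([0,T];H^{s-1}(\mathbb{T}^2))$. Euler-Voigt equations with parameter $\alpha>0$: $\partial_tu^\alpha-\alpha\Delta\partial_tu^\alpha+u^\alpha\cdot\nabla u^\alpha=-\nabla p^\alpha$, $\operatorname{div}u^\alpha=0$ on $(0,T)\times\mathbb{T}^2$, $u^\alpha(0,\cdot)=u_0^\alpha$. For smooth zero-average divergence-free $u_0^\alpha$, ''the solution'' is the unique one, which belongs to $C([0,T];H^r(\mathbb{T}^2))\cap C^1([0,T];H^{r-1}(\mathbb{T}^2))$ for any $r>2$. *)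

(* Defs.v *)
From mathcomp Require Import all_boot all_order all_algebra.
From mathcomp Require Import all_classical all_reals all_analysis.
Import Order.TTheory GRing.Theory Num.Theory.
Import numFieldNormedType.Exports.

Set Implicit Arguments.
Unset Strict Implicit.
Unset Printing Implicit Defensive.

Local Open Scope classical_set_scope.
Local Open Scope ring_scope.

(* Functions on the torus are functions on the plane R * R that are
   (2 pi)-periodic in each coordinate; they are integrated over the cell
   [0, 2 pi]^2.  A planar vector field is a function R * R -> R * R. *)

Section Torus.
Context {R : realType}.
Implicit Types (f g p phi : R * R -> R) (u v : R * R -> R * R).

Definition leb2 :
    {measure set (measurableTypeR R * measurableTypeR R) -> \bar R} :=
  (@lebesgue_measure R \x @lebesgue_measure R)%E.

Definition cell : set (R * R) := `[0, 2 * pi] `*` `[0, 2 * pi].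

Definition torus_periodic {V : Type} (f : R * R -> V) : Prop :=
  forall x : R * R,
    f (x.1 + 2 * pi, x.2) = f x /\ f (x.1, x.2 + 2 * pi) = f x.

Definition L2norm f : \bar R := 'N[leb2]_2%:E[(EFin \o f) \_ cell].

Definition enorm (y : R * R) : R := Num.sqrt (y.1 ^+ 2 + y.2 ^+ 2).

Definition vL2norm u : \bar R := L2norm (enorm \o u).

Definition vL2 u : Prop :=
  [/\ torus_periodic u, measurable_fun setT u & (vL2norm u < +oo)%E].

Definition zero_average u : Prop :=
  (\int[leb2]_(x in cell) (u x).1) = 0 /\ (\int[leb2]_(x in cell) (u x).2) = 0.

Definition d1 f (x : R * R) : R := 'D_(1, 0) f x.
Definition d2 f (x : R * R) : R := 'D_(0, 1) f x.

Fixpoint Cn (n : nat) f : Prop :=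
  match n with
  | 0 => continuous f
  | m.+1 => [/\ forall x, differentiable f x, Cn m (d1 f) & Cn m (d2 f)]
  end.

Definition smooth f : Prop := forall n, Cn n f.

Definition vC1 u : Prop := Cn 1 (fst \o u) /\ Cn 1 (snd \o u).
Definition vsmooth u : Prop := smooth (fst \o u) /\ smooth (snd \o u).

Definition grad f (x : R * R) : R * R := (d1 f x, d2 f x).
Definition laplace f : R * R -> R := d1 (d1 f) \+ d2 (d2 f).
Definition vlaplace u (x : R * R) : R * R :=
  (laplace (fst \o u) x, laplace (snd \o u) x).
Definition divergence u : R * R -> R := d1 (fst \o u) \+ d2 (snd \o u).
Definition curl u : R * R -> R := d1 (snd \o u) \- d2 (fst \o u).

(* u . grad u *)
Definition convect u (x : R * R) : R * R :=
  ((u x).1 * d1 (fst \o u) x + (u x).2 * d2 (fst \o u) x,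
   (u x).1 * d1 (snd \o u) x + (u x).2 * d2 (snd \o u) x).

Definition div_free u : Prop := forall x, divergence u x = 0.

Definition weak_grad f (G : R * R -> R * R) : Prop :=
  vL2 G /\
  forall phi, torus_periodic phi -> smooth phi ->
    (\int[leb2]_(x in cell) (f x * d1 phi x)) =
      - (\int[leb2]_(x in cell) ((G x).1 * phi x)) /\
    (\int[leb2]_(x in cell) (f x * d2 phi x)) =
      - (\int[leb2]_(x in cell) ((G x).2 * phi x)).

(* The weak gradient, as an L^2 field chosen among its a.e. equal versions; it
   exists when f is in H^1, and the zero field is a dummy value otherwise. *)
Definition wgrad f : R * R -> R * R := xget (fun=> (0, 0)) (weak_grad f).

Definition phase (k : int * int) (x : R * R) : R :=
  k.1%:~R * x.1 + k.2%:~R * x.2.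

(* |f^(k)|^2 for f^(k) = (2 pi)^-2 int_cell f(x) exp(- i k . x) dx *)
Definition fourier_sq f (k : int * int) : R :=
  (((2 * pi) ^- 2) *
    (\int[leb2]_(x in cell) (f x * cos (phase k x)))) ^+ 2 +
  (((2 * pi) ^- 2) *
    (\int[leb2]_(x in cell) (f x * sin (phase k x)))) ^+ 2.

Definition Hnorm (s : R) u : \bar R :=
  ((\esum_(k in [set: int * int])
     ((1 + k.1%:~R ^+ 2 + k.2%:~R ^+ 2) `^ s *
      (fourier_sq (fst \o u) k + fourier_sq (snd \o u) k))%:E) `^ 2^-1)%E.

(* H^s(T^2; R^2) for s >= 0 *)
Definition Hs (s : R) u : Prop := vL2 u /\ (Hnorm s u < +oo)%E.

(* C([0, T]; H^s) *)
Definition contHs (s T : R) (u : R -> R * R -> R * R) : Prop :=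
  forall t, t \in `[0, T] ->
    Hs s (u t) /\
    Hnorm s (fun x => u t' x - u t x) @[t' --> within `[0, T] (nbhs t)]
      --> 0%E.

(* v is the derivative of u : [0, T] -> H^s (one-sided at 0 and T) *)
Definition derivHs (s T : R) (u v : R -> R * R -> R * R) : Prop :=
  forall t, t \in `[0, T] ->
    Hnorm s (fun x => ((t' - t)^-1 * ((u t' x).1 - (u t x).1) - (v t x).1,
                       (t' - t)^-1 * ((u t' x).2 - (u t x).2) - (v t x).2))
      @[t' --> within `[0, T] t^'] --> 0%E.

(* For s > 2, elements of H^s have a unique C^1 representative (Sobolev
   embedding); solutions and data are that representative, so that the first
   order derivatives in the equations are classical ones. *)
Definition Euler_solution (s T : R) (u0 : R * R -> R * R)
    (u : R -> R * R -> R * R) : Prop :=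
  exists dtu : R -> R * R -> R * R,
    [/\ contHs s T u, contHs (s - 1) T dtu & derivHs (s - 1) T u dtu] /\
    [/\ u 0 = u0,
        forall t, t \in `[0, T] -> vC1 (u t) &
        forall t, t \in `]0, T[ -> div_free (u t) /\
          exists p, [/\ torus_periodic p, Cn 1 p &
            forall x, dtu t x + convect (u t) x = - grad p x]].

(* A field that is in H^r for all r has a smooth representative. *)
Definition Euler_Voigt_solution (alpha T : R) (u0 : R * R -> R * R)
    (u : R -> R * R -> R * R) : Prop :=
  exists dtu : R -> R * R -> R * R,
    (forall r, 2 < r ->
      [/\ contHs r T u, contHs (r - 1) T dtu & derivHs (r - 1) T u dtu]) /\
    [/\ u 0 = u0,
        forall t, t \in `[0, T] -> vsmooth (u t) /\ vsmooth (dtu t) &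
        forall t, t \in `]0, T[ -> div_free (u t) /\
          exists p, [/\ torus_periodic p, Cn 1 p &
            forall x, dtu t x - (alpha * (vlaplace (dtu t) x).1,
                                 alpha * (vlaplace (dtu t) x).2)
              + convect (u t) x = - grad p x]].

End Torus.

(* Main.v *)
(* The proof runs on Fourier coefficients.  Let v and w be the coefficients of the
   Euler-Voigt and the Euler solution (of the velocities, or of the vorticities).
   The energy estimate is made for the finitely supported difference
   chi_M v - chi_N w, with Lipschitz frequency cutoffs chi, in the Voigt norm
   sum (1 + alpha |k|^2) |.|^2.  The transport of this difference by v vanishes by
   skew symmetry, the transport of w by v - w is absorbed by Gronwall, the
   commutators of the cutoffs with the transport terms are O(N^(-2(s-1))), and what
   remains is alpha times the squared norm of the gradient of chi_N d_t w.  For the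
   velocity and for s >= 3 the latter is O(alpha) and N is taken with
   N^(-2(s-1)) ~ alpha.  For s < 3 the vorticity has d_t w only in H^(s-2), so that
   this term is O(alpha N^(2(3-s))), and N ~ alpha^(-1/4) balances both errors at
   alpha^((s-1)/2).  M depends on the Voigt solution, hence on alpha, and is taken
   so large that its error is negligible. *)

Require Import Defs.
From mathcomp Require Import all_boot all_order all_algebra.
From mathcomp Require Import all_classical all_reals all_analysis measurable_realfun.
From mathcomp Require Import ring lra zify.
Import Order.TTheory GRing.Theory Num.Theory.
Import numFieldNormedType.Exports.

Set Implicit Arguments.
Unset Strict Implicit.
Unset Printing Implicit Defensive.

Local Open Scope classical_set_scope.
Local Open Scope ring_scope.

(** * Integration over the cell *)

Section CellIntegral.
Context {R : realType}.
Implicit Types (f g : R * R -> R).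

(** The solutions are given only as curves in Sobolev spaces. A Fourier coefficient is a bounded
    functional on these spaces, hence a scalar function of time with an ordinary derivative, and the
    energy of a finitely supported difference is a finite sum, differentiated term by term. At a
    fixed frequency the equations require one classical derivative of the velocity and none of the
    vorticity, whose gradient need not be continuous for the Euler solution. With [r = s - 1], the
    hypothesis s > 2 enters as summability of (1 + |k|^2)^(-r) over the lattice, which takes the
    place of the embedding of H^r into the bounded functions. Two cutoffs occur because the H^s
    bound of the Voigt solution may depend on alpha: the constants of the stability estimates come
    from the Euler solution, and the bound of the Voigt solution appears only next to a negative
    power of [M]. The family runs over all alpha > 0, so for s < 3 large alpha needs an argument of
    its own: there alpha exceeds alpha^((s-1)/2). *)

Lemma open_measurable_plane (U : set (R * R)) :
  open U -> measurable (U : set (measurableTypeR R * measurableTypeR R)).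
Proof.
move=> oU.
(* Squares with rational centre and radius: there are countably many, and each is a product of open
   intervals, hence measurable for the product sigma-algebra. *)
pose Q (q : rat * rat * rat) : set (R * R) :=
  ball (ratr q.1.1 : R) (ratr q.2) `*` ball (ratr q.1.2 : R) (ratr q.2).
have -> : U = \bigcup_(q in [set q | Q q `<=` U]) Q q.
  apply/seteqP; split => [x Ux|x [q /= qU /qU//]].
  have /nbhs_ballP[e /= e0 eU] : nbhs x U by exact: open_nbhs_nbhs.
  have /rat_in_itvoo[r /itvP re] : (0 : R) < e / 2 by rewrite divr_gt0.
  have rat_near (y : R) : exists q : rat, ball (ratr q : R) (ratr r) y.
    have /rat_in_itvoo[q qy] : y - ratr r < y + ratr r.
      by rewrite ltrBlDr -addrA ltrDl addr_gt0// re.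
    by exists q; move: qy; rewrite in_itv/= /ball/= ltr_distl.
  have [q1 q1x] := rat_near x.1; have [q2 q2x] := rat_near x.2.
  have r2e : ratr r + ratr r <= e :> R by rewrite (splitr e) lerD// ltW// re.
  exists (q1, q2, r) => //= y [/= y1 y2]; apply: eU.
  by split; apply: (le_ball r2e); apply: ball_triangle; [exact/ball_sym/q1x|
    exact: y1|exact/ball_sym/q2x|exact: y2].
rewrite bigcup_mkcond; apply: countable_bigcupT_measurable => [|q]; first exact: countableP.
by case: ifP => _ //; apply: measurableX; apply: open_measurable; exact: ball_open.
Qed.

Lemma continuous_measurable_plane f : continuous f ->
  measurable_fun setT (f : measurableTypeR R * measurableTypeR R -> R).
Proof.
move=> cf; apply: (measurability _ (RGenOpens.measurableE R)).
move=> _ [_ [a [b ->] <-]]; rewrite setTI; apply: open_measurable_plane.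
by move/continuousP : cf; apply; exact: interval_open.
Qed.

Lemma cell_measurable :
  measurable (cell : set (measurableTypeR R * measurableTypeR R)).
Proof. exact: measurableX. Qed.

Lemma cell_compact : compact (cell : set (R * R)).
Proof. by apply: compact_setX; exact: segment_compact. Qed.

Lemma leb2_cell : leb2 cell = (((2 * pi) ^+ 2 : R)%:E).
Proof.
rewrite /leb2/= product_measure1E//= lebesgue_measure_itv/= lte_fin.
by rewrite mulr_gt0// ?pi_gt0// -EFinB subr0 -EFinM expr2.
Qed.

Lemma leb2_cell_fin : (leb2 (cell : set (R * R)) < +oo)%E.
Proof. by rewrite leb2_cell ltry. Qed.

Lemma continuous_bounded_cell f : continuous f ->
  exists2 M, 0 < M & forall x, cell x -> `|f x| <= M.
Proof.
move=> cf.
have /compact_bounded[M [_ fM]] : compact (f @` cell).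
  exact: (continuous_compact (continuous_subspaceT cf) cell_compact).
exists (`|M| + 1) => [|x cx]; first by rewrite ltr_wpDl.
by apply: (fM (`|M| + 1)); [rewrite (le_lt_trans (ler_norm M))// ltrDl|exists x].
Qed.

Lemma continuous_integrable f : continuous f ->
  leb2.-integrable cell (EFin \o f).
Proof.
move=> cf; apply: (measurable_bounded_integrable cell_measurable leb2_cell_fin).
- by apply: measurable_funTS; exact: continuous_measurable_plane.
- have [M M0 fM] := continuous_bounded_cell cf.
  exists M; split; first exact: num_real.
  by move=> y My x cx; apply: le_trans (fM _ cx) _; exact: ltW.
Qed.

Definition tint f : R := \int[leb2]_(x in cell) f x.

Lemma eq_tint f g : f =1 g -> tint f = tint g.
Proof. by move=> fg; apply: eq_Rintegral => x _; exact: fg. Qed.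

Lemma tintD f g : continuous f -> continuous g ->
  tint (fun x => f x + g x) = tint f + tint g.
Proof.
by move=> cf cg; apply: RintegralD; [exact: cell_measurable|
  exact: continuous_integrable|exact: continuous_integrable].
Qed.

Lemma tintB f g : continuous f -> continuous g ->
  tint (fun x => f x - g x) = tint f - tint g.
Proof.
by move=> cf cg; apply: RintegralB; [exact: cell_measurable|
  exact: continuous_integrable|exact: continuous_integrable].
Qed.

Lemma tintZ (c : R) f : continuous f -> tint (fun x => c * f x) = c * tint f.
Proof.
by move=> cf; apply: RintegralZl; [exact: cell_measurable|exact: continuous_integrable].
Qed.

Lemma tint_cst (c : R) : tint (fun=> c) = c * (2 * pi) ^+ 2.
Proof. by rewrite /tint Rintegral_cst ?leb2_cell//; exact: cell_measurable. Qed.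

Lemma le_tint f g : continuous f -> continuous g ->
  (forall x, cell x -> f x <= g x) -> tint f <= tint g.
Proof.
by move=> cf cg fg; apply: le_Rintegral => //; [exact: cell_measurable|
  exact: continuous_integrable|exact: continuous_integrable].
Qed.

Lemma tint_ge0 f : (forall x, cell x -> 0 <= f x) -> 0 <= tint f.
Proof. by move=> f0; apply: Rintegral_ge0 => x cx; exact: f0. Qed.

Lemma le_norm_tint f : continuous f -> `|tint f| <= tint (fun x => `|f x|).
Proof.
by move=> cf; apply: le_normr_Rintegral; [exact: cell_measurable|
  exact: continuous_integrable].
Qed.

Lemma continuous_sum (I : Type) (s : seq I) (F : I -> R * R -> R) :
  (forall i, continuous (F i)) -> continuous (fun x => \sum_(i <- s) F i x).
Proof.
move=> cF; elim: s => [|i s IH].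
  by under eq_fun do rewrite big_nil; exact: cst_continuous.
under eq_fun do rewrite big_cons.
by move=> x; apply: continuousD; [exact: cF|exact: IH].
Qed.

Lemma tint_sum (I : Type) (s : seq I) (F : I -> R * R -> R) :
  (forall i, continuous (F i)) ->
  tint (fun x => \sum_(i <- s) F i x) = \sum_(i <- s) tint (F i).
Proof.
move=> cF; elim: s => [|i s IH].
  by under eq_tint do rewrite big_nil; rewrite tint_cst mul0r big_nil.
under eq_tint do rewrite big_cons.
by rewrite big_cons tintD ?IH//; exact: continuous_sum.
Qed.

(** Fubini's theorem is applied on the whole plane to the integrand extended by zero; the condition
    of lying in the cell is then recovered one coordinate at a time. *)
Lemma fubini_tint21 f : continuous f ->
  (tint f)%:E = (\int[lebesgue_measure]_(y in `[0%R, (2 * pi)%R])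
    \int[lebesgue_measure]_(x in `[0%R, (2 * pi)%R]) (f (x, y))%:E)%E.
Proof.
move=> cf.
have fi := continuous_integrable cf.
have mc := cell_measurable.
rewrite /tint /Rintegral fineK; last exact: integrable_fin_num.
rewrite integral_mkcond -integral21_prod_meas1; last by apply/integrable_restrict => //; rewrite setTI.
rewrite [RHS]integral_mkcond; apply: eq_integral => y _.
rewrite /fubini_G patchE; case: ifPn => [|/negP] yc.
  rewrite [RHS]integral_mkcond; apply: eq_integral => x _.
  rewrite !patchE; congr (if _ then _ else _).
  apply/idP/idP; rewrite !inE => //=; first by case.
  by move=> ?; split=> //=; move: yc; rewrite inE.
rewrite integral0_eq// => x _; rewrite patchE ifF//.
by apply/negP => /set_mem[/= _ yc']; apply: yc; exact/mem_set.
Qed.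

Lemma fubini_tint12 f : continuous f ->
  (tint f)%:E = (\int[lebesgue_measure]_(x in `[0%R, (2 * pi)%R])
    \int[lebesgue_measure]_(y in `[0%R, (2 * pi)%R]) (f (x, y))%:E)%E.
Proof.
move=> cf.
have fi := continuous_integrable cf.
have mc := cell_measurable.
rewrite /tint /Rintegral fineK; last exact: integrable_fin_num.
rewrite integral_mkcond -integral12_prod_meas1; last by apply/integrable_restrict => //; rewrite setTI.
rewrite [RHS]integral_mkcond; apply: eq_integral => x _.
rewrite /fubini_F patchE; case: ifPn => [|/negP] xc.
  rewrite [RHS]integral_mkcond; apply: eq_integral => y _.
  rewrite !patchE; congr (if _ then _ else _).
  apply/idP/idP; rewrite !inE => //=; first by case.
  by move=> ?; split=> //=; move: xc; rewrite inE.
rewrite integral0_eq// => y _; rewrite patchE ifF//.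
by apply/negP => /set_mem[/= xc' _]; apply: xc; exact/mem_set.
Qed.

(** On each horizontal line the fundamental theorem of calculus leaves the difference of the values
    at the two ends of a period, which vanishes by periodicity. *)
Lemma tint_d1 f : torus_periodic f -> (forall x, differentiable f x) ->
  continuous (d1 f) -> tint (d1 f) = 0.
Proof.
move=> pf df cf; apply: EFin_inj; rewrite fubini_tint21//.
apply: integral0_eq => y _.
have dfy (x : R) : is_derive x 1 (fun x => f (x, y)) (d1 f (x, y)).
  have E : (fun h : R => h^-1 *: (f (h *: (1 : R) + x, y) - f (x, y))) =
           (fun h : R => h^-1 *: (f (h *: ((1, 0) : R * R) + (x, y)) - f (x, y))).
    apply/funext => h; congr (_ *: (f _ - _)).
    by apply/pair_equal_spec; rewrite /= scaler0 add0r.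
  have D v : derivable f (x, y) v by exact: diff_derivable.
  split; first by rewrite /derivable E; exact: D.
  by rewrite /derive E.
rewrite (@continuous_FTC2 _ _ (fun x => f (x, y))).
- have /= := (pf (0, y)).1; rewrite add0r => ->; exact: subee.
- by rewrite mulr_gt0// pi_gt0.
- apply: continuous_subspaceT => x; apply: (@continuous_comp _ _ _ (fun x => (x, y))).
    exact: (cvg_pair cvg_id (cvg_cst y)).
  exact: cf.
- have cfy (x : R) : {for x, continuous (fun x => f (x, y))}.
    by apply/differentiable_continuous/derivable1_diffP; case: (dfy x).
  by split; [move=> x _; case: (dfy x)|exact/cvg_at_right_filter/cfy|
    exact/cvg_at_left_filter/cfy].
- by move=> x _; rewrite derive1E; case: (dfy x).
Qed.

Lemma tint_d2 f : torus_periodic f -> (forall x, differentiable f x) ->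
  continuous (d2 f) -> tint (d2 f) = 0.
Proof.
move=> pf df cf; apply: EFin_inj; rewrite fubini_tint12//.
apply: integral0_eq => y _.
have dfy (x : R) : is_derive x 1 (fun x => f (y, x)) (d2 f (y, x)).
  have E : (fun h : R => h^-1 *: (f (y, h *: (1 : R) + x) - f (y, x))) =
           (fun h : R => h^-1 *: (f (h *: ((0, 1) : R * R) + (y, x)) - f (y, x))).
    apply/funext => h; congr (_ *: (f _ - _)).
    by apply/pair_equal_spec; rewrite /= scaler0 add0r.
  have D v : derivable f (y, x) v by exact: diff_derivable.
  split; first by rewrite /derivable E; exact: D.
  by rewrite /derive E.
rewrite (@continuous_FTC2 _ _ (fun x => f (y, x))).
- have /= := (pf (y, 0)).2; rewrite add0r => ->; exact: subee.
- by rewrite mulr_gt0// pi_gt0.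
- apply: continuous_subspaceT => x; apply: (@continuous_comp _ _ _ (fun x => (y, x))).
    exact: (cvg_pair (cvg_cst y) cvg_id).
  exact: cf.
- have cfy (x : R) : {for x, continuous (fun x => f (y, x))}.
    by apply/differentiable_continuous/derivable1_diffP; case: (dfy x).
  by split; [move=> x _; case: (dfy x)|exact/cvg_at_right_filter/cfy|
    exact/cvg_at_left_filter/cfy].
- by move=> x _; rewrite derive1E; case: (dfy x).
Qed.

End CellIntegral.

(** * Fourier series of continuous periodic functions *)

Section FourierCoefficients.
Context {R : realType}.
Implicit Types (f g h : R * R -> R) (k l : int * int) (x : R * R).

Definition ecos k : R * R -> R := fun x => cos (phase k x).
Definition esin k : R * R -> R := fun x => sin (phase k x).

Lemma phaseD k l x : phase (k + l) x = phase k x + phase l x.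
Proof. by rewrite /phase/= !intrD !mulrDl addrACA. Qed.

Lemma phaseN k x : phase (- k) x = - phase k x.
Proof. by rewrite /phase/= !intrN !mulNr opprD. Qed.

Lemma phaseB k l x : phase (k - l) x = phase k x - phase l x.
Proof. by rewrite phaseD phaseN. Qed.

Lemma phase_sub k x y : phase k (x - y) = phase k x - phase k y.
Proof. by rewrite /phase/= !mulrBr opprD addrACA. Qed.

Lemma differentiable_fst x : differentiable (fst : R * R -> R) x.
Proof.
pose F : {linear (R * R)%type -> R^o} := fst.
have cF : continuous F by move=> y; exact: cvg_fst.
by have /= := @linear_differentiable R (R * R)%type R F x cF.
Qed.

Lemma differentiable_snd x : differentiable (snd : R * R -> R) x.
Proof.
pose F : {linear (R * R)%type -> R^o} := snd.
have cF : continuous F by move=> y; exact: cvg_snd.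
by have /= := @linear_differentiable R (R * R)%type R F x cF.
Qed.

Lemma differentiable_phase k x : differentiable (phase k : R * R -> R) x.
Proof.
apply: (@differentiableD _ _ _ (fun x : R * R => k.1%:~R * x.1) (fun x : R * R => k.2%:~R * x.2)).
  apply: (@differentiableZ _ _ _ (fst : R * R -> R)).
  exact: differentiable_fst.
apply: (@differentiableZ _ _ _ (snd : R * R -> R)).
exact: differentiable_snd.
Qed.

Lemma d1_phase k x : d1 (phase k) x = k.1%:~R :> R.
Proof.
apply: cvg_lim => //; apply: cvg_near_cst; near=> h.
have h0 : h != 0 by near: h; exact: nbhs_dnbhs_neq.
have -> : phase k (h *: ((1, 0) : R * R) + x) - phase k x = h * k.1%:~R.
  by rewrite /phase/= /GRing.scale/=; ring.
by rewrite /GRing.scale/= mulrA mulVf ?mul1r.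
Unshelve. all: by end_near. Qed.

Lemma d2_phase k x : d2 (phase k) x = k.2%:~R :> R.
Proof.
apply: cvg_lim => //; apply: cvg_near_cst; near=> h.
have h0 : h != 0 by near: h; exact: nbhs_dnbhs_neq.
have -> : phase k (h *: ((0, 1) : R * R) + x) - phase k x = h * k.2%:~R.
  by rewrite /phase/= /GRing.scale/=; ring.
by rewrite /GRing.scale/= mulrA mulVf ?mul1r.
Unshelve. all: by end_near. Qed.

Lemma continuous_phase k : continuous (phase k : R * R -> R).
Proof. by move=> x; apply: differentiable_continuous; exact: differentiable_phase. Qed.

Lemma continuous_ecos k : continuous (ecos k).
Proof.
by move=> x; apply: (@continuous_comp _ _ _ (phase k) cos);
  [exact: continuous_phase|exact: continuous_cos].
Qed.

Lemma continuous_esin k : continuous (esin k).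
Proof.
by move=> x; apply: (@continuous_comp _ _ _ (phase k) sin);
  [exact: continuous_phase|exact: continuous_sin].
Qed.

Lemma differentiable_ecos k x : differentiable (ecos k) x.
Proof.
apply: (@differentiable_comp _ _ _ _ (phase k) cos).
  exact: differentiable_phase.
by apply/derivable1_diffP; exact: derivable_cos.
Qed.

Lemma differentiable_esin k x : differentiable (esin k) x.
Proof.
apply: (@differentiable_comp _ _ _ _ (phase k) sin).
  exact: differentiable_phase.
by apply/derivable1_diffP; exact: derivable_sin.
Qed.

Lemma derive_comp_phase k x (F : R -> R) (v : R * R) : derivable F (phase k x) 1 ->
  'D_v (F \o phase k) x = 'D_v (phase k) x * derive1 F (phase k x).
Proof.
move=> /derivable1_diffP dF.
rewrite !deriveE; [|exact: differentiable_phase|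
  by apply: differentiable_comp => //; exact: differentiable_phase].
rewrite diff_comp//=; last exact: differentiable_phase.
by rewrite deriv1E//; exact/derivable1_diffP.
Qed.

Lemma d1_ecos k x : d1 (ecos k) x = - k.1%:~R * esin k x.
Proof.
rewrite /d1 derive_comp_phase; last exact: derivable_cos.
by rewrite -/(d1 _ x) d1_phase derive1E derive_val mulrN mulNr.
Qed.

Lemma d2_ecos k x : d2 (ecos k) x = - k.2%:~R * esin k x.
Proof.
rewrite /d2 derive_comp_phase; last exact: derivable_cos.
by rewrite -/(d2 _ x) d2_phase derive1E derive_val mulrN mulNr.
Qed.

Lemma d1_esin k x : d1 (esin k) x = k.1%:~R * ecos k x.
Proof.
rewrite /d1 derive_comp_phase; last exact: derivable_sin.
by rewrite -/(d1 _ x) d1_phase derive1E derive_val.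
Qed.

Lemma d2_esin k x : d2 (esin k) x = k.2%:~R * ecos k x.
Proof.
rewrite /d2 derive_comp_phase; last exact: derivable_sin.
by rewrite -/(d2 _ x) d2_phase derive1E derive_val.
Qed.

Lemma periodicz (F : R -> R) (T a : R) (z : int) :
  periodic F T -> F (a + z%:~R * T) = F a.
Proof.
move=> FT; case: z => n; rewrite ?NegzE ?mulrNz -pmulrn ?mulNr mulr_natl.
  exact: periodicn.
by rewrite -[LHS](periodicn FT n.+1) subrK.
Qed.

Lemma cosD2piz (a : R) (z : int) : cos (a + z%:~R * (2 * pi)) = cos a.
Proof. by apply: periodicz; rewrite mulr_natl; exact: cosD2pi. Qed.

Lemma sinD2piz (a : R) (z : int) : sin (a + z%:~R * (2 * pi)) = sin a.
Proof. by apply: periodicz; rewrite mulr_natl; exact: sinD2pi. Qed.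

Lemma phase_periodic k x :
  phase k (x.1 + 2 * pi, x.2) = phase k x + k.1%:~R * (2 * pi) /\
  phase k (x.1, x.2 + 2 * pi) = phase k x + k.2%:~R * (2 * pi).
Proof. by rewrite /phase/=; split; ring. Qed.

Lemma ecos_periodic k : torus_periodic (ecos k).
Proof.
by move=> x; rewrite /ecos (phase_periodic k x).1 (phase_periodic k x).2 !cosD2piz.
Qed.

Lemma esin_periodic k : torus_periodic (esin k).
Proof.
by move=> x; rewrite /esin (phase_periodic k x).1 (phase_periodic k x).2 !sinD2piz.
Qed.

Lemma continuousMR f g : continuous f -> continuous g -> continuous (fun x => f x * g x).
Proof. by move=> cf cg x; apply: continuousM; [exact: cf|exact: cg]. Qed.

Lemma continuousZR (c : R) f : continuous f -> continuous (fun x => c * f x).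
Proof. by move=> cf; apply: continuousMR => //; exact: cst_continuous. Qed.

Lemma continuousDR f g : continuous f -> continuous g -> continuous (fun x => f x + g x).
Proof. by move=> cf cg x; apply: continuousD; [exact: cf|exact: cg]. Qed.

Lemma continuousBR f g : continuous f -> continuous g -> continuous (fun x => f x - g x).
Proof. by move=> cf cg x; apply: continuousB; [exact: cf|exact: cg]. Qed.

Lemma tint_parts1 f g : torus_periodic f -> torus_periodic g -> Cn 1 f -> Cn 1 g ->
  tint (fun x => d1 f x * g x) = - tint (fun x => f x * d1 g x).
Proof.
move=> pf pg [df cf1 cf2] [dg cg1 cg2].
have cf : continuous f by move=> x; exact: differentiable_continuous.
have cg : continuous g by move=> x; exact: differentiable_continuous.
apply/eqP; rewrite -addr_eq0 -tintD; [|exact: continuousMR|exact: continuousMR].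
have E : (fun x => d1 f x * g x + f x * d1 g x) = d1 (fun x => f x * g x).
  apply/funext => x; rewrite /d1 deriveM; [|exact: diff_derivable|exact: diff_derivable].
  by rewrite /GRing.scale/= addrC mulrC [X in _ + X]mulrC.
rewrite E tint_d1//.
- by move=> x; rewrite (pf x).1 (pf x).2 (pg x).1 (pg x).2.
- by move=> x; exact: differentiableM.
- by rewrite -E; apply: continuousDR; exact: continuousMR.
Qed.

Lemma tint_parts2 f g : torus_periodic f -> torus_periodic g -> Cn 1 f -> Cn 1 g ->
  tint (fun x => d2 f x * g x) = - tint (fun x => f x * d2 g x).
Proof.
move=> pf pg [df cf1 cf2] [dg cg1 cg2].
have cf : continuous f by move=> x; exact: differentiable_continuous.
have cg : continuous g by move=> x; exact: differentiable_continuous.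
apply/eqP; rewrite -addr_eq0 -tintD; [|exact: continuousMR|exact: continuousMR].
have E : (fun x => d2 f x * g x + f x * d2 g x) = d2 (fun x => f x * g x).
  apply/funext => x; rewrite /d2 deriveM; [|exact: diff_derivable|exact: diff_derivable].
  by rewrite /GRing.scale/= addrC mulrC [X in _ + X]mulrC.
rewrite E tint_d2//.
- by move=> x; rewrite (pf x).1 (pf x).2 (pg x).1 (pg x).2.
- by move=> x; exact: differentiableM.
- by rewrite -E; apply: continuousDR; exact: continuousMR.
Qed.

Lemma Cn1_ecos k : Cn 1 (ecos k).
Proof.
split; first by move=> x; exact: differentiable_ecos.
  by have -> : d1 (ecos k) = (fun x => - k.1%:~R * esin k x) by [apply/funext => x; rewrite d1_ecos]; apply: continuousZR; exact: continuous_esin.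
by have -> : d2 (ecos k) = (fun x => - k.2%:~R * esin k x) by [apply/funext => x; rewrite d2_ecos]; apply: continuousZR; exact: continuous_esin.
Qed.

Lemma Cn1_esin k : Cn 1 (esin k).
Proof.
split; first by move=> x; exact: differentiable_esin.
  by have -> : d1 (esin k) = (fun x => k.1%:~R * ecos k x) by [apply/funext => x; rewrite d1_esin]; apply: continuousZR; exact: continuous_ecos.
by have -> : d2 (esin k) = (fun x => k.2%:~R * ecos k x) by [apply/funext => x; rewrite d2_esin]; apply: continuousZR; exact: continuous_ecos.
Qed.

(** Real Fourier data: the complex coefficient of [f] at [k] is [cc f k - i sc f k]. For continuous
    [f], [cc] is even and [sc] is odd in [k]. *)
Definition cc f k : R := (2 * pi) ^- 2 * tint (fun x => f x * ecos k x).
Definition sc f k : R := (2 * pi) ^- 2 * tint (fun x => f x * esin k x).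

Lemma fourier_sqE f k : fourier_sq f k = cc f k ^+ 2 + sc f k ^+ 2.
Proof. by []. Qed.

(** Multiplication of [cc - i sc] by [i k_1], read off in real and imaginary parts; the next three
    lemmas complete the rule for both coordinates. *)
Lemma cc_d1 f k : torus_periodic f -> Cn 1 f -> cc (d1 f) k = k.1%:~R * sc f k.
Proof.
move=> pf cf; rewrite /cc tint_parts1//; [|exact: ecos_periodic|exact: Cn1_ecos].
under eq_tint do rewrite d1_ecos mulrCA.
rewrite tintZ; first by rewrite /sc; ring.
apply: continuousMR; last exact: continuous_esin.
by case: cf => df _ _ x; exact: differentiable_continuous.
Qed.

Lemma sc_d1 f k : torus_periodic f -> Cn 1 f -> sc (d1 f) k = - k.1%:~R * cc f k.
Proof.
move=> pf cf; rewrite /sc tint_parts1//; [|exact: esin_periodic|exact: Cn1_esin].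
under eq_tint do rewrite d1_esin mulrCA.
rewrite tintZ; first by rewrite /cc; ring.
apply: continuousMR; last exact: continuous_ecos.
by case: cf => df _ _ x; exact: differentiable_continuous.
Qed.

Lemma cc_d2 f k : torus_periodic f -> Cn 1 f -> cc (d2 f) k = k.2%:~R * sc f k.
Proof.
move=> pf cf; rewrite /cc tint_parts2//; [|exact: ecos_periodic|exact: Cn1_ecos].
under eq_tint do rewrite d2_ecos mulrCA.
rewrite tintZ; first by rewrite /sc; ring.
apply: continuousMR; last exact: continuous_esin.
by case: cf => df _ _ x; exact: differentiable_continuous.
Qed.

Lemma sc_d2 f k : torus_periodic f -> Cn 1 f -> sc (d2 f) k = - k.2%:~R * cc f k.
Proof.
move=> pf cf; rewrite /sc tint_parts2//; [|exact: esin_periodic|exact: Cn1_esin].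
under eq_tint do rewrite d2_esin mulrCA.
rewrite tintZ; first by rewrite /cc; ring.
apply: continuousMR; last exact: continuous_ecos.
by case: cf => df _ _ x; exact: differentiable_continuous.
Qed.

End FourierCoefficients.

(** * Orthogonality, partial sums and best approximation *)

Section PartialSums.
Context {R : realType}.
Implicit Types (f g h : R * R -> R) (k l : int * int) (x : R * R).

(** For [k != 0] some coordinate of [k] is nonzero, and up to this factor the cosine is the
    derivative of a periodic sine in that direction. *)
Lemma tint_ecos k : tint (ecos k) = (k == 0)%:R * (2 * pi) ^+ 2 :> R.
Proof.
have [->|k0] := eqVneq k 0.
  rewrite mul1r -[RHS]mul1r -tint_cst; apply: eq_tint => x.
  by rewrite /ecos /phase/= !mul0r addr0 cos0.
rewrite mul0r; have [k1|k1] := eqVneq k.1 0.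
  have k2 : k.2 != 0.
    by apply: contraNneq k0 => k2; rewrite [k]surjective_pairing k1 k2.
  have := @tint_d2 R _ (@esin_periodic R k) (differentiable_esin k).
  have -> : d2 (esin k) = (fun x : R * R => k.2%:~R * ecos k x).
    by apply/funext => x; rewrite d2_esin.
  move=> /(_ (continuousZR (@continuous_ecos R k))).
  rewrite tintZ; last exact: continuous_ecos.
  by move/eqP; rewrite mulf_eq0 intr_eq0 (negbTE k2) => /eqP.
have := @tint_d1 R _ (@esin_periodic R k) (differentiable_esin k).
have -> : d1 (esin k) = (fun x : R * R => k.1%:~R * ecos k x).
  by apply/funext => x; rewrite d1_esin.
move=> /(_ (continuousZR (@continuous_ecos R k))).
rewrite tintZ; last exact: continuous_ecos.
by move/eqP; rewrite mulf_eq0 intr_eq0 (negbTE k1) => /eqP.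
Qed.

Lemma tint_esin k : tint (esin k) = 0 :> R.
Proof.
have [->|k0] := eqVneq k 0.
  rewrite -[RHS](mul0r ((2 * pi) ^+ 2)) -tint_cst; apply: eq_tint => x.
  by rewrite /esin /phase/= !mul0r addr0 sin0.
have [k1|k1] := eqVneq k.1 0.
  have k2 : k.2 != 0.
    by apply: contraNneq k0 => k2; rewrite [k]surjective_pairing k1 k2.
  have := @tint_d2 R _ (@ecos_periodic R k) (differentiable_ecos k).
  have -> : d2 (ecos k) = (fun x : R * R => - k.2%:~R * esin k x).
    by apply/funext => x; rewrite d2_ecos.
  move=> /(_ (continuousZR (@continuous_esin R k))).
  rewrite tintZ; last exact: continuous_esin.
  by move/eqP; rewrite mulf_eq0 oppr_eq0 intr_eq0 (negbTE k2) => /eqP.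
have := @tint_d1 R _ (@ecos_periodic R k) (differentiable_ecos k).
have -> : d1 (ecos k) = (fun x : R * R => - k.1%:~R * esin k x).
  by apply/funext => x; rewrite d1_ecos.
move=> /(_ (continuousZR (@continuous_esin R k))).
rewrite tintZ; last exact: continuous_esin.
by move/eqP; rewrite mulf_eq0 oppr_eq0 intr_eq0 (negbTE k1) => /eqP.
Qed.

Lemma twopi_sq_neq0 : (2 * pi) ^+ 2 != 0 :> R.
Proof. by rewrite expf_neq0// mulf_neq0// gt_eqF// pi_gt0. Qed.

Lemma twopi_sq_gt0 : 0 < (2 * pi) ^+ 2 :> R.
Proof. by rewrite exprn_gt0// mulr_gt0// pi_gt0. Qed.

Lemma tintE_cc f k : tint (fun x => f x * ecos k x) = (2 * pi) ^+ 2 * cc f k.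
Proof. by rewrite /cc mulrA mulfV ?mul1r// twopi_sq_neq0. Qed.

Lemma tintE_sc f k : tint (fun x => f x * esin k x) = (2 * pi) ^+ 2 * sc f k.
Proof. by rewrite /sc mulrA mulfV ?mul1r// twopi_sq_neq0. Qed.

Lemma ecosN k x : ecos (- k) x = ecos k x :> R.
Proof. by rewrite /ecos phaseN cosN. Qed.

Lemma esinN k x : esin (- k) x = - esin k x :> R.
Proof. by rewrite /esin phaseN sinN. Qed.

Lemma ccN f k : cc f (- k) = cc f k.
Proof. by congr (_ * _); apply: eq_tint => x; rewrite ecosN. Qed.

Lemma scN f k : continuous f -> sc f (- k) = - sc f k.
Proof.
move=> cf; rewrite /sc -mulrN; congr (_ * _).
rewrite -mulN1r -tintZ; last by apply: continuousMR => //; exact: continuous_esin.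
by apply: eq_tint => x; rewrite esinN; ring.
Qed.

Lemma ccD f g k : continuous f -> continuous g ->
  cc (fun x => f x + g x) k = cc f k + cc g k.
Proof.
move=> cf cg; have ce := @continuous_ecos R k; rewrite /cc -mulrDr -tintD; [|exact: continuousMR|exact: continuousMR].
by congr (_ * _); apply: eq_tint => x; rewrite mulrDl.
Qed.

Lemma scD f g k : continuous f -> continuous g ->
  sc (fun x => f x + g x) k = sc f k + sc g k.
Proof.
move=> cf cg; have ce := @continuous_esin R k; rewrite /sc -mulrDr -tintD; [|exact: continuousMR|exact: continuousMR].
by congr (_ * _); apply: eq_tint => x; rewrite mulrDl.
Qed.

Lemma ccZ (a : R) f k : continuous f -> cc (fun x => a * f x) k = a * cc f k.
Proof.
move=> cf; have ce := @continuous_ecos R k; rewrite /cc [RHS]mulrCA -(tintZ a); last exact: continuousMR.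
by congr (_ * _); apply: eq_tint => x; rewrite mulrA.
Qed.

Lemma scZ (a : R) f k : continuous f -> sc (fun x => a * f x) k = a * sc f k.
Proof.
move=> cf; have ce := @continuous_esin R k; rewrite /sc [RHS]mulrCA -(tintZ a); last exact: continuousMR.
by congr (_ * _); apply: eq_tint => x; rewrite mulrA.
Qed.

Lemma ccB f g k : continuous f -> continuous g ->
  cc (fun x => f x - g x) k = cc f k - cc g k.
Proof.
move=> cf cg; rewrite -[- cc g k]mulN1r -ccZ// -ccD//; last exact: continuousZR.
by congr (_ * _); apply: eq_tint => x; rewrite mulN1r.
Qed.

Lemma scB f g k : continuous f -> continuous g ->
  sc (fun x => f x - g x) k = sc f k - sc g k.
Proof.
move=> cf cg; rewrite -[- sc g k]mulN1r -scZ// -scD//; last exact: continuousZR.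
by congr (_ * _); apply: eq_tint => x; rewrite mulN1r.
Qed.

Lemma cc_sum (I : Type) (s : seq I) (F : I -> R * R -> R) k :
  (forall i, continuous (F i)) ->
  cc (fun x => \sum_(i <- s) F i x) k = \sum_(i <- s) cc (F i) k.
Proof.
move=> cF; elim: s => [|i s IH].
  rewrite big_nil -[RHS](mulr0 ((2 * pi) ^- 2)); congr (_ * _).
  rewrite -[RHS](mul0r ((2 * pi) ^+ 2)) -tint_cst; apply: eq_tint => x.
  by rewrite big_nil mul0r.
rewrite big_cons -IH -ccD//; last exact: continuous_sum.
by congr (_ * _); apply: eq_tint => x; rewrite big_cons.
Qed.

Lemma sc_sum (I : Type) (s : seq I) (F : I -> R * R -> R) k :
  (forall i, continuous (F i)) ->
  sc (fun x => \sum_(i <- s) F i x) k = \sum_(i <- s) sc (F i) k.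
Proof.
move=> cF; elim: s => [|i s IH].
  rewrite big_nil -[RHS](mulr0 ((2 * pi) ^- 2)); congr (_ * _).
  rewrite -[RHS](mul0r ((2 * pi) ^+ 2)) -tint_cst; apply: eq_tint => x.
  by rewrite big_nil mul0r.
rewrite big_cons -IH -scD//; last exact: continuous_sum.
by congr (_ * _); apply: eq_tint => x; rewrite big_cons.
Qed.

(** Indexing by the whole lattice is redundant, since [l] and [- l] carry the same cosine and
    opposite sines. The pairing therefore sees both [k] and [- k], each with weight one half. *)
Lemma cc_ecos l k : cc (ecos l) k = 2^-1 * ((l == k)%:R + (l == - k)%:R) :> R.
Proof.
have E x : ecos l x * ecos k x = 2^-1 * (ecos (l - k) x + ecos (l + k) x) :> R.
  by rewrite /ecos phaseB phaseD cosB cosD; field.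
rewrite /cc; under eq_tint do rewrite E.
have c1 := @continuous_ecos R (l - k); have c2 := @continuous_ecos R (l + k).
rewrite tintZ ?tintD ?tint_ecos//; last exact: continuousDR.
by rewrite subr_eq0 addr_eq0; have := twopi_sq_neq0; move: (_ ^+ 2) => c c0; field.
Qed.

Lemma sc_ecos l k : sc (ecos l) k = 0 :> R.
Proof.
have E x : ecos l x * esin k x = 2^-1 * (esin (l + k) x - esin (l - k) x) :> R.
  by rewrite /ecos /esin phaseB phaseD sinB sinD; field.
rewrite /sc; under eq_tint do rewrite E.
have c1 := @continuous_esin R (l - k); have c2 := @continuous_esin R (l + k).
rewrite tintZ ?tintB ?tint_esin ?subrr ?mulr0//; exact: continuousBR.
Qed.

Lemma cc_esin l k : cc (esin l) k = 0 :> R.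
Proof.
have E x : esin l x * ecos k x = 2^-1 * (esin (l + k) x + esin (l - k) x) :> R.
  by rewrite /ecos /esin phaseB phaseD sinB sinD; field.
rewrite /cc; under eq_tint do rewrite E.
have c1 := @continuous_esin R (l - k); have c2 := @continuous_esin R (l + k).
rewrite tintZ ?tintD ?tint_esin ?addr0 ?mulr0//; exact: continuousDR.
Qed.

Lemma sc_esin l k : sc (esin l) k = 2^-1 * ((l == k)%:R - (l == - k)%:R) :> R.
Proof.
have E x : esin l x * esin k x = 2^-1 * (ecos (l - k) x - ecos (l + k) x) :> R.
  by rewrite /ecos /esin phaseB phaseD cosB cosD; field.
rewrite /sc; under eq_tint do rewrite E.
have c1 := @continuous_ecos R (l - k); have c2 := @continuous_ecos R (l + k).
rewrite tintZ ?tintB ?tint_ecos//; last exact: continuousBR.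
by rewrite subr_eq0 addr_eq0; have := twopi_sq_neq0; move: (_ ^+ 2) => c c0; field.
Qed.

Definition box (n : nat) : seq (int * int) :=
  [seq (i, j) | i <- [seq i%:Z - n%:Z | i <- iota 0 n.*2.+1],
                j <- [seq i%:Z - n%:Z | i <- iota 0 n.*2.+1]].

Lemma mem_box n k : (k \in box n) = (`|k.1| <= n%:Z) && (`|k.2| <= n%:Z).
Proof.
have E (i : int) : (i \in [seq i%:Z - n%:Z | i <- iota 0 n.*2.+1]) = (`|i| <= n%:Z).
  apply/mapP/idP => [[j]|ni].
    by rewrite mem_iota => /andP[j0 jn] ->; lia.
  exists (absz (i + n%:Z)); last by lia.
  by rewrite mem_iota; lia.
rewrite [k]surjective_pairing; apply/allpairsP/idP => /= [[[i j]/= [ii jj [-> ->]]]|].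
  by rewrite -!E ii jj.
by move=> /andP[k1 k2]; exists k; rewrite !E k1 k2 -surjective_pairing.
Qed.

Lemma uniq_box n : uniq (box n).
Proof.
apply: allpairs_uniq; last by move=> [a b] [c d].
  by rewrite map_inj_uniq ?iota_uniq// => i j /addIr[].
by rewrite map_inj_uniq ?iota_uniq// => i j /addIr[].
Qed.

Lemma box_oppr n k : (- k \in box n) = (k \in box n).
Proof. by rewrite !mem_box/= !normrN. Qed.

Lemma sum_delta (s : seq (int * int)) (a : int * int -> R) k : uniq s -> k \in s ->
  \sum_(l <- s) (l == k)%:R * a l = a k.
Proof.
move=> us ks; rewrite (bigD1_seq k)//= eqxx mul1r big1 ?addr0// => l /negbTE ->.
by rewrite mul0r.
Qed.

Definition trig (s : seq (int * int)) (a b : int * int -> R) : R * R -> R :=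
  fun x => \sum_(l <- s) (a l * ecos l x + b l * esin l x).

Lemma continuous_trig_term (a b : int * int -> R) l :
  continuous (fun x : R * R => a l * ecos l x + b l * esin l x).
Proof.
by apply: continuousDR; apply: continuousZR; [exact: continuous_ecos|exact: continuous_esin].
Qed.

Lemma continuous_trig s a b : continuous (trig s a b).
Proof. by apply: continuous_sum => l; exact: continuous_trig_term. Qed.

Lemma tint_trigM s a b h : continuous h ->
  tint (fun x => trig s a b x * h x) =
  (2 * pi) ^+ 2 * \sum_(l <- s) (a l * cc h l + b l * sc h l).
Proof.
move=> ch; have ce l := @continuous_ecos R l; have cs l := @continuous_esin R l.
under eq_tint do rewrite /trig mulr_suml.
rewrite tint_sum; last first.
  by move=> l; apply: continuousMR => //; exact: continuous_trig_term.
rewrite mulr_sumr; apply: eq_bigr => l _.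
have c1 := continuousMR ch (ce l); have c2 := continuousMR ch (cs l).
rewrite (@eq_tint _ _ (fun x => a l * (h x * ecos l x) + b l * (h x * esin l x))); last first.
  by move=> x; ring.
by rewrite tintD ?tintZ ?tintE_cc ?tintE_sc//; [ring|exact: continuousZR|exact: continuousZR].
Qed.

(** The real form of the sum of g^(l) exp(i l . x) over the box. Both [l] and [- l] are in the box,
    so no factor 2 appears. *)
Definition psum n g : R * R -> R := trig (box n) (cc g) (sc g).

Lemma continuous_psum n g : continuous (psum n g).
Proof. exact: continuous_trig. Qed.

Lemma sum_delta_sym (n : nat) (a : int * int -> R) k : k \in box n ->
  \sum_(l <- box n) a l * (2^-1 * ((l == k)%:R + (l == - k)%:R)) = 2^-1 * (a k + a (- k)).
Proof.
move=> kn; rewrite (eq_bigr (fun l => 2^-1 * ((l == k)%:R * a l + (l == - k)%:R * a l))); last first.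
  by move=> l _; ring.
by rewrite -mulr_sumr big_split/= !sum_delta ?uniq_box ?box_oppr.
Qed.

Lemma sum_delta_asym (n : nat) (a : int * int -> R) k : k \in box n ->
  \sum_(l <- box n) a l * (2^-1 * ((l == k)%:R - (l == - k)%:R)) = 2^-1 * (a k - a (- k)).
Proof.
move=> kn; rewrite (eq_bigr (fun l => 2^-1 * ((l == k)%:R * a l - (l == - k)%:R * a l))); last first.
  by move=> l _; ring.
by rewrite -mulr_sumr sumrB !sum_delta ?uniq_box ?box_oppr.
Qed.

Lemma cc_psum n g k : k \in box n -> cc (psum n g) k = cc g k.
Proof.
move=> kn; have ce l := @continuous_ecos R l; have cs l := @continuous_esin R l.
rewrite cc_sum; last by move=> l; exact: continuous_trig_term.
under eq_bigr => l _.
  rewrite ccD ?ccZ ?cc_esin ?mulr0 ?addr0 ?cc_ecos//; try exact: continuousZR.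
  over.
by rewrite sum_delta_sym// ccN; field.
Qed.

Lemma sc_psum n g k : continuous g -> k \in box n -> sc (psum n g) k = sc g k.
Proof.
move=> cg kn; have ce l := @continuous_ecos R l; have cs l := @continuous_esin R l.
rewrite sc_sum; last by move=> l; exact: continuous_trig_term.
under eq_bigr => l _.
  rewrite scD ?scZ ?sc_ecos ?mulr0 ?add0r ?sc_esin//; try exact: continuousZR.
  over.
by rewrite sum_delta_asym// scN//; field.
Qed.

(** Pythagoras: the error has vanishing coefficients in the box, so it is orthogonal to the partial
    sum itself. *)
Lemma tint_err n g : continuous g ->
  tint (fun x => (g x - psum n g x) ^+ 2) =
  tint (fun x => g x ^+ 2) - (2 * pi) ^+ 2 * \sum_(l <- box n) fourier_sq g l.
Proof.
move=> cg; have cS := @continuous_psum n g.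
have cgS := continuousBR cg cS.
have -> : tint (fun x => (g x - psum n g x) ^+ 2) =
    tint (fun x => g x * (g x - psum n g x) - psum n g x * (g x - psum n g x)).
  by apply: eq_tint => x; ring.
rewrite tintB; [|exact: continuousMR|exact: continuousMR].
rewrite [X in _ - X]tint_trigM// [X in _ - _ * X]big_seq.
under [X in _ - _ * X]eq_bigr => l ln.
  rewrite ccB// scB// cc_psum// sc_psum// !subrr !mulr0 addr0.
  over.
rewrite big1// mulr0 subr0.
have -> : tint (fun x => g x * (g x - psum n g x)) =
    tint (fun x => g x * g x - psum n g x * g x).
  by apply: eq_tint => x; ring.
by rewrite tintB ?tint_trigM//; exact: continuousMR.
Qed.

(** The error is also orthogonal to the difference between the partial sum and the competitor. This
    transfers the approximation by Fejer means to the partial sums; the list [s] may contain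
    repetitions. *)
Lemma tint_err_best n g s a b : continuous g -> {subset s <= box n} ->
  tint (fun x => (g x - psum n g x) ^+ 2) <= tint (fun x => (g x - trig s a b x) ^+ 2).
Proof.
move=> cg sn; have cS := @continuous_psum n g; have cp := @continuous_trig s a b.
have cgS := continuousBR cg cS; have cSp := continuousBR cS cp.
have E0 s' a' b' : {subset s' <= box n} ->
    tint (fun x => trig s' a' b' x * (g x - psum n g x)) = 0.
  move=> s'n; rewrite tint_trigM// big_seq big1 ?mulr0// => l ls.
  by rewrite ccB// scB// cc_psum ?sc_psum ?s'n// !subrr !mulr0 addr0.
have -> : tint (fun x => (g x - trig s a b x) ^+ 2) =
    tint (fun x => ((g x - psum n g x) ^+ 2 + (psum n g x - trig s a b x) ^+ 2) +
      2 * (psum n g x * (g x - psum n g x) - trig s a b x * (g x - psum n g x))).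
  by apply: eq_tint => x; ring.
have c1 : continuous (fun x => (g x - psum n g x) ^+ 2) := continuousMR cgS cgS.
have c2 : continuous (fun x => (psum n g x - trig s a b x) ^+ 2) := continuousMR cSp cSp.
have c3 := continuousMR cS cgS; have c4 := continuousMR cp cgS.
rewrite tintD; [|exact: continuousDR|exact/continuousZR/continuousBR].
rewrite tintZ; last exact: continuousBR.
rewrite tintB// [X in _ * (X - _)]E0// [X in _ * (_ - X)]E0// subrr mulr0 addr0.
by rewrite tintD// lerDl tint_ge0// => x _; exact: sqr_ge0.
Qed.

End PartialSums.

(** * A trigonometric modulus of continuity *)

Section CosineModulus.
Context {R : realType}.
Implicit Types (f g h : R * R -> R) (k l : int * int) (x : R * R).

(** By evenness one may take [t >= 0]. Then 1 - cos t = 2 sin^2 (t/2), and this sine is positive for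
    0 < t < 2 pi. *)
Lemma cos_eq1 (t : R) : `|t| <= 2 * pi -> cos t = 1 -> [\/ t = 0, t = 2 * pi | t = - (2 * pi)].
Proof.
wlog t0 : t / 0 <= t => [H|].
  have [t0|t0] := leP 0 t; first exact: H.
  move=> tp ct; have [|||E|E|E] := H (- t); rewrite ?normrN ?cosN//.
  - by rewrite oppr_ge0 ltW.
  - by apply: Or31; move/eqP: E; rewrite oppr_eq0 => /eqP.
  - by apply: Or33; rewrite -E opprK.
  - by apply: Or32; exact: oppr_inj.
rewrite ger0_norm// => tp ct.
have [->|tn0] := eqVneq t 0; first exact: Or31.
have [->|tn2] := eqVneq t (2 * pi); first exact: Or32.
suff : 0 < sin (t / 2).
  have : cos (t / 2 *+ 2) = 1 by rewrite -mulr_natr -mulrA mulVf// mulr1.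
  rewrite cos_mulr2n cos2sin2 => E s0.
  have : sin (t / 2) ^+ 2 = 0 by move: E; rewrite mulr2n; lra.
  by move/eqP; rewrite sqrf_eq0 => /eqP s0'; rewrite s0' ltxx in s0.
have tgt0 : 0 < t by rewrite lt_neqAle eq_sym tn0.
have tlt2 : t < 2 * pi by rewrite lt_neqAle tn2.
by apply: sin_gt0_pi; lra.
Qed.

(** The closed cell contains opposite edges that are the same points of the torus; a cosine equal to
    1 detects equality modulo the period. *)
Lemma periodic_eq_cos g x y : torus_periodic g -> cell x -> cell y ->
  cos (y.1 - x.1) = 1 -> cos (y.2 - x.2) = 1 -> g y = g x.
Proof.
have bnd (a b : R) : `[0, 2 * pi]%classic a -> `[0, 2 * pi]%classic b -> `|b - a| <= 2 * pi.
  by rewrite /= !in_itv/= => /andP[a0 a1] /andP[b0 b1]; rewrite ler_norml; lra.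
move=> pg; case: x y => [x1 x2] [y1 y2] [/= cx1 cx2] [/= cy1 cy2].
move=> /(cos_eq1 (bnd _ _ cx1 cy1)) E1 /(cos_eq1 (bnd _ _ cx2 cy2)) E2.
have -> : g (y1, y2) = g (x1, y2).
  case: E1 => E.
  - by congr (g (_, _)); lra.
  - have -> : y1 = x1 + 2 * pi by lra.
    by exact: (pg (x1, y2)).1.
  - have -> : x1 = y1 + 2 * pi by lra.
    by rewrite (pg (y1, y2)).1.
case: E2 => E.
- by congr (g (_, _)); lra.
- have -> : y2 = x2 + 2 * pi by lra.
    by exact: (pg (x1, x2)).2.
- have -> : x2 = y2 + 2 * pi by lra.
    by rewrite (pg (x1, y2)).2.
Qed.

(* The right-hand side is the modulus of continuity that the Fejer kernel
   integrates explicitly. *)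
Lemma periodic_modulus g (e : R) : continuous g -> torus_periodic g -> 0 < e ->
  exists2 C, 0 <= C & forall x y, cell x -> cell y ->
    `|g y - g x| <= e + C * (2 - cos (y.1 - x.1) - cos (y.2 - x.2)).
Proof.
move=> cg pg e0.
pose H (z : (R * R) * (R * R)) := `|g z.2 - g z.1|.
pose D (z : (R * R) * (R * R)) := 2 - cos (z.2.1 - z.1.1) - cos (z.2.2 - z.1.2).
have D0 z : 0 <= D z.
  by rewrite /D; have := cos_le1 (z.2.1 - z.1.1); have := cos_le1 (z.2.2 - z.1.2); lra.
pose T2 := ((R * R) * (R * R))%type.
have cf1 : continuous (fst : T2 -> R * R) by move=> z; exact: cvg_fst.
have cf2 : continuous (snd : T2 -> R * R) by move=> z; exact: cvg_snd.
have cp1 : continuous (fst : R * R -> R) by move=> z; exact: cvg_fst.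
have cp2 : continuous (snd : R * R -> R) by move=> z; exact: cvg_snd.
have cgo (a : T2 -> R * R) (b : R * R -> R) : continuous a -> continuous b ->
    continuous (fun z => b (a z)).
  by move=> ca cb z; apply: (@continuous_comp _ _ _ a b); [exact: ca|exact: cb].
have ccos (a b : T2 -> R) : continuous a -> continuous b ->
    continuous (fun z => cos (a z - b z)).
  move=> ca cb z; apply: (@continuous_comp _ _ _ (fun z => a z - b z) cos).
    by apply: continuousB; [exact: ca|exact: cb].
  exact: continuous_cos.
have cH : continuous H.
  move=> z; apply: (@continuous_comp _ _ _ (fun z : T2 => g z.2 - g z.1) Num.norm).
    by apply: continuousB; exact: cgo.
  exact: norm_continuous.
have cB (a b : T2 -> R) : continuous a -> continuous b -> continuous (fun z => a z - b z).
  by move=> ca cb z; apply: continuousB; [exact: ca|exact: cb].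
have cD : continuous D.
  have c2 : continuous (fun _ : T2 => 2 : R) by exact: cst_continuous.
  exact: (cB _ _ (cB _ _ c2 (ccos _ _ (cgo _ _ cf2 cp1) (cgo _ _ cf1 cp1)))
    (ccos _ _ (cgo _ _ cf2 cp2) (cgo _ _ cf1 cp2))).
(* On this compact set of pairs, where [g] varies by at least [e], the function [D] has no zero,
   because a zero would identify the two points on the torus. Its minimum [D c] is thus positive,
   and the constant [2 * M / D c] covers the largest possible variation [2 * M]. *)
pose A := (cell `*` cell) `&` [set z | e <= H z].
have cA : compact A.
  apply: compact_closedI; first by apply: compact_setX; exact: cell_compact.
  by apply: (closed_comp (f := H) (D := [set y : R | e <= y])) => [z _|]; [exact: cH|exact: closed_ge].
have [M M0 gM] := continuous_bounded_cell cg.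
have [A0|/set0P A0] := eqVneq A set0.
  exists 0 => // x y cx cy; rewrite mul0r addr0 leNgt; apply/negP => h.
  by have : A (x, y) by [split => //=; exact: ltW]; rewrite A0.
have [c Ac minc] := compact_EVT_min A0 cA (continuous_subspaceT cD).
have Dc : 0 < D c.
  rewrite lt_neqAle D0 andbT eq_sym; apply/negP => /eqP Dc0.
  move: Ac; rewrite inE => -[[c1 c2] /=]; apply/negP; rewrite -ltNge.
  have l1 := cos_le1 (c.2.1 - c.1.1); have l2 := cos_le1 (c.2.2 - c.1.2).
  rewrite /H (periodic_eq_cos pg c1 c2) ?subrr ?normr0//; move: Dc0; rewrite /D; lra.
exists (2 * M / D c) => [|x y cx cy].
  by rewrite divr_ge0 ?mulr_ge0// ltW.
have Dxy0 := D0 (x, y); rewrite -[2 - _ - _]/(D (x, y)).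
have [h|h] := leP e `|g y - g x|; last first.
  by rewrite (le_trans (ltW h))// lerDl !mulr_ge0// ?invr_ge0 ltW.
have DD : D c <= D (x, y) by apply: minc; rewrite inE.
apply: (@le_trans _ _ (2 * M)).
  by rewrite (le_trans (ler_normB _ _))// mulr_natl mulr2n lerD// gM.
rewrite ler_wpDl ?(ltW e0)// -mulrA ler_peMr ?mulr_ge0 ?(ltW M0)//.
by rewrite mulrC ler_pdivlMr// mul1r.
Qed.

End CosineModulus.

(** * Fejer means and convergence in mean square *)

Section MeanConvergence.
Context {R : realType}.
Implicit Types (f g h : R * R -> R) (k l : int * int) (x : R * R).

Section Fejer.
Context (m : nat).
Let n := m.+1.
Let J : finType := ('I_n * 'I_n)%type.
Let fr (j : J) : int * int := (j.1%:Z, j.2%:Z).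
Let c := (n ^ 2)%:R^-1 : R.

(** The differences are listed with repetition: the multiplicity of a frequency is, up to the
    normalization [c], its Fejer weight, so no weight has to be written down. *)
Definition fejer_freq : seq (int * int) := [seq fr p.1 - fr p.2 | p <- index_enum (J * J)%type].

(* The squared modulus of the normalized sum of exp(i k . x) over 0 <= k_1, k_2 < n. *)
Definition fejer_ker x : R * R -> R :=
  trig fejer_freq (fun d => c * ecos d x) (fun d => c * esin d x).

Definition fejer g : R * R -> R := trig fejer_freq (fun d => c * cc g d) (fun d => c * sc g d).

Lemma fejer_freq_box : {subset fejer_freq <= box m}.
Proof.
move=> d /mapP[[[a b] [a' b']] _ ->]; rewrite mem_box/=.
by have := ltn_ord a; have := ltn_ord b; have := ltn_ord a'; have := ltn_ord b'; rewrite /n; lia.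
Qed.

Lemma sum_fejer_freq (F : int * int -> R) :
  \sum_(d <- fejer_freq) F d = \sum_(i : J) \sum_(j : J) F (fr i - fr j).
Proof. by rewrite /fejer_freq big_map pair_bigA. Qed.

Lemma fejer_ker_ge0 x y : 0 <= fejer_ker x y.
Proof.
pose a (i : J) := phase (fr i) (y - x).
have -> : fejer_ker x y = c * ((\sum_(i : J) cos (a i)) ^+ 2 + (\sum_(i : J) sin (a i)) ^+ 2).
  rewrite /fejer_ker /trig sum_fejer_freq !expr2 !big_distrl/= -big_split/= mulr_sumr.
  apply: eq_bigr => i _; rewrite !big_distrr/= -big_split/= mulr_sumr.
  apply: eq_bigr => j _; rewrite -cosB /a -phaseB phase_sub cosB /ecos /esin; ring.
by rewrite mulr_ge0 ?invr_ge0// addr_ge0 ?sqr_ge0.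
Qed.

Lemma fejer_tint g x : continuous g ->
  tint (fun y => fejer_ker x y * g y) = (2 * pi) ^+ 2 * fejer g x.
Proof.
move=> cg; rewrite tint_trigM//; congr (_ * _); apply: eq_bigr => d _; ring.
Qed.

(** The multiplicity of [e] in [fejer_freq]; [c * cnt e] is the Fejer multiplier at [e]. *)
Let cnt (e : int * int) : R := \sum_(i : J) \sum_(j : J) (fr i - fr j == e)%:R.

Lemma cntN e : cnt (- e) = cnt e.
Proof.
rewrite /cnt exchange_big/=; apply: eq_bigr => i _; apply: eq_bigr => j _.
by rewrite -(inj_eq oppr_inj) opprK opprB.
Qed.

(** The test function is cos (e . (y - x)), so the kernel returns its multiplier at [e] times the
    area of the cell. *)
Lemma fejer_ecos e x :
  tint (fun y => fejer_ker x y * (ecos e x * ecos e y + esin e x * esin e y)) =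
  (2 * pi) ^+ 2 * (c * cnt e).
Proof.
have ce := @continuous_ecos R e; have cs := @continuous_esin R e.
rewrite tint_trigM; last by apply: continuousDR; exact: continuousZR.
congr (_ * _).
have E d : c * ecos d x * cc (fun y => ecos e x * ecos e y + esin e x * esin e y) d +
    c * esin d x * sc (fun y => ecos e x * ecos e y + esin e x * esin e y) d =
    c * 2^-1 * ((d == e)%:R + (d == - e)%:R).
  rewrite ccD ?scD ?ccZ ?scZ ?cc_ecos ?cc_esin ?sc_ecos ?sc_esin//; try exact: continuousZR.
  rewrite (eq_sym e d) (_ : (e == - d) = (d == - e)); last by rewrite eq_sym eqr_oppLR.
  have cs1 : ecos e x ^+ 2 + esin e x ^+ 2 = 1 by rewrite /ecos /esin cos2Dsin2.
  have [e1 e2] : (d == e)%:R * ecos d x = (d == e)%:R * ecos e x /\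
      (d == e)%:R * esin d x = (d == e)%:R * esin e x.
    by have [->|_] := eqVneq d e; rewrite ?mul0r.
  have [e3 e4] : (d == - e)%:R * ecos d x = (d == - e)%:R * ecos e x /\
      (d == - e)%:R * esin d x = - ((d == - e)%:R * esin e x).
    have [->|_] := eqVneq d (- e); last by rewrite !mul0r oppr0.
    by rewrite ecosN esinN mulrN.
  move: ((d == e)%:R : R) ((d == - e)%:R : R) e1 e2 e3 e4 => b1 b2 e1 e2 e3 e4.
  transitivity (c * 2^-1 * ((b1 * ecos d x + b2 * ecos d x) * ecos e x +
     (b1 * esin d x - b2 * esin d x) * esin e x)).
    by ring.
  by rewrite e1 e2 e3 e4 -[b1 in RHS]mulr1 -[b2 in RHS]mulr1 -cs1; ring.
rewrite (eq_bigr _ (fun d _ => E d)) -mulr_sumr big_split/=.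
rewrite (sum_fejer_freq (fun d => (d == e)%:R)) (sum_fejer_freq (fun d => (d == - e)%:R)).
by rewrite -/(cnt e) -/(cnt (- e)) cntN; field.
Qed.

Lemma cnt0 : cnt 0 = (n ^ 2)%:R.
Proof.
rewrite /cnt (eq_bigr (fun=> 1)) => [|[a b] _].
  by rewrite sumr_const card_prod card_ord mulnn.
rewrite (bigD1 (a, b))//= subrr eqxx big1 ?addr0// => -[a' b'] ne.
rewrite subr_eq0; case: eqP => // -[/ord_inj ea /ord_inj eb].
by move: ne; rewrite ea eb eqxx.
Qed.

Lemma cnt10 : (n ^ 2)%:R - n%:R <= cnt (1, 0).
Proof.
have -> : (n ^ 2)%:R - n%:R = \sum_(j : J) (1 - (j.1 == ord_max)%:R) :> R.
  rewrite sumrB sumr_const card_prod card_ord mulnn; congr (_ - _).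
  rewrite -(pair_bigA _ (fun a b : 'I_n => (a == ord_max)%:R))/=.
  rewrite (bigD1 ord_max)//= eqxx [X in _ + X]big1 ?addr0; last first.
    by move=> a /negbTE ->; rewrite big1.
  by rewrite sumr_const card_ord.
rewrite /cnt exchange_big/=; apply: ler_sum => -[a b] _ /=.
have [->|am] := eqVneq a ord_max; first by rewrite subrr sumr_ge0.
(* The neighbour of [(a, b)] in the first direction represents the difference [(1, 0)]; it exists
   unless [a] is the last index, which costs n of the n^2 pairs. *)
rewrite subr0 (bigD1 (inord a.+1, b))//= [X in X + _](_ : _ = 1) ?lerDl ?sumr_ge0//.
rewrite (_ : _ == _)//; apply/eqP; congr pair; rewrite /= ?subrr// inordK.
  by rewrite intS addrK.
have am' : val a != m by apply: contraNneq am => e; apply/eqP/val_inj.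
by have := ltn_ord a; move: am' => /=; rewrite /n; lia.
Qed.

Lemma cnt01 : (n ^ 2)%:R - n%:R <= cnt (0, 1).
Proof.
have -> : (n ^ 2)%:R - n%:R = \sum_(j : J) (1 - (j.2 == ord_max)%:R) :> R.
  rewrite sumrB sumr_const card_prod card_ord mulnn; congr (_ - _).
  rewrite -(pair_bigA _ (fun b a : 'I_n => (a == ord_max)%:R))/= exchange_big/=.
  rewrite (bigD1 ord_max)//= eqxx [X in _ + X]big1 ?addr0; last first.
    by move=> a /negbTE ->; rewrite big1.
  by rewrite sumr_const card_ord.
rewrite /cnt exchange_big/=; apply: ler_sum => -[b a] _ /=.
have [->|am] := eqVneq a ord_max; first by rewrite subrr sumr_ge0.
rewrite subr0 (bigD1 (b, inord a.+1))//= [X in X + _](_ : _ = 1) ?lerDl ?sumr_ge0//.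
rewrite (_ : _ == _)//; apply/eqP; congr pair; rewrite /= ?subrr// inordK.
  by rewrite intS addrK.
have am' : val a != m by apply: contraNneq am => e; apply/eqP/val_inj.
by have := ltn_ord a; move: am' => /=; rewrite /n; lia.
Qed.

Lemma fejer_tint1 x : tint (fejer_ker x) = (2 * pi) ^+ 2.
Proof.
have c0 : (n ^ 2)%:R != 0 :> R by rewrite pnatr_eq0 expn_eq0.
have := fejer_ecos 0 x; rewrite cnt0 mulVf// mulr1 => <-.
apply: eq_tint => y; rewrite /ecos /esin /phase/= !mul0r addr0 cos0 sin0.
by rewrite !mulr1 mulr0 addr0 mulr1.
Qed.

(** The kernel has mass (2 pi)^2 and the multiplier at [e] is at least 1 - 1/n. *)
Lemma fejer_cos e x : (n ^ 2)%:R - n%:R <= cnt e ->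
  tint (fun y => fejer_ker x y * (1 - cos (phase e y - phase e x))) <= (2 * pi) ^+ 2 / n%:R.
Proof.
move=> le.
have cK := @continuous_trig R fejer_freq (fun d => c * ecos d x) (fun d => c * esin d x).
have ce := @continuous_ecos R e; have cs := @continuous_esin R e.
have ch : continuous (fun y => ecos e x * ecos e y + esin e x * esin e y).
  by apply: continuousDR; exact: continuousZR.
have -> : tint (fun y => fejer_ker x y * (1 - cos (phase e y - phase e x))) =
  tint (fun y => fejer_ker x y - fejer_ker x y * (ecos e x * ecos e y + esin e x * esin e y)).
  by apply: eq_tint => y; rewrite cosB /ecos /esin; ring.
rewrite tintB//; last exact: continuousMR.
rewrite fejer_tint1 fejer_ecos -{1}[(2 * pi) ^+ 2]mulr1 -mulrBr.
rewrite ler_pM2l ?twopi_sq_gt0// lerBlDr -lerBlDl.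
have n0 : 0 < n%:R :> R by rewrite ltr0n.
rewrite /c natrX ler_pdivlMl ?exprn_gt0//.
by rewrite (_ : _ * _ = (n ^ 2)%:R - n%:R)//; rewrite natrX; field; rewrite gt_eqF.
Qed.

(** The difference [fejer g x - g x] is an average of [g y - g x] against a nonnegative kernel. The
    assumed modulus of continuity involves only the frequencies [(1, 0)] and [(0, 1)], each of which
    costs at most [C / n]. *)
Lemma fejer_err g (e C : R) x : continuous g -> 0 <= e -> 0 <= C -> cell x ->
  (forall y, cell y -> `|g y - g x| <= e + C * (2 - cos (y.1 - x.1) - cos (y.2 - x.2))) ->
  `|fejer g x - g x| <= e + 2 * C / n%:R.
Proof.
move=> cg e0 C0 cx gC; have pi2 := @twopi_sq_gt0 R.
have cK := @continuous_trig R fejer_freq (fun d => c * ecos d x) (fun d => c * esin d x).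
have ccos (k : int * int) : continuous (fun y => 1 - cos (phase k y - phase k x)).
  apply: continuousBR; first exact: cst_continuous.
  move=> y; apply: (@continuous_comp _ _ _ (fun y => phase k y - phase k x) cos).
    by apply: continuousB; [exact: continuous_phase|exact: cst_continuous].
  exact: continuous_cos.
have cgx : continuous (fun y => g y - g x) by apply: continuousBR => //; exact: cst_continuous.
have E : (2 * pi) ^+ 2 * (fejer g x - g x) = tint (fun y => fejer_ker x y * (g y - g x)).
  have -> : tint (fun y => fejer_ker x y * (g y - g x)) =
      tint (fun y => fejer_ker x y * g y - g x * fejer_ker x y).
    by apply: eq_tint => y; ring.
  rewrite tintB; [|exact: continuousMR|exact: continuousZR].
  by rewrite tintZ// fejer_tint// fejer_tint1; ring.
rewrite -(ler_pM2l pi2) -{1}(gtr0_norm pi2) -normrM E.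
have cn h : continuous h -> continuous (fun y => `|h y|).
  by move=> ch y; apply: (@continuous_comp _ _ _ h Num.norm); [exact: ch|exact: norm_continuous].
apply: (le_trans (le_norm_tint (continuousMR cK cgx))).
pose h y := fejer_ker x y * (e + C * (2 - cos (y.1 - x.1) - cos (y.2 - x.2))).
have hE y : h y = e * fejer_ker x y +
    C * (fejer_ker x y * (1 - cos (phase (1, 0) y - phase (1, 0) x)) +
         fejer_ker x y * (1 - cos (phase (0, 1) y - phase (0, 1) x))).
  by rewrite /h /phase/= !mul0r !mul1r !addr0 !add0r; ring.
have hf := funext hE.
have ch : continuous h.
  rewrite hf; apply: continuousDR; first exact: continuousZR.
  by apply: continuousZR; apply: continuousDR; exact: continuousMR.
apply: (@le_trans _ _ (tint h)).
  apply: le_tint => // [|y cy]; first exact/cn/continuousMR.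
  by rewrite normrM (ger0_norm (fejer_ker_ge0 x y)) ler_wpM2l ?fejer_ker_ge0// gC.
rewrite hf tintD; [|exact: continuousZR|by apply: continuousZR; apply: continuousDR; exact: continuousMR].
rewrite !tintZ//; last by apply: continuousDR; exact: continuousMR.
rewrite tintD; [|exact: continuousMR|exact: continuousMR].
rewrite fejer_tint1 [X in _ <= X]mulrDr [e * _]mulrC lerD2l.
have := fejer_cos x cnt10; have := fejer_cos x cnt01.
move=> h1 h2; apply: (@le_trans _ _ (C * (((2 * pi) ^+ 2) / n%:R + ((2 * pi) ^+ 2) / n%:R))).
  by rewrite ler_wpM2l// lerD.
by rewrite le_eqVlt; apply/orP; left; apply/eqP; ring.
Qed.

End Fejer.

(** Fejer means approximate uniformly on the cell, and the partial sum over any larger box does at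
    least as well in mean square. *)
Lemma psum_L2_cvg g (e : R) : continuous g -> torus_periodic g -> 0 < e ->
  exists n0 : nat, forall n, (n0 <= n)%N -> tint (fun x => (g x - psum n g x) ^+ 2) <= e.
Proof.
move=> cg pg e0.
(* The uniform error is at most [2 * d <= 1], so its square is at most [2 * d], and [2 * d] times
   the area of the cell is at most [e]. *)
pose d := Num.min 1 (e / ((2 * pi) ^+ 2)) / 2.
have pi2 := @twopi_sq_gt0 R.
have d0 : 0 < d by rewrite divr_gt0// lt_min ltr01 divr_gt0.
have [C C0 gC] := periodic_modulus cg pg d0.
have [m Hm] : exists m : nat, 2 * C / m.+1%:R <= d.
  exists (Num.truncn (2 * C / d)).
  rewrite ler_pdivrMr ?ltr0n// [d * _]mulrC -ler_pdivrMr//.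
  by apply: ltW; apply: truncnS_gt.
exists m => n mn.
have sub : {subset fejer_freq m <= box n}.
  move=> l /fejer_freq_box; rewrite !mem_box => /andP[l1 l2].
  by rewrite (le_trans l1) ?(le_trans l2)// lez_nat.
apply: (le_trans (tint_err_best _ _ cg sub)).
rewrite -/(fejer m g).
have cp : continuous (fejer m g) by exact: continuous_trig.
have cgp := continuousBR cg cp.
apply: (@le_trans _ _ (tint (fun=> (2 * d)))).
  apply: le_tint => [||x cx]; [exact: (continuousMR cgp cgp)|exact: cst_continuous|].
  have h : `|g x - fejer m g x| <= 2 * d.
    have := @fejer_err m g d C x cg (ltW d0) C0 cx (fun y => gC x y cx).
    by rewrite distrC => /le_trans; apply; rewrite [leRHS]mulr_natl mulr2n lerD2l.
  have d1 : 2 * d <= 1 by rewrite /d mulrC divfK// ge_min lexx.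
  rewrite -real_normK ?num_real// expr2 (le_trans _ h)// ler_piMr//; exact: le_trans h d1.
rewrite tint_cst /d [2 * _]mulrC divfK// -ler_pdivlMr//.
by rewrite ge_min lexx orbT.
Qed.

End MeanConvergence.

(** * Cutoffs and trilinear sums *)

Section Weights.
Context {R : realType}.
Implicit Types (k l m : int * int) (r N : R).

(* For a >= 0: the (possibly infinite) sum of a is at most A. *)
Definition fin_le (a : int * int -> R) (A : R) : Prop :=
  forall s, uniq s -> \sum_(k <- s) a k <= A.

(** The squared Japanese bracket 1 + |k|^2; [jb] below is the bracket itself. *)
Definition J k : R := 1 + k.1%:~R ^+ 2 + k.2%:~R ^+ 2.

Lemma J_ge1 k : 1 <= J k.
Proof. by rewrite /J -addrA lerDl addr_ge0 ?sqr_ge0. Qed.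

Lemma J_gt0 k : 0 < J k.
Proof. exact: lt_le_trans (J_ge1 k). Qed.

Lemma J_ge0 k : 0 <= J k. Proof. exact: ltW (J_gt0 k). Qed.

Lemma J_neq0 k : J k != 0. Proof. by rewrite gt_eqF ?J_gt0. Qed.

Hint Resolve J_ge1 J_gt0 J_ge0 J_neq0 : core.

Lemma JN k : J (- k) = J k.
Proof. by rewrite /J/= !intrN !sqrrN. Qed.

Definition jb k : R := Num.sqrt (J k).

Lemma jb_ge1 k : 1 <= jb k.
Proof. by rewrite -[leLHS]sqrtr1 ler_wsqrtr. Qed.

Lemma sqr_jb k : jb k ^+ 2 = J k.
Proof. by rewrite sqr_sqrtr. Qed.

Lemma jb_triangle k l : jb (k + l) <= jb k + jb l.
Proof.
have jk := jb_ge1 k; have jl := jb_ge1 l.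
rewrite -(ler_pXn2r (n := 2)) ?nnegrE ?sqrtr_ge0//; last by rewrite addr_ge0// ?(le_trans _ jk)// (le_trans _ jl).
rewrite sqrrD !sqr_jb.
have -> : J (k + l) = J k + J l - 1 + (k.1%:~R * l.1%:~R + k.2%:~R * l.2%:~R) *+ 2.
  by rewrite /J/= !intrD; ring.
rewrite [leRHS]addrAC lerD//; first by lra.
rewrite ler_pMn2r//; apply: le_trans (ler_norm _) _.
rewrite -(ler_pXn2r (n := 2)) ?nnegrE ?normr_ge0 ?mulr_ge0 ?sqrtr_ge0//.
rewrite real_normK ?num_real// exprMn !sqr_jb /J.
move: k.1%:~R k.2%:~R l.1%:~R l.2%:~R => a b c d.
have -> : (1 + a ^+ 2 + b ^+ 2) * (1 + c ^+ 2 + d ^+ 2) =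
  (a * c + b * d) ^+ 2 + ((a * d - b * c) ^+ 2 + (1 + a ^+ 2 + b ^+ 2 + c ^+ 2 + d ^+ 2)) by ring.
by rewrite lerDl !addr_ge0 ?sqr_ge0.
Qed.

Lemma jbN k : jb (- k) = jb k.
Proof. by rewrite /jb JN. Qed.

Lemma jb_dist k l : `|jb k - jb l| <= jb (k - l).
Proof.
have h a b : jb a - jb b <= jb (a - b).
  by rewrite lerBlDr -{1}(subrK b a) jb_triangle.
rewrite ler_norml h andbT lerNl opprB.
by rewrite -(jbN (k - l)) opprB h.
Qed.

(** Equal to 1 up to [N], to 0 from [2 * N] on, and linear in [jb] in between. The slope 1/N, which
    a sharp cutoff would not have, is what makes the commutators small. *)
Definition chi N k : R := Num.max 0 (Num.min 1 (2 - jb k / N)).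

Lemma chi_ge0 N k : 0 <= chi N k.
Proof. by rewrite /chi le_max lexx. Qed.

Lemma chi_le1 N k : chi N k <= 1.
Proof. by rewrite /chi ge_max ler01 ge_min lexx. Qed.

Lemma chi1 N k : 0 < N -> jb k <= N -> chi N k = 1.
Proof.
move=> N0 kN; rewrite /chi min_l ?max_r//.
have : jb k / N <= 1 by rewrite ler_pdivrMr ?mul1r.
lra.
Qed.

Lemma chi0 N k : 0 < N -> 2 * N <= jb k -> chi N k = 0.
Proof.
move=> N0 kN; rewrite /chi max_l//.
have : 2 <= jb k / N by rewrite ler_pdivlMr.
by rewrite ge_min => h; apply/orP; right; lra.
Qed.

Lemma chi_lip N k l : 0 < N -> (chi N k - chi N l) ^+ 2 <= J (k - l) / N ^+ 2.
Proof.
move=> N0.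
have h : `|chi N k - chi N l| <= `|jb k - jb l| / N.
  have -> : `|jb k - jb l| / N = `|jb k / N - jb l / N|.
    by rewrite -mulrBl normrM [`|N^-1|]gtr0_norm ?invr_gt0.
  rewrite /chi; move: (jb k / N) (jb l / N) => a b.
  have n1 := ler_norm (a - b); have := ler_norm (b - a); rewrite [`|b - a|]distrC.
  move: `|a - b| n1 => n n1 n2.
  rewrite ler_norml; case: (leP 1 (2 - a)) => ?; case: (leP 1 (2 - b)) => ?;
    case: (leP 0 (1 : R)) => ?; case: (leP 0 (2 - a)) => ?; case: (leP 0 (2 - b)) => ?;
    by apply/andP; split; lra.
rewrite -[leLHS]real_normK ?num_real// -sqr_jb -expr_div_n.
rewrite ler_pXn2r ?nnegrE ?normr_ge0 ?divr_ge0 ?sqrtr_ge0 ?(ltW N0)//.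
by apply: le_trans h _; rewrite ler_wpM2r ?invr_ge0 ?(ltW N0)// jb_dist.
Qed.

(** If [jb l >= N / 2], the Lipschitz bound yields [J m / N ^+ 2], and the quantity 4 J(l) / N^2 >=
    1 may be raised to the power [r]. If [jb l < N / 2], the two cutoffs agree unless [jb k > N];
    then [jb m >= N / 2] and 4 J(m) / N^2 takes over that role. The sum of two negative powers
    covers both cases and is summable in [l] uniformly in [k]. *)
Lemma commutator_weight r N k l : 1 <= r -> 0 < N ->
  (chi N k - chi N l) ^+ 2 * J l <=
  (4 / N ^+ 2) `^ r * (J (k - l) `^ (- r) + J l `^ (- r)) * J (k - l) `^ (r + 1) * J l `^ r.
Proof.
move=> r1 N0; set m := k - l; have N20 : 0 < N ^+ 2 by rewrite exprn_gt0.
have pw k' : 0 < J k' `^ r by rewrite powR_gt0.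
have pD : J m `^ (r + 1) = J m `^ r * J m.
  by rewrite powRD ?powRr1//; apply/implyP => _.
have c0 : 0 < (4 / N ^+ 2) `^ r by rewrite powR_gt0 ?divr_gt0.
rewrite !powRN pD; have [h|h] := leP (N / 2) (jb l).
  apply: (@le_trans _ _ ((4 / N ^+ 2) `^ r * (J m `^ r)^-1 * (J m `^ r * J m) * J l `^ r)).
    have -> : (4 / N ^+ 2) `^ r * (J m `^ r)^-1 * (J m `^ r * J m) * J l `^ r =
       J m * ((4 / N ^+ 2) * J l) `^ r.
      have a0 := lt0r_neq0 (pw m); rewrite [X in _ = _ * X]powRM ?divr_ge0 ?(ltW N20)//.
      by move: (J m `^ r) a0 (J l `^ r) (_ `^ r) => a a0 b d; field.
    apply: (@le_trans _ _ (J m / N ^+ 2 * J l)).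
      by rewrite ler_wpM2r// chi_lip.
    rewrite -mulrA ler_wpM2l//.
    have y1 : 1 <= 4 / N ^+ 2 * J l.
      rewrite mulrAC ler_pdivlMr// mul1r -sqr_jb -(ler_pXn2r (n := 2)) in h *; rewrite ?nnegrE ?sqrtr_ge0 ?divr_ge0 ?(ltW N0)//.
      by move: h; rewrite expr_div_n; lra.
    apply: le_trans (le1r_powR y1 r1); rewrite ler_wpM2r//.
    have : 0 < (N ^+ 2)^-1 by rewrite invr_gt0.
    lra.
  do 2 rewrite ler_wpM2r// ?mulr_ge0 ?(ltW (pw _))//.
  by rewrite ler_wpM2l ?(ltW c0)// lerDl invr_ge0 ltW.
have [kN|kN] := leP (jb k) N.
  rewrite !chi1//; last by move: h N0; lra.
  rewrite subrr expr2 mul0r mul0r.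
  have w k' := ltW (pw k').
  have wi k' : 0 <= (J k' `^ r)^-1 by rewrite invr_ge0 w.
  exact: (mulr_ge0 (mulr_ge0 (mulr_ge0 (ltW c0) (addr_ge0 (wi m) (wi l)))
    (mulr_ge0 (w m) (J_ge0 m))) (w l)).
have tri : jb k <= jb m + jb l by rewrite -[in leLHS](subrK l k) jb_triangle.
have mN : N / 2 <= jb m by lra.
have lm : J l <= J m.
  by rewrite -!sqr_jb ler_pXn2r ?nnegrE ?sqrtr_ge0//; lra.
have d1 : (chi N k - chi N l) ^+ 2 <= 1.
  have := chi_ge0 N k; have := chi_ge0 N l; have := chi_le1 N k; have := chi_le1 N l; nra.
apply: (@le_trans _ _ (J m)).
  by rewrite -[leRHS]mul1r; apply: ler_pM => //; exact: sqr_ge0.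
apply: (@le_trans _ _ ((4 / N ^+ 2) `^ r * (J l `^ r)^-1 * (J m `^ r * J m) * J l `^ r)).
  have -> : (4 / N ^+ 2) `^ r * (J l `^ r)^-1 * (J m `^ r * J m) * J l `^ r =
       J m * ((4 / N ^+ 2) * J m) `^ r.
    have a0 := lt0r_neq0 (pw l); rewrite [X in _ = _ * X]powRM ?divr_ge0 ?(ltW N20)//.
    by move: (J l `^ r) a0 (J m `^ r) (_ `^ r) => a a0 b d; field.
  rewrite ler_peMr//.
  have y1 : 1 <= 4 / N ^+ 2 * J m.
    have N20' : 0 <= N / 2 by rewrite divr_ge0 ?(ltW N0).
    have : (N / 2) ^+ 2 <= jb m ^+ 2 by rewrite ler_pXn2r ?nnegrE ?sqrtr_ge0.
    by rewrite mulrAC ler_pdivlMr// mul1r sqr_jb expr_div_n; lra.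
  by apply: le_trans (le1r_powR y1 r1).
do 2 rewrite ler_wpM2r// ?mulr_ge0 ?(ltW (pw _))//.
by rewrite ler_wpM2l ?(ltW c0)// lerDr invr_ge0 ltW.
Qed.

(** The larger of [k - l] and [l] absorbs the derivative. Only one power of [J] falls on [k - l]:
    for a difference of velocities this is the H^1 norm, comparable to the L^2 norm of the vorticity
    difference. *)
Lemma product_weight r k l : 1 <= r ->
  J l <= (J (k - l) `^ (- r) + J l `^ (- r)) * J (k - l) * J l `^ r.
Proof.
move=> r1; set m := k - l.
have pw k' : 0 < J k' `^ r by rewrite powR_gt0.
rewrite !powRN; have [lm|ml] := leP (J l) (J m).
  apply: (le_trans lm); rewrite -[leLHS]mulr1 -(@mulVf _ (J l `^ r)); last by rewrite gt_eqF.
  rewrite mulrA ler_wpM2r ?(ltW (pw _))// mulrC ler_wpM2r// lerDr invr_ge0 ltW//.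
apply: (@le_trans _ _ ((J m `^ r)^-1 * J m * J l `^ r)); last first.
  by do 2 rewrite ler_wpM2r ?(ltW (pw _))//; rewrite lerDl invr_ge0 ltW.
have q1 : 1 <= J l / J m by rewrite ler_pdivlMr ?mul1r// ltW.
have := le1r_powR q1 r1.
rewrite ler_pdivrMr// => /le_trans; apply.
rewrite powRM ?invr_ge0// le_eqVlt; apply/orP; left; apply/eqP.
have -> : (J m)^-1 `^ r = (J m `^ r)^-1 by rewrite -powR_inv1// -powRrM mulN1r powRN.
ring.
Qed.

End Weights.

(** * Lattice sums *)

Section Summability.
Context {R : realType}.
Implicit Types (k l m : int * int) (r N : R).

Lemma sum_le_uniq_sub (T : eqType) (s t : seq T) (F : T -> R) : uniq s -> uniq t ->
  {subset s <= t} -> (forall x, 0 <= F x) -> \sum_(x <- s) F x <= \sum_(x <- t) F x.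
Proof.
move=> us ut st F0; rewrite (perm_big [seq x <- t | x \in s]) /=.
  rewrite big_filter [leRHS](bigID (fun x => x \in s))/= lerDl sumr_ge0//.
apply: uniq_perm => //; first exact: filter_uniq.
move=> x; rewrite mem_filter /=; apply/idP/andP => [xs|[]//]; split => //; exact: st.
Qed.

Lemma sub_box (s : seq (int * int)) : exists n, {subset s <= box n}.
Proof.
elim: s => [|k s [n sn]]; first by exists 0%N.
exists (maxn n (maxn `|k.1| `|k.2|)) => l; rewrite inE => /predU1P[->|/sn]; rewrite !mem_box; lia.
Qed.

Lemma fin_le_box (a : int * int -> R) A : (forall k, 0 <= a k) ->
  (forall n, \sum_(k <- box n) a k <= A) -> fin_le a A.
Proof.
move=> a0 H s us; have [n sn] := sub_box s.
apply: le_trans (H n); apply: sum_le_uniq_sub => //; exact: uniq_box.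
Qed.

(** Comparison with an integral: the mean value theorem for x^(1-r) bounds each term by a
    difference, and the differences telescope. *)
Lemma sum_invpow_le r n : 1 < r ->
  \sum_(1 <= j < n.+1) j%:R `^ (- r) <= 1 + (r - 1)^-1 :> R.
Proof.
move=> r1; pose p := r - 1; have p0 : 0 < p by rewrite subr_gt0.
case: n => [|n]; first by rewrite big_geq// addr_ge0// invr_ge0 ltW.
rewrite big_nat_recl// powR1 lerD2l.
have step (j : nat) : (0 < j)%N -> j.+1%:R `^ (- r) <= p^-1 * (j%:R `^ (- p) - j.+1%:R `^ (- p)) :> R.
  move=> j0.
  have jj : j%:R < j.+1%:R :> R by rewrite ltr_nat.
  have j0' : 0 < j%:R :> R by rewrite ltr0n.
  have d (x : R) : x \in `]j%:R, j.+1%:R[ -> is_derive x 1 (fun x => x `^ (- p)) (- p * x `^ (- p - 1)).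
    by rewrite in_itv/= => /andP[jx _]; apply: is_derive1_powR; exact: lt_trans jx.
  have c : {within `[j%:R, j.+1%:R], continuous (fun x : R => x `^ (- p))}.
    apply: derivable_within_continuous => x; rewrite in_itv/= => /andP[jx _].
    by apply: derivable_powR; rewrite in_itv/= andbT (lt_le_trans j0').
  have [c' cj E] := MVT jj d c.
  rewrite -[X in p^-1 * X]opprB E -natrB// subSnn mulr1 mulNr opprK mulrA mulVf ?mul1r ?gt_eqF//.
  move: cj; rewrite in_itv/= => /andP[c1 c2].
  have -> : - p - 1 = - r by rewrite /p; ring.
  rewrite !powRN lef_pV2 ?posrE ?powR_gt0 ?(lt_trans j0')//.
  rewrite ge0_ler_powR ?nnegrE ?ltW// ?(lt_trans j0' c1)//; exact: lt_trans ltr01 r1.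
apply: (@le_trans _ _ (\sum_(1 <= j < n.+1) (p^-1 * (j%:R `^ (- p) - j.+1%:R `^ (- p))))).
  by apply: ler_sum_nat => j /andP[j1 _]; exact: step.
rewrite -mulr_sumr ler_piMr ?invr_ge0 ?(ltW p0)//.
rewrite (eq_bigr (fun j : nat => (- (j.+1%:R `^ (- p))) - (- (j%:R `^ (- p))))); last first.
  by move=> j _; rewrite opprK addrC.
by rewrite telescope_sumr// powR1 opprK gerDr oppr_le0 powR_ge0.
Qed.

(** The inequality (1 + a^2)(1 + b^2) <= (1 + a^2 + b^2)^2 splits the planar sum into a product of
    two one-dimensional sums with exponent [r], which gives the threshold [r > 1]. *)
Lemma J_summable r : 1 < r -> exists2 Z, 0 <= Z & fin_le (fun k => J k `^ (- r)) Z.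
Proof.
move=> r1; pose b (j : int) : R := (1 + j%:~R ^+ 2) `^ (- (r / 2)).
have r0 : 0 < r by exact: lt_trans r1.
have b0 j : 0 <= b j by exact: powR_ge0.
have q0 (j : int) : 0 < 1 + j%:~R ^+ 2 :> R by rewrite ltr_wpDr ?sqr_ge0.
have bN (j : nat) : (0 < j)%N -> b j%:Z <= j%:R `^ (- r).
  move=> j0; have j0' : 0 < j%:R :> R by rewrite ltr0n.
  rewrite /b !powRN lef_pV2 ?posrE ?powR_gt0//.
  have -> : j%:R `^ r = (j%:R ^+ 2) `^ (r / 2) :> R.
    by rewrite -powR_mulrn ?ltW// -powRrM mulrC divfK.
  rewrite ge0_ler_powR ?nnegrE ?sqr_ge0 ?divr_ge0 ?(ltW r0) ?(ltW (q0 _))//.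
  by rewrite -pmulrn lerDr.
(* Bound for the one-dimensional sum: 1 for the index 0 and one tail for each sign. *)
pose B := 1 + 2 * (1 + (r - 1)^-1).
exists (B ^+ 2); first exact: sqr_ge0.
apply: fin_le_box => [k|n]; first exact: powR_ge0.
have bJ k : J k `^ (- r) <= b k.1 * b k.2.
  rewrite /b/= -powRM ?(ltW (q0 _))// !powRN lef_pV2 ?posrE ?powR_gt0 ?J_gt0 ?mulr_gt0//.
  have -> : J k `^ r = (J k ^+ 2) `^ (r / 2).
    by rewrite -powR_mulrn ?J_ge0// -powRrM mulrC divfK.
  rewrite ge0_ler_powR ?nnegrE ?sqr_ge0 ?mulr_ge0 ?invr_ge0 ?(ltW r0) ?(ltW (q0 _))//.
  rewrite /J; move: (k.1%:~R) (k.2%:~R) => a c.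
  have -> : (1 + a ^+ 2 + c ^+ 2) ^+ 2 = (1 + a ^+ 2) * (1 + c ^+ 2) +
     (a ^+ 2 + c ^+ 2 + (a ^+ 2) ^+ 2 + (c ^+ 2) ^+ 2 + (a * c) ^+ 2) by ring.
  by rewrite lerDl !addr_ge0 ?sqr_ge0.
apply: (@le_trans _ _ (\sum_(k <- box n) b k.1 * b k.2)); first by apply: ler_sum => k _.
rewrite /box big_allpairs/= -big_distrlr/= -expr2 ler_pXn2r ?nnegrE ?sumr_ge0//; last first.
  by rewrite addr_ge0// mulr_ge0// addr_ge0// invr_ge0 subr_ge0 ltW.
have bo j : b (- j) = b j by rewrite /b intrN sqrrN.
have sb : \sum_(i <- [seq i%:Z - n%:Z | i <- iota 0 n.*2.+1]) b i <=
    b 0 + 2 * \sum_(1 <= j < n.+1) b j%:Z.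
  pose t := 0 :: [seq j%:Z | j <- index_iota 1 n.+1] ++ [seq - j%:Z | j <- index_iota 1 n.+1].
  have -> : b 0 + 2 * \sum_(1 <= j < n.+1) b j%:Z = \sum_(i <- t) b i.
    rewrite /t big_cons big_cat/= !big_map mulr_natl mulr2n; congr (_ + (_ + _)).
    by apply: eq_bigr => j _; rewrite bo.
  apply: sum_le_uniq_sub => //.
  - by rewrite map_inj_uniq ?iota_uniq// => i j /addIr[].
  - rewrite /t /= mem_cat negb_or cat_uniq.
    rewrite !map_inj_uniq ?iota_uniq; [|by move=> i j /oppr_inj[]|by move=> i j []].
    rewrite andbT/=; apply/andP; split.
    + by apply/andP; split; apply/mapP => -[j]; rewrite mem_iota => ? ?; lia.
    + by apply/hasPn => _ /mapP[j jn ->]; apply/mapP => -[i]; move: jn; rewrite !mem_iota; lia.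
  - move=> _ /mapP[j jn ->]; rewrite inE mem_cat; move: jn; rewrite mem_iota add0n => /= jn.
    have [jn'|jn'|->] := ltngtP j n; last by rewrite subrr eqxx.
      apply/orP; right; apply/orP; right; apply/mapP; exists (n - j)%N; last by lia.
      by rewrite mem_iota; lia.
    apply/orP; right; apply/orP; left; apply/mapP; exists (j - n)%N; last by lia.
    by rewrite mem_iota; lia.
apply: (le_trans sb); apply: lerD; first by rewrite /b expr2 mul0r addr0 powR1.
rewrite ler_wpM2l//; apply: le_trans (sum_invpow_le n r1).
by apply: ler_sum_nat => j /andP[j1 _]; exact: bN.
Qed.

End Summability.

(** * Trilinear sums over frequencies *)

Section Trilinear.
Context {R : realType}.
Implicit Types (k l m : int * int) (r N : R) (z y : R * R).

(* Complex numbers are pairs (real part, imaginary part), and the two components of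
   a coefficient of a planar field are complex.  cpair z y is Im (conj z * y), and
   transport v th k l is the l-th term of the k-th coefficient of v . grad th,
   divided by i. *)
Definition nsq z : R := z.1 ^+ 2 + z.2 ^+ 2.
Definition vnsq (v : (R * R) * (R * R)) : R := nsq v.1 + nsq v.2.
Definition cmul z y : R * R := (z.1 * y.1 - z.2 * y.2, z.1 * y.2 + z.2 * y.1).
Definition rscale (c : R) z : R * R := (c * z.1, c * z.2).
Definition cpair z y : R := z.1 * y.2 - z.2 * y.1.
Definition freq_dot k (v : (R * R) * (R * R)) : R * R :=
  (k.1%:~R * v.1.1 + k.2%:~R * v.2.1, k.1%:~R * v.1.2 + k.2%:~R * v.2.2).
Definition transport (v : int * int -> (R * R) * (R * R)) (th : int * int -> R * R) k l : R * R :=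
  cmul (freq_dot l (v (k - l))) (th l).

Lemma nsq_ge0 z : 0 <= nsq z.
Proof. by rewrite addr_ge0 ?sqr_ge0. Qed.

Lemma vnsq_ge0 v : 0 <= vnsq v.
Proof. by rewrite addr_ge0 ?nsq_ge0. Qed.

Lemma nsq_cmul z y : nsq (cmul z y) = nsq z * nsq y.
Proof. by rewrite /nsq /=; ring. Qed.

Lemma nsq_rscale c z : nsq (rscale c z) = c ^+ 2 * nsq z.
Proof. by rewrite /nsq /=; ring. Qed.

Lemma nsq_freq_dot k v : nsq (freq_dot k v) <= J k * vnsq v.
Proof.
rewrite /nsq /vnsq /J /=; move: k.1%:~R k.2%:~R v.1 v.2 => a b [c d] [e f]; rewrite /nsq/=.
rewrite -subr_ge0.
have -> : (1 + a ^+ 2 + b ^+ 2) * (c ^+ 2 + d ^+ 2 + (e ^+ 2 + f ^+ 2)) -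
  ((a * c + b * e) ^+ 2 + (a * d + b * f) ^+ 2) =
  (c ^+ 2 + d ^+ 2 + (e ^+ 2 + f ^+ 2)) + ((a * e - b * c) ^+ 2 + (a * f - b * d) ^+ 2) by ring.
by rewrite !addr_ge0 ?sqr_ge0.
Qed.

Lemma nsq_transport v th k l :
  nsq (transport v th k l) <= J l * vnsq (v (k - l)) * nsq (th l).
Proof. by rewrite nsq_cmul ler_wpM2r ?nsq_ge0// nsq_freq_dot. Qed.

Lemma cpair_sumr (I : Type) (s : seq I) (F : I -> R * R) z :
  cpair z (\sum_(i <- s) F i) = \sum_(i <- s) cpair z (F i).
Proof.
elim: s => [|i s IH]; first by rewrite !big_nil /cpair/= !mulr0 subrr.
by rewrite !big_cons -IH /cpair/=; ring.
Qed.

Lemma cpairD z y1 y2 : cpair z (y1 + y2) = cpair z y1 + cpair z y2.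
Proof. by rewrite /cpair/=; ring. Qed.

Lemma cpair_le (a : R) z y : 0 < a -> cpair z y <= 2^-1 * (a * nsq z + a^-1 * nsq y).
Proof.
move=> a0; rewrite -subr_ge0.
have -> : 2^-1 * (a * nsq z + a^-1 * nsq y) - cpair z y =
  2^-1 * a^-1 * ((a * z.1 - y.2) ^+ 2 + (a * z.2 + y.1) ^+ 2).
  by rewrite /nsq /cpair; field; rewrite gt_eqF.
by rewrite mulr_ge0 ?addr_ge0 ?sqr_ge0 ?mulr_ge0 ?invr_ge0 ?ltW.
Qed.

(* Integration by parts in Fourier variables: for a real divergence-free field v,
   the transport term is skew-symmetric. *)
Lemma transport_skew v (eta : int * int -> R * R) s :
  (forall k, v (- k) = (((v k).1.1, - (v k).1.2), ((v k).2.1, - (v k).2.2))) ->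
  (forall k, freq_dot k (v k) = 0) ->
  \sum_(k <- s) \sum_(l <- s) cpair (eta k) (transport v eta k l) = 0.
Proof.
move=> vh vd.
have E k l : cpair (eta k) (transport v eta k l) = - cpair (eta l) (transport v eta l k).
  have := vd (k - l); rewrite /transport -(opprB k l) vh /freq_dot/= => -[].
  rewrite !intrD !intrN.
  move: (v (k - l)) (eta k) (eta l) => [[a b] [c d]] [e f] [g h] /=.
  rewrite /cpair/=; move: k.1%:~R k.2%:~R l.1%:~R l.2%:~R => k1 k2 l1 l2 E1 E2.
  have -> : k1 * a + k2 * c = l1 * a + l2 * c by apply/eqP; rewrite -subr_eq0 -E1; apply/eqP; ring.
  have -> : k1 * - b + k2 * - d = - (l1 * b + l2 * d).
    by apply/eqP; rewrite -subr_eq0 -oppr_eq0 -E2; apply/eqP; ring.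
  ring.
set S := LHS; suff : S = - S by lra.
rewrite {2}/S exchange_big/= -sumrN; apply: eq_bigr => k _.
by rewrite -sumrN; apply: eq_bigr => l _; exact: E.
Qed.

(** The l^1 bound for a convolution in finite form: for fixed [l] the shifts [k - l] of a list
    without repetition have no repetition, so [fin_le f A] applies to them. *)
Lemma sum_conv_le (f g : int * int -> R) (A B : R) F G :
  (forall k, 0 <= f k) -> (forall k, 0 <= g k) -> fin_le f A -> fin_le g B -> uniq F -> uniq G ->
  \sum_(k <- F) \sum_(l <- G) f (k - l) * g l <= A * B.
Proof.
move=> f0 g0 fA gB uF uG.
have A0 : 0 <= A by have := fA [::] isT; rewrite big_nil.
rewrite exchange_big/=; apply: (@le_trans _ _ (\sum_(l <- G) A * g l)).
  apply: ler_sum => l _; rewrite -mulr_suml ler_wpM2r//.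
  have := fA [seq k - l | k <- F]; rewrite big_map; apply.
  by rewrite map_inj_uniq// => a b /addIr.
by rewrite -mulr_sumr ler_wpM2l// gB.
Qed.

(** Young's inequality with the free weight [ze] splits each term into a part quadratic in [eta],
    where the sum over [l] costs [Z], and a convolution of weighted squares of [v] and [th]. The
    commutators and the two product bounds are instances that differ only in the weights. *)
Lemma trilinear_le v th (eta : int * int -> R * R) (s ze : int * int -> int * int -> R)
    (a b : int * int -> R) (K Z A B : R) F G :
  uniq F -> uniq G -> 0 <= K ->
  (forall k, 0 <= a k) -> (forall k, 0 <= b k) -> (forall k l, 0 < ze k l) ->
  (forall k l, s k l ^+ 2 * J l <= K * ze k l * a (k - l) * b l) ->
  (forall k, \sum_(l <- G) ze k l <= Z) ->
  fin_le (fun k => a k * vnsq (v k)) A -> fin_le (fun k => b k * nsq (th k)) B ->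
  \sum_(k <- F) \sum_(l <- G) cpair (eta k) (rscale (s k l) (transport v th k l)) <=
  2^-1 * (Z * \sum_(k <- F) nsq (eta k) + K * (A * B)).
Proof.
move=> uF uG K0 a0 b0 z0 H HZ HA HB.
apply: (@le_trans _ _ (\sum_(k <- F) \sum_(l <- G)
  2^-1 * (ze k l * nsq (eta k) + K * ((a (k - l) * vnsq (v (k - l))) * (b l * nsq (th l)))))).
  apply: ler_sum => k _; apply: ler_sum => l _.
  apply: le_trans (cpair_le _ _ (z0 k l)) _.
  rewrite ler_wpM2l ?invr_ge0// lerD2l nsq_rscale.
  rewrite mulrC ler_pdivrMr//.
  apply: (@le_trans _ _ (s k l ^+ 2 * (J l * vnsq (v (k - l)) * nsq (th l)))).
    by rewrite ler_wpM2l ?sqr_ge0// nsq_transport.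
  have -> : s k l ^+ 2 * (J l * vnsq (v (k - l)) * nsq (th l)) =
    (s k l ^+ 2 * J l) * (vnsq (v (k - l)) * nsq (th l)) by ring.
  apply: le_trans (_ : _ <= (K * ze k l * a (k - l) * b l) * (vnsq (v (k - l)) * nsq (th l))) _.
    by rewrite ler_wpM2r// mulr_ge0 ?nsq_ge0 ?vnsq_ge0.
  by rewrite le_eqVlt; apply/orP; left; apply/eqP; ring.
have -> : \sum_(k <- F) \sum_(l <- G)
    2^-1 * (ze k l * nsq (eta k) + K * ((a (k - l) * vnsq (v (k - l))) * (b l * nsq (th l)))) =
  2^-1 * (\sum_(k <- F) (\sum_(l <- G) ze k l) * nsq (eta k) +
    K * \sum_(k <- F) \sum_(l <- G) (a (k - l) * vnsq (v (k - l))) * (b l * nsq (th l))).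
  rewrite [in RHS]mulr_sumr -big_split/= mulr_sumr; apply: eq_bigr => k _.
  by rewrite -mulr_sumr big_split/= mulr_suml mulr_sumr.
rewrite ler_wpM2l ?invr_ge0// lerD//.
  by rewrite mulr_sumr; apply: ler_sum => k _; rewrite ler_wpM2r ?nsq_ge0.
rewrite ler_wpM2l//; apply: sum_conv_le HA HB uF uG => k.
  by rewrite mulr_ge0 ?vnsq_ge0.
by rewrite mulr_ge0 ?nsq_ge0.
Qed.

End Trilinear.

Lemma cvg_bigsum (R : realType) (T : Type) (s : seq T) (f : T -> nat -> R) (a : T -> R) :
  (forall i, f i @ \oo --> a i) ->
  (fun n => \sum_(i <- s) f i n) @ \oo --> \sum_(i <- s) a i.
Proof.
move=> fa; elim: s => [|i s IH].
  by under eq_fun do rewrite big_nil; rewrite big_nil; exact: cvg_cst.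
by under eq_fun do rewrite big_cons; rewrite big_cons; apply: cvgD.
Qed.

Lemma sum_supp (R : zmodType) (T : eqType) (s t : seq T) (F : T -> R) : uniq s -> uniq t ->
  {subset s <= t} -> (forall x, x \notin s -> F x = 0) ->
  \sum_(x <- s) F x = \sum_(x <- t) F x.
Proof.
move=> us ut st F0; rewrite [RHS](bigID (fun x => x \in s))/= [X in _ + X]big1 ?addr0 => [|x /F0//].
rewrite -[RHS]big_filter; apply: perm_big; apply: uniq_perm => //; first exact: filter_uniq.
move=> x; rewrite mem_filter; apply/idP/andP => [xs|[]//]; split => //; exact: st.
Qed.

Lemma box_sub (m n : nat) : (m <= n)%N -> {subset box m <= box n}.
Proof. by move=> mn k; rewrite !mem_box; lia. Qed.

(** * The energy flux of the truncated difference *)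

Section FluxEnergy.
Context {R : realType}.
Implicit Types (k l m : int * int) (M N : R) (z y : R * R).
Implicit Types (v w : int * int -> (R * R) * (R * R)) (th eta : int * int -> R * R).

Context (r Z : R) (r1 : 1 <= r) (HZ : fin_le (fun k => J k `^ (- r) : R) Z).

Lemma sum_weight_le k F : uniq F ->
  \sum_(l <- F) (J (k - l) `^ (- r) + J l `^ (- r)) <= 2 * Z :> R.
Proof.
move=> uF; rewrite big_split mulr_natl mulr2n lerD ?HZ//.
have := HZ (s := [seq k - l | l <- F]); rewrite big_map; apply.
by rewrite map_inj_uniq// => a b /addrI/oppr_inj.
Qed.

Lemma commutator_le v th eta (c : R) M A B F G :
  uniq F -> uniq G -> 0 < M -> c ^+ 2 = 1 ->
  fin_le (fun k => J k `^ (r + 1) * vnsq (v k)) A ->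
  fin_le (fun k => J k `^ r * nsq (th k)) B ->
  \sum_(k <- F) \sum_(l <- G)
    cpair (eta k) (rscale (c * (chi M k - chi M l)) (transport v th k l)) <=
  2^-1 * (2 * Z * \sum_(k <- F) nsq (eta k) + (4 / M ^+ 2) `^ r * (A * B)).
Proof.
move=> uF uG M0 c1 HA HB.
apply: (@trilinear_le _ v th eta _ (fun k l => J (k - l) `^ (- r) + J l `^ (- r))
  (fun k => J k `^ (r + 1)) (fun k => J k `^ r)) => //.
- exact: powR_ge0.
- by move=> k; exact: powR_ge0.
- by move=> k; exact: powR_ge0.
- by move=> k l; rewrite addr_gt0 ?powR_gt0 ?J_gt0.
- by move=> k l; rewrite exprMn c1 mul1r commutator_weight.
- by move=> k; exact: sum_weight_le.
Qed.

(* The two cutoffs act on different solutions: chi M on the Voigt one, chi N on the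
   Euler one. *)
Definition cutoff_diff M N th1 th2 k := rscale (chi M k) (th1 k) - rscale (chi N k) (th2 k).

(** The truncated difference of the transport terms is the commutator of [chi M] with [v], minus
    that of [chi N] with [w], plus the transport of the cut-off [th2] by [v - w], plus the transport
    of [eta] by [v]. The first two are small, the third is left to the hypothesis on [X], and the
    last one is skew. The fluxes [P1], [P2] are limits over boxes, so the estimate is made for each
    large box and passes to the limit. *)
Lemma flux_energy v w th1 th2 (P1 P2 : int * int -> R * R) M N F A1 B1 A2 B2 X n0 :
  let eta := cutoff_diff M N th1 th2 in
  (forall k, v (- k) = (((v k).1.1, - (v k).1.2), ((v k).2.1, - (v k).2.2))) ->
  (forall k, freq_dot k (v k) = 0) ->
  0 < M -> 0 < N -> F = box n0 -> (forall k, k \notin F -> eta k = 0) ->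
  (forall k, (fun n => \sum_(l <- box n) (transport v th1 k l).1) @ \oo --> (P1 k).1) ->
  (forall k, (fun n => \sum_(l <- box n) (transport v th1 k l).2) @ \oo --> (P1 k).2) ->
  (forall k, (fun n => \sum_(l <- box n) (transport w th2 k l).1) @ \oo --> (P2 k).1) ->
  (forall k, (fun n => \sum_(l <- box n) (transport w th2 k l).2) @ \oo --> (P2 k).2) ->
  fin_le (fun k => J k `^ (r + 1) * vnsq (v k)) A1 ->
  fin_le (fun k => J k `^ r * nsq (th1 k)) B1 ->
  fin_le (fun k => J k `^ (r + 1) * vnsq (w k)) A2 ->
  fin_le (fun k => J k `^ r * nsq (th2 k)) B2 ->
  (forall n, \sum_(k <- F) \sum_(l <- box n)
     cpair (eta k) (rscale (chi N l) (transport (fun m => v m - w m) th2 k l)) <= X) ->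
  \sum_(k <- F) cpair (eta k) (rscale (chi M k) (P1 k) - rscale (chi N k) (P2 k)) <=
  2 * Z * (\sum_(k <- F) nsq (eta k)) +
  2^-1 * ((4 / M ^+ 2) `^ r * (A1 * B1)) + 2^-1 * ((4 / N ^+ 2) `^ r * (A2 * B2)) + X.
Proof.
move=> eta vh vd M0 N0 FE eta0 c11 c12 c21 c22 HA1 HB1 HA2 HB2 HX.
pose L n k := \sum_(l <- box n) (rscale (chi M k) (transport v th1 k l) -
  rscale (chi N k) (transport w th2 k l)).
have LE n k : cpair (eta k) (L n k) =
  (eta k).1 * (chi M k * \sum_(l <- box n) (transport v th1 k l).2 -
               chi N k * \sum_(l <- box n) (transport w th2 k l).2) -
  (eta k).2 * (chi M k * \sum_(l <- box n) (transport v th1 k l).1 -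
               chi N k * \sum_(l <- box n) (transport w th2 k l).1).
  rewrite cpair_sumr !mulr_sumr -!sumrB !mulr_sumr -sumrB.
  by apply: eq_bigr => l _; rewrite /cpair.
have cL : (fun n => \sum_(k <- F) cpair (eta k) (L n k)) @ \oo -->
    \sum_(k <- F) cpair (eta k) (rscale (chi M k) (P1 k) - rscale (chi N k) (P2 k)).
  apply: cvg_bigsum => k; rewrite (funext (fun n => LE n k)).
  apply: cvgB; apply: cvgMl_tmp.
    by apply: cvgB; apply: cvgMl_tmp; [exact: c12|exact: c22].
  by apply: cvgB; apply: cvgMl_tmp; [exact: c11|exact: c21].
apply: (cvgr_to_le cL); near=> n.
have nn : {subset F <= box n}.
  by rewrite FE; apply: box_sub; near: n; exact: nbhs_infty_ge.
have uF : uniq F by rewrite FE uniq_box.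
have uG := uniq_box n.
have E k l : rscale (chi M k) (transport v th1 k l) - rscale (chi N k) (transport w th2 k l) =
    rscale (1 * (chi M k - chi M l)) (transport v th1 k l) +
    rscale (-1 * (chi N k - chi N l)) (transport w th2 k l) +
    rscale (chi N l) (transport (fun m => v m - w m) th2 k l) + transport v eta k l.
  rewrite /eta /cutoff_diff /transport /cmul /freq_dot /rscale /=.
  move: (chi M k) (chi M l) (chi N k) (chi N l) => x1 x2 x3 x4.
  move: (v (k - l)) (w (k - l)) (th1 l) (th2 l) => [[? ?] [? ?]] [[? ?] [? ?]] [? ?] [? ?] /=.
  by apply/pair_equal_spec; split => /=; ring.
have -> : \sum_(k <- F) cpair (eta k) (L n k) =
    \sum_(k <- F) \sum_(l <- box n)
      cpair (eta k) (rscale (1 * (chi M k - chi M l)) (transport v th1 k l)) +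
    \sum_(k <- F) \sum_(l <- box n)
      cpair (eta k) (rscale (-1 * (chi N k - chi N l)) (transport w th2 k l)) +
    \sum_(k <- F) \sum_(l <- box n)
      cpair (eta k) (rscale (chi N l) (transport (fun m => v m - w m) th2 k l)) +
    \sum_(k <- F) \sum_(l <- box n) cpair (eta k) (transport v eta k l).
  rewrite -!big_split/=; apply: eq_bigr => k _.
  rewrite cpair_sumr -!big_split/=; apply: eq_bigr => l _.
  by rewrite E !cpairD.
(* Skew symmetry requires the same index set in both sums; since [eta] vanishes outside [F], the
   outer sum may be enlarged to the box of the inner one. *)
have -> : \sum_(k <- F) \sum_(l <- box n) cpair (eta k) (transport v eta k l) = 0.
  rewrite (sum_supp (t := box n))//; first exact: transport_skew.
  move=> k /eta0 ->; rewrite big1// => l _; by rewrite /cpair/= !mul0r subrr.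
rewrite addr0.
have c1 := @commutator_le v th1 eta 1 M A1 B1 F (box n) uF uG M0 (expr1n _ 2) HA1 HB1.
have m1 : (-1 : R) ^+ 2 = 1 by ring.
have c2 := @commutator_le w th2 eta (-1) N A2 B2 F (box n) uF uG N0 m1 HA2 HB2.
move: (HX n) c1 c2; lra.
Unshelve. all: by end_near. Qed.

End FluxEnergy.

(** * Gronwall's inequality *)

Lemma within_continuousM (R : realType) (A : set R) (f g : R -> R) :
  {within A, continuous f} -> {within A, continuous g} ->
  {within A, continuous (fun x => f x * g x)}.
Proof. by move=> cf cg x; exact: (cvgM (cf x) (cg x)). Qed.

Lemma within_continuousD (R : realType) (A : set R) (f g : R -> R) :
  {within A, continuous f} -> {within A, continuous g} ->
  {within A, continuous (fun x => f x + g x)}.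
Proof. by move=> cf cg x; exact: (cvgD (cf x) (cg x)). Qed.

Lemma within_continuous_cst (R : realType) (A : set R) (c : R) :
  {within A, continuous (fun=> c)}.
Proof. by move=> x; exact: cvg_cst. Qed.

Lemma gronwall (R : realType) (T c d : R) (E dE : R -> R) : 0 < c -> 0 <= d ->
  {within `[0, T], continuous E} ->
  (forall t, t \in `]0, T[ -> is_derive t 1 E (dE t)) ->
  (forall t, t \in `]0, T[ -> dE t <= c * E t + d) -> 0 <= E 0 ->
  forall t, t \in `[0, T] -> E t <= (E 0 + d / c) * expR (c * T).
Proof.
move=> c0 d0 cE DE HE E0 t tT.
(* Integrating factor; the shift by [d / c] absorbs the constant forcing and makes [G]
   nonincreasing. *)
pose G x := expR (- c * x) * (E x + d / c).
have dG x : x \in `]0, T[ -> is_derive x 1 G (expR (- c * x) * (dE x - c * E x - d)).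
  move=> xT; have h1 := DE x xT.
  have h2 : is_derive x 1 (fun x => expR (- c * x)) (expR (- c * x) * - c).
    have h : is_derive x 1 (fun x => - c * x) (- c).
      by have := @is_deriveZ R R R id (- c) x 1 1 (is_derive_id x 1); rewrite /GRing.scale/= mulr1.
    exact: (is_derive1_comp (is_derive_expR (- c * x)) h).
  have h3 : is_derive x 1 (fun x => E x + d / c) (dE x + 0).
    exact: (is_deriveD h1 (is_derive_cst (d / c) x 1)).
  have := is_deriveM h2 h3; rewrite /GRing.scale/= => h4.
  rewrite (_ : expR _ * _ = expR (- c * x) * (dE x + 0) + (E x + d / c) * (expR (- c * x) * - c))//.
  by field; rewrite gt_eqF.
have cG : {within `[0, T], continuous G}.
  apply: within_continuousM; last first.
    by apply: within_continuousD; [exact: cE|exact: within_continuous_cst].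
  apply: continuous_subspaceT => y.
  apply: (@continuous_comp _ _ _ (fun y => - c * y) expR); last exact: continuous_expR.
  by apply: continuousM; [exact: cst_continuous|exact: cvg_id].
have T0 : 0 <= T by move: tT; rewrite in_itv/= => /andP[]; exact: le_trans.
have : G t <= G 0.
  apply: (@ler0_derive1_le_cc _ G 0 T).
  - by move=> x xT; have [] := dG x xT.
  - move=> x xT; rewrite derive1E; have [_ ->] := dG x xT.
    by rewrite mulr_ge0_le0 ?expR_ge0//; move: (HE x xT); lra.
  - exact: cG.
  - exact: tT.
  - by rewrite in_itv/= lexx.
  - by move: tT; rewrite in_itv/= => /andP[].
rewrite /G mulr0 expR0 mul1r => h.
have dc : 0 <= d / c by rewrite divr_ge0// ltW.
apply: (@le_trans _ _ ((E 0 + d / c) * expR (c * t))).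
  rewrite -ler_pdivrMr ?expR_gt0// -expRN -mulNr mulrC; apply: le_trans h.
  by rewrite ler_wpM2l ?expR_ge0// lerDl.
rewrite ler_wpM2l ?addr_ge0// ler_expR ler_pM2l//.
by move: tT; rewrite in_itv/= => /andP[].
Qed.

(** * Product bounds and tails of the cutoffs *)

Section Energy.
Context {R : realType}.
Implicit Types (k l m : int * int) (M N al : R) (z y : R * R).

(** The velocity difference is controlled in L^2 only, so it gets the weight 1 and the Euler
    velocity takes all powers: the exponents [- r] and [r + 1] leave exactly the one power of [J]
    that the derivative costs. *)
Lemma product_bound_velocity (r Z : R) w th eta N A B F G : 1 <= r ->
  fin_le (fun k => J k `^ (- r) : R) Z -> uniq F -> uniq G -> 0 < N ->
  fin_le (fun k => vnsq (w k)) A -> fin_le (fun k => J k `^ (r + 1) * nsq (th k)) B ->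
  \sum_(k <- F) \sum_(l <- G) cpair (eta k) (rscale (chi N l) (transport w th k l)) <=
  2^-1 * (Z * \sum_(k <- F) nsq (eta k) + A * B).
Proof.
move=> r1 HZ uF uG N0 HA HB; rewrite -[A * B]mul1r.
apply: (@trilinear_le R w th eta (fun _ l => chi N l) (fun _ l => J l `^ (- r))
  (fun=> 1) (fun k => J k `^ (r + 1)) 1 Z) => //.
- by move=> k; exact: powR_ge0.
- by move=> k l; rewrite powR_gt0 ?J_gt0.
- move=> k l; rewrite mul1r mulr1 -powRD; last by rewrite J_neq0 implybT.
  rewrite (_ : - r + (r + 1) = 1); last by ring.
  rewrite powRr1 ?J_ge0// ler_piMl ?J_ge0//.
  have := chi_ge0 N l; have := chi_le1 N l; nra.
- by move=> k; exact: HZ.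
- by move=> s us; under eq_bigr do rewrite mul1r; exact: HA.
Qed.

(** The Euler vorticity has one power of [J] less than the velocity. The missing power is moved to
    the velocity difference, which is legitimate because its H^1 norm is controlled by the vorticity
    difference. *)
Lemma product_bound_vorticity (r Z : R) w th eta N A B F G : 1 <= r ->
  fin_le (fun k => J k `^ (- r) : R) Z -> uniq F -> uniq G -> 0 < N ->
  fin_le (fun k => J k * vnsq (w k)) A -> fin_le (fun k => J k `^ r * nsq (th k)) B ->
  \sum_(k <- F) \sum_(l <- G) cpair (eta k) (rscale (chi N l) (transport w th k l)) <=
  2^-1 * (2 * Z * \sum_(k <- F) nsq (eta k) + A * B).
Proof.
move=> r1 HZ uF uG N0 HA HB; rewrite -[A * B]mul1r.
apply: (@trilinear_le R w th eta (fun _ l => chi N l)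
  (fun k l => J (k - l) `^ (- r) + J l `^ (- r))
  (fun k => J k) (fun k => J k `^ r) 1 (2 * Z)) => //.
- by move=> k; exact: J_ge0.
- by move=> k; exact: powR_ge0.
- by move=> k l; rewrite addr_gt0 ?powR_gt0 ?J_gt0.
- move=> k l; rewrite mul1r; apply: le_trans (product_weight k l r1).
  rewrite ler_piMl ?J_ge0//.
  have := chi_ge0 N l; have := chi_le1 N l; nra.
- by move=> k; exact: sum_weight_le.
Qed.

(** The left side vanishes for [jb k <= N] and is at most 1 beyond, where [J k / N ^+ 2] is at least
    1. *)
Lemma chi_tail (r : R) N k : 0 <= r -> 0 < N -> (1 - chi N k) ^+ 2 <= (1 / N ^+ 2) `^ r * J k `^ r.
Proof.
move=> r0 N0; have N20 : 0 < N ^+ 2 by rewrite exprn_gt0.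
have [kN|kN] := leP (jb k) N.
  by rewrite chi1// subrr expr2 mul0r mulr_ge0 ?powR_ge0.
rewrite -powRM ?J_ge0 ?divr_ge0 ?(ltW N20)//.
apply: (@le_trans _ _ 1).
  have := chi_ge0 N k; have := chi_le1 N k; nra.
rewrite -[leLHS](powRr0 (1 / N ^+ 2 * J k)) ler_powR//.
rewrite mulrAC mul1r ler_pdivlMr// mul1r -sqr_jb ler_pXn2r ?nnegrE ?sqrtr_ge0 ?(ltW N0)//.
exact: ltW.
Qed.

Definition vcutoff_diff M N (v w : int * int -> (R * R) * (R * R)) k : (R * R) * (R * R) :=
  (cutoff_diff M N (fun k => (v k).1) (fun k => (w k).1) k,
   cutoff_diff M N (fun k => (v k).2) (fun k => (w k).2) k).

Lemma nsq_add3 (a b c : R * R) : nsq (a + b + c) <= 3 * (nsq a + nsq b + nsq c).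
Proof.
move: a b c => [a a'] [b b'] [c c']; rewrite /nsq/= -subr_ge0.
have -> : 3 * (a ^+ 2 + a' ^+ 2 + (b ^+ 2 + b' ^+ 2) + (c ^+ 2 + c' ^+ 2)) -
  ((a + b + c) ^+ 2 + (a' + b' + c') ^+ 2) =
  ((a - b) ^+ 2 + (b - c) ^+ 2 + (a - c) ^+ 2) +
  ((a' - b') ^+ 2 + (b' - c') ^+ 2 + (a' - c') ^+ 2) by ring.
by rewrite !addr_ge0 ?sqr_ge0.
Qed.

Lemma cutoff_diff_dist M N th1 th2 k : nsq (th1 k - th2 k) <=
  3 * (nsq (cutoff_diff M N th1 th2 k) + (1 - chi M k) ^+ 2 * nsq (th1 k) +
       (1 - chi N k) ^+ 2 * nsq (th2 k)).
Proof.
have -> : th1 k - th2 k = cutoff_diff M N th1 th2 k + rscale (1 - chi M k) (th1 k) +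
    rscale (-1 * (1 - chi N k)) (th2 k).
  rewrite /cutoff_diff /rscale; move: (th1 k) (th2 k) => [a b] [c d].
  by apply/pair_equal_spec; split => /=; ring.
apply: le_trans (nsq_add3 _ _ _) _.
by rewrite !nsq_rscale mulN1r sqrrN.
Qed.

End Energy.

(** * The time derivative of the truncated Voigt energy *)

Section EnergyDerivative.
Context {R : realType}.
Implicit Types (k l m : int * int) (M N al : R) (z y : R * R).

(* cminusi is the multiplication by - i. *)
Definition cdot z y : R := z.1 * y.1 + z.2 * y.2.
Definition cminusi y : R * R := (y.2, - y.1).
Definition ksq k : R := k.1%:~R ^+ 2 + k.2%:~R ^+ 2.

Lemma ksq_ge0 k : 0 <= ksq k.
Proof. by rewrite addr_ge0 ?sqr_ge0. Qed.

Lemma JksqE k : J k = 1 + ksq k.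
Proof. by rewrite /J /ksq addrA. Qed.

Lemma ksq_leJ k : ksq k <= J k.
Proof. by rewrite JksqE lerDr. Qed.

Definition weighted_energy al (F : seq (int * int)) (eta : int * int -> R * R) : R :=
  \sum_(k <- F) (1 + al * ksq k) * nsq (eta k).

Lemma is_derive_bigsum (T : Type) (s : seq T) (f : T -> R -> R) (df : T -> R) (t : R) :
  (forall i, is_derive t 1 (f i) (df i)) ->
  is_derive t 1 (fun t => \sum_(i <- s) f i t) (\sum_(i <- s) df i).
Proof.
move=> H; elim: s => [|i s IH].
  under eq_fun do rewrite big_nil; rewrite big_nil; exact: is_derive_cst.
under eq_fun do rewrite big_cons; rewrite big_cons; exact: (is_deriveD (H i) IH).
Qed.

Lemma is_derive_weighted_energy al F (eta : R -> int * int -> R * R) (deta : int * int -> R * R) (t : R) :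
  (forall k, is_derive t 1 (fun t => (eta t k).1) (deta k).1) ->
  (forall k, is_derive t 1 (fun t => (eta t k).2) (deta k).2) ->
  is_derive t 1 (fun t => weighted_energy al F (eta t))
    (\sum_(k <- F) (1 + al * ksq k) * (2 * cdot (eta t k) (deta k))).
Proof.
move=> d1 d2; apply: is_derive_bigsum => k.
have h1 := is_deriveM (d1 k) (d1 k); have h2 := is_deriveM (d2 k) (d2 k).
have := is_deriveZ (1 + al * ksq k) (is_deriveD h1 h2).
rewrite /GRing.scale/=.
by rewrite (_ : (eta t k).1 * (deta k).1 + (eta t k).1 * (deta k).1 +
  ((eta t k).2 * (deta k).2 + (eta t k).2 * (deta k).2) = 2 * cdot (eta t k) (deta k)) // /cdot; ring.
Qed.

Lemma within_continuous_weighted_energy al F (eta : R -> int * int -> R * R) (A : set R) :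
  (forall k, {within A, continuous (fun t => (eta t k).1)}) ->
  (forall k, {within A, continuous (fun t => (eta t k).2)}) ->
  {within A, continuous (fun t => weighted_energy al F (eta t))}.
Proof.
move=> c1 c2; rewrite /weighted_energy; elim: F => [|k F IH].
  by under eq_fun do rewrite big_nil; exact: within_continuous_cst.
under eq_fun do rewrite big_cons; apply: within_continuousD => //.
apply: within_continuousM; first exact: within_continuous_cst.
by apply: within_continuousD; exact: within_continuousM.
Qed.

(** The multiplier [1 + al * ksq k] turns the Voigt time derivative into its flux exactly. Applied
    to the Euler time derivative it leaves the excess al |k|^2 [dth2], which is split by Young's
    inequality into a part absorbed by the energy and the forcing [al * S]. *)
Lemma weighted_energy_rate al M N F th1 th2 dth1 dth2 (Q1 Q2 : int * int -> R * R) S :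
  0 <= al -> uniq F ->
  (forall k, rscale (1 + al * ksq k) (dth1 k) = cminusi (Q1 k)) ->
  (forall k, dth2 k = cminusi (Q2 k)) ->
  fin_le (fun k => ksq k * chi N k ^+ 2 * nsq (dth2 k)) S ->
  \sum_(k <- F) (1 + al * ksq k) * (2 * cdot (cutoff_diff M N th1 th2 k) (cutoff_diff M N dth1 dth2 k)) <=
  2 * \sum_(k <- F) cpair (cutoff_diff M N th1 th2 k) (rscale (chi M k) (Q1 k) - rscale (chi N k) (Q2 k)) +
  weighted_energy al F (cutoff_diff M N th1 th2) + al * S.
Proof.
move=> al0 uF E1 E2 HS; set eta := cutoff_diff M N th1 th2.
apply: (@le_trans _ _ (2 * \sum_(k <- F) cpair (eta k) (rscale (chi M k) (Q1 k) - rscale (chi N k) (Q2 k)) +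
  weighted_energy al F eta + al * \sum_(k <- F) ksq k * chi N k ^+ 2 * nsq (dth2 k))); last first.
  by rewrite lerD2l ler_wpM2l// HS.
rewrite /weighted_energy !mulr_sumr -!big_split/=; apply: ler_sum => k _.
have H1 := E1 k; have H2 := E2 k.
have -> : (1 + al * ksq k) * (2 * cdot (eta k) (cutoff_diff M N dth1 dth2 k)) =
  2 * cpair (eta k) (rscale (chi M k) (Q1 k) - rscale (chi N k) (Q2 k)) -
  2 * (al * ksq k) * (cdot (eta k) (rscale (chi N k) (dth2 k))).
  have -> : (1 + al * ksq k) * (2 * cdot (eta k) (cutoff_diff M N dth1 dth2 k)) =
     2 * cdot (eta k) (rscale (chi M k) (rscale (1 + al * ksq k) (dth1 k)) -
       rscale (chi N k) (dth2 k)) -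
     2 * (al * ksq k) * (cdot (eta k) (rscale (chi N k) (dth2 k))).
    rewrite /cutoff_diff /cdot /rscale; move: (eta k) (dth1 k) (dth2 k) (chi M k) (chi N k) (ksq k).
    by move=> [a b] [c d] [e f] x y z /=; ring.
  rewrite H1 H2; congr (_ - _); rewrite /cdot /cpair /cminusi /rscale.
  by move: (eta k) (Q1 k) (Q2 k) => [a b] [c d] [e f] /=; ring.
rewrite -addrA lerD2l.
have q0 := ksq_ge0 k; set q := ksq k in q0 *.
have n0 : 0 <= nsq (eta k) by exact: nsq_ge0.
have -> : al * (q * chi N k ^+ 2 * nsq (dth2 k)) = al * q * nsq (rscale (chi N k) (dth2 k)).
  by rewrite nsq_rscale; ring.
move: (rscale (chi N k) (dth2 k)) => b.
rewrite -subr_ge0.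
have -> : (1 + al * q) * nsq (eta k) + al * q * nsq b - - (2 * (al * q) * cdot (eta k) b) =
  nsq (eta k) + al * q * nsq (eta k + b).
  by rewrite /nsq /cdot/=; ring.
by rewrite addr_ge0// mulr_ge0 ?nsq_ge0// mulr_ge0.
Qed.

End EnergyDerivative.

(** * Stability estimates on the Fourier side *)

Section FourierSolutions.
Context {R : realType}.
Implicit Types (k l m : int * int) (M N al : R) (z y : R * R).
Implicit Types (v w : int * int -> (R * R) * (R * R)).

Definition curl_hat v k : R * R :=
  (- (k.1%:~R * (v k).2.2 - k.2%:~R * (v k).1.2), k.1%:~R * (v k).2.1 - k.2%:~R * (v k).1.1).

Definition flux_cvg v (th P : int * int -> R * R) := forall k,
  (fun n => \sum_(l <- box n) (transport v th k l).1) @ \oo --> (P k).1 /\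
  (fun n => \sum_(l <- box n) (transport v th k l).2) @ \oo --> (P k).2.

(* The coefficients v of a solution and dv of its time derivative; al = 0 is the
   Euler case.  The pressure p and the limits P of the truncated transport sums enter
   only through the equations at each frequency. *)
Record fsol (al s T : R) (v dv : R -> int * int -> (R * R) * (R * R)) : Prop := Fsol {
  fs_cont : forall k, [/\ {within `[0, T], continuous (fun t => (v t k).1.1)},
    {within `[0, T], continuous (fun t => (v t k).1.2)},
    {within `[0, T], continuous (fun t => (v t k).2.1)} &
    {within `[0, T], continuous (fun t => (v t k).2.2)}];
  fs_der : forall t, t \in `]0, T[ -> forall k,
    [/\ is_derive t 1 (fun t => (v t k).1.1) (dv t k).1.1,
    is_derive t 1 (fun t => (v t k).1.2) (dv t k).1.2,
    is_derive t 1 (fun t => (v t k).2.1) (dv t k).2.1 &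
    is_derive t 1 (fun t => (v t k).2.2) (dv t k).2.2];
  fs_herm : forall t, t \in `]0, T[ -> forall k,
    v t (- k) = (((v t k).1.1, - (v t k).1.2), ((v t k).2.1, - (v t k).2.2));
  fs_div : forall t, t \in `]0, T[ -> forall k, freq_dot k (v t k) = 0;
  fs_mean : forall t, t \in `]0, T[ -> v t 0 = 0;
  fs_bnd : exists A, forall t, t \in `[0, T] -> fin_le (fun k => J k `^ s * vnsq (v t k)) A;
  fs_dbnd : exists A, forall t, t \in `]0, T[ ->
    fin_le (fun k => J k `^ (s - 1) * vnsq (dv t k)) A;
  fs_vel : forall t, t \in `]0, T[ -> exists P1 P2 p : int * int -> R * R,
    [/\ forall k, rscale (1 + al * ksq k) (dv t k).1 = cminusi (P1 k + rscale k.1%:~R (p k)),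
        forall k, rscale (1 + al * ksq k) (dv t k).2 = cminusi (P2 k + rscale k.2%:~R (p k)),
        flux_cvg (v t) (fun k => (v t k).1) P1 & flux_cvg (v t) (fun k => (v t k).2) P2];
  fs_vort : forall t, t \in `]0, T[ -> exists2 P : int * int -> R * R,
    forall k, rscale (1 + al * ksq k) (curl_hat (dv t) k) = cminusi (P k) &
    flux_cvg (v t) (curl_hat (v t)) P }.

Lemma fin_le_le (a b : int * int -> R) A : (forall k, a k <= b k) -> fin_le b A -> fin_le a A.
Proof. by move=> ab bA s us; apply: le_trans (bA s us); exact: ler_sum. Qed.

Lemma fin_leD (a b : int * int -> R) A B : fin_le a A -> fin_le b B ->
  fin_le (fun k => a k + b k) (A + B).
Proof. by move=> aA bB s us; rewrite big_split lerD ?aA ?bB. Qed.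

Lemma fin_leZ (c : R) (a : int * int -> R) A : 0 <= c -> fin_le a A ->
  fin_le (fun k => c * a k) (c * A).
Proof. by move=> c0 aA s us; rewrite -mulr_sumr ler_wpM2l ?aA. Qed.

Lemma fin_le_ge0 (a : int * int -> R) A : fin_le a A -> 0 <= A.
Proof. by move/(_ [::] isT); rewrite big_nil. Qed.

Lemma fin_leW (a : int * int -> R) A B : fin_le a A -> A <= B -> fin_le a B.
Proof. by move=> aA AB s us; apply: le_trans AB; exact: aA. Qed.

Lemma fin_le_supp (a : int * int -> R) F : uniq F -> (forall k, 0 <= a k) ->
  (forall k, k \notin F -> a k = 0) -> fin_le a (\sum_(k <- F) a k).
Proof.
move=> uF a0 aF s us; rewrite (bigID (fun k => k \in F))/= [X in _ + X]big1 ?addr0; last first.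
  by move=> k /aF.
rewrite -big_filter; apply: sum_le_uniq_sub => //; first exact: filter_uniq.
by move=> k; rewrite mem_filter => /andP[].
Qed.

Lemma chi_box0 N (n : nat) k : 0 < N -> 2 * N <= n%:R -> k \notin box n -> chi N k = 0.
Proof.
move=> N0 Nn kn; apply: chi0 => //; apply: (le_trans Nn).
rewrite -(ler_pXn2r (n := 2)) ?nnegrE ?sqrtr_ge0// sqr_jb /J.
have h (i : int) : ~~ (`|i| <= n%:Z) -> n%:R ^+ 2 <= i%:~R ^+ 2 :> R.
  rewrite -ltNge => ni; rewrite -[leRHS]real_normK ?num_real// ler_pXn2r ?nnegrE//.
  by rewrite -intr_norm pmulrn ler_int ltW.
move: kn; rewrite mem_box negb_and => /orP[/h|/h] k2.
  by apply: (le_trans k2); rewrite -addrA addrCA lerDl addr_ge0 ?sqr_ge0.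
by apply: (le_trans k2); rewrite lerDr addr_ge0 ?sqr_ge0.
Qed.

Lemma cutoff_box0 M N (n : nat) th1 th2 k : 0 < M -> 0 < N ->
  2 * M <= n%:R -> 2 * N <= n%:R -> k \notin box n -> cutoff_diff M N th1 th2 k = 0.
Proof.
move=> M0 N0 Mn Nn kn; rewrite /cutoff_diff (chi_box0 M0 Mn kn) (chi_box0 N0 Nn kn).
by rewrite /rscale !mul0r subrr.
Qed.

(** The commutator errors enter only through (4/N^2)^r, so a cutoff is prescribed by the size of its
    error; every positive size is attained. *)
Lemma exists_cutoff (r c : R) : 0 < r -> 0 < c -> exists2 N, 0 < N & (4 / N ^+ 2) `^ r = c.
Proof.
move=> r0 c0; exists (2 * c `^ (- (2 * r)^-1)); first by rewrite mulr_gt0// powR_gt0.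
rewrite exprMn -(powR_mulrn 2 (powR_ge0 _ _)) -powRrM.
rewrite (_ : - (2 * r)^-1 * 2 = - r^-1); last by field; rewrite gt_eqF.
rewrite powRN (_ : 4 / _ = c `^ r^-1); last first.
  by have := powR_gt0 (r^-1) c0; move: (_ `^ _) => x x0; field; rewrite gt_eqF.
by rewrite -powRrM mulVf ?gt_eqF// powRr1// ltW.
Qed.

Lemma nat_ge (x y : R) : exists n : nat, x <= n%:R /\ y <= n%:R.
Proof.
exists (Num.truncn (Num.max x y)).+1.
by split; rewrite ltW// (le_lt_trans _ (truncnS_gt _))// le_max lexx ?orbT.
Qed.

Lemma invsq_le (r : R) M : 0 <= r -> 0 < M -> (1 / M ^+ 2) `^ r <= (4 / M ^+ 2) `^ r.
Proof.
move=> r0 M0; have M20 : 0 < M ^+ 2 by rewrite exprn_gt0.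
rewrite ge0_ler_powR ?nnegrE ?divr_ge0 ?(ltW M20)//.
by rewrite ler_pM2r ?invr_gt0//; lra.
Qed.

(** Removes the cutoffs: the difference is the truncated one plus the tails discarded by [M] and by
    [N], and the factor 3 comes from squaring a sum of three terms. *)
Lemma vnsq_dist_le (r : R) M N v w A1 A2 F : 0 <= r -> 0 < M -> 0 < N -> uniq F ->
  (forall k, k \notin F -> vcutoff_diff M N v w k = 0) ->
  fin_le (fun k => J k `^ (r + 1) * vnsq (v k)) A1 ->
  fin_le (fun k => J k `^ (r + 1) * vnsq (w k)) A2 ->
  fin_le (fun k => vnsq (v k - w k)) (3 * (\sum_(k <- F) vnsq (vcutoff_diff M N v w k) +
     (4 / M ^+ 2) `^ r * A1 + (4 / N ^+ 2) `^ r * A2)).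
Proof.
move=> r0 M0 N0 uF F0 HA1 HA2.
have h1 : fin_le (fun k => vnsq (vcutoff_diff M N v w k))
    (\sum_(k <- F) vnsq (vcutoff_diff M N v w k)).
  apply: fin_le_supp => // k; first exact: vnsq_ge0.
  by move=> /F0 ->; rewrite /vnsq /nsq/= !expr2 !mul0r !addr0.
have c0 M' : 0 <= (4 / M' ^+ 2) `^ r :> R by exact: powR_ge0.
have := fin_leZ (_ : 0 <= 3 :> R) (fin_leD (fin_leD h1 (fin_leZ (c0 M) HA1)) (fin_leZ (c0 N) HA2)).
move=> /(_ (ler0n R 3)); apply: fin_le_le => k.
have t M' (x : (R * R) * (R * R)) : 0 < M' -> (1 - chi M' k) ^+ 2 * vnsq x <= (4 / M' ^+ 2) `^ r * (J k `^ (r + 1) * vnsq x).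
  move=> M'0; rewrite mulrA ler_wpM2r ?vnsq_ge0//.
  apply: (le_trans (chi_tail k r0 M'0)); apply: ler_pM; rewrite ?powR_ge0 ?invsq_le//.
  by rewrite ler_powR ?J_ge1// lerDl.
apply: le_trans (_ : _ <= 3 * (vnsq (vcutoff_diff M N v w k) + (1 - chi M k) ^+ 2 * vnsq (v k) +
   (1 - chi N k) ^+ 2 * vnsq (w k))) _.
  have e1 := cutoff_diff_dist M N (fun k => (v k).1) (fun k => (w k).1) k.
  have e2 := cutoff_diff_dist M N (fun k => (v k).2) (fun k => (w k).2) k.
  by rewrite /vnsq /vcutoff_diff/=; move: e1 e2; lra.
by rewrite ler_wpM2l// !lerD ?t.
Qed.

(** Lagrange's identity: the squares of the cross and of the dot product of [k] and [v k] add up to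
    |k|^2 |v(k)|^2, and the dot product vanishes. *)
Lemma nsq_curl_hat v k : freq_dot k (v k) = 0 -> nsq (curl_hat v k) = ksq k * vnsq (v k).
Proof.
move=> /pair_equal_spec[]; rewrite /curl_hat /ksq /vnsq /nsq/=.
move: (v k) (k.1%:~R) (k.2%:~R) => [[a b] [c d]] x y /= E1 E2.
have -> : (x ^+ 2 + y ^+ 2) * (a ^+ 2 + b ^+ 2 + (c ^+ 2 + d ^+ 2)) =
  (- (x * d - y * b)) ^+ 2 + (x * c - y * a) ^+ 2 + ((x * a + y * c) ^+ 2 + (x * b + y * d) ^+ 2) by ring.
by rewrite E1 E2 expr0n/= !addr0.
Qed.

Lemma nsq_curl_hat_le v k : nsq (curl_hat v k) <= ksq k * vnsq (v k).
Proof.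
rewrite /curl_hat /ksq /vnsq /nsq/=.
move: (v k) (k.1%:~R) (k.2%:~R) => [[a b] [c d]] x y /=; rewrite -subr_ge0.
have -> : (x ^+ 2 + y ^+ 2) * (a ^+ 2 + b ^+ 2 + (c ^+ 2 + d ^+ 2)) -
  ((- (x * d - y * b)) ^+ 2 + (x * c - y * a) ^+ 2) = (x * a + y * c) ^+ 2 + (x * b + y * d) ^+ 2 by ring.
by rewrite addr_ge0 ?sqr_ge0.
Qed.

Lemma curl_hat_cutoff M N v w k :
  curl_hat (vcutoff_diff M N v w) k = cutoff_diff M N (curl_hat v) (curl_hat w) k.
Proof.
rewrite /curl_hat /vcutoff_diff /cutoff_diff /rscale.
move: (v k) (w k) => [[a b] [c d]] [[e f] [g h]].
by apply/pair_equal_spec; split => /=; ring.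
Qed.

Lemma freq_dot_cutoff M N v w k : freq_dot k (v k) = 0 -> freq_dot k (w k) = 0 ->
  freq_dot k (vcutoff_diff M N v w k) = 0.
Proof.
rewrite /freq_dot /vcutoff_diff /cutoff_diff /rscale.
move: (v k) (w k) => [[a b] [c d]] [[e f] [g h]] /= /pair_equal_spec[E1 E2] /pair_equal_spec[E3 E4].
move: (k.1%:~R) (k.2%:~R) E1 E2 E3 E4 => x y E1 E2 E3 E4.
apply/pair_equal_spec; split.
  rewrite (_ : _ + _ = chi M k * (x * a + y * c) - chi N k * (x * e + y * g)); last by ring.
  by rewrite E1 E3 !mulr0 subr0.
rewrite (_ : _ + _ = chi M k * (x * b + y * d) - chi N k * (x * f + y * h)); last by ring.
by rewrite E2 E4 !mulr0 subr0.
Qed.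

Lemma ksq_ge1 k : k != 0 -> 1 <= ksq k :> R.
Proof.
have h (i : int) : i != 0 -> 1 <= i%:~R ^+ 2 :> R.
  by move=> i0; rewrite -rmorphXn/= -[1]/(1%:~R) ler_int; nia.
move=> k0; rewrite /ksq; have [k1|k1] := eqVneq k.1 0; last by rewrite (le_trans (h _ k1))// lerDl sqr_ge0.
have k2 : k.2 != 0.
  by apply: contraNneq k0 => k2; rewrite [k]surjective_pairing k1 k2.
by rewrite (le_trans (h _ k2))// lerDr sqr_ge0.
Qed.

(** The velocity is recovered from the vorticity: for [k != 0] one has [J k <= 2 * ksq k], whence
    the factor 2, and at [k = 0] both fields have zero mean. *)
Lemma Jvnsq_dist_le (r : R) M N v w A1 A2 F : 0 <= r -> 0 < M -> 0 < N -> uniq F ->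
  (forall k, k \notin F -> vcutoff_diff M N v w k = 0) ->
  (forall k, freq_dot k (v k) = 0) -> (forall k, freq_dot k (w k) = 0) -> v 0 = 0 -> w 0 = 0 ->
  fin_le (fun k => J k `^ (r + 1) * vnsq (v k)) A1 ->
  fin_le (fun k => J k `^ (r + 1) * vnsq (w k)) A2 ->
  fin_le (fun k => J k * vnsq (v k - w k))
    (3 * (2 * (\sum_(k <- F) nsq (cutoff_diff M N (curl_hat v) (curl_hat w) k)) +
     (4 / M ^+ 2) `^ r * A1 + (4 / N ^+ 2) `^ r * A2)).
Proof.
move=> r0 M0 N0 uF F0 dv dw v0 w0 HA1 HA2.
have h1 : fin_le (fun k => nsq (cutoff_diff M N (curl_hat v) (curl_hat w) k))
    (\sum_(k <- F) nsq (cutoff_diff M N (curl_hat v) (curl_hat w) k)).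
  apply: fin_le_supp => // k; first exact: nsq_ge0.
  move=> /F0 E; rewrite -curl_hat_cutoff /curl_hat E /nsq/=.
  by rewrite !mulr0 subrr oppr0 expr0n/= addr0.
have c0 M' : 0 <= (4 / M' ^+ 2) `^ r :> R by exact: powR_ge0.
have := fin_leZ (_ : 0 <= 3 :> R) (fin_leD (fin_leD (fin_leZ (ler0n R 2) h1)
  (fin_leZ (c0 M) HA1)) (fin_leZ (c0 N) HA2)).
move=> /(_ (ler0n R 3)); apply: fin_le_le => k.
have t M' (x : (R * R) * (R * R)) : 0 < M' ->
    J k * ((1 - chi M' k) ^+ 2 * vnsq x) <= (4 / M' ^+ 2) `^ r * (J k `^ (r + 1) * vnsq x).
  have pD : J k `^ (r + 1) = J k `^ r * J k.
    by rewrite powRD ?powRr1 ?J_ge0//; apply/implyP => _; exact: J_neq0.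
  move=> M'0; rewrite pD.
  rewrite (_ : J k * _ = (1 - chi M' k) ^+ 2 * (J k * vnsq x)); last by ring.
  rewrite -[J k `^ r * J k * _]mulrA [leRHS]mulrA.
  rewrite ler_wpM2r ?mulr_ge0 ?vnsq_ge0 ?J_ge0//.
  apply: (le_trans (chi_tail k r0 M'0)); by rewrite ler_wpM2r ?powR_ge0 ?invsq_le.
apply: le_trans (_ : _ <= 3 * (J k * vnsq (vcutoff_diff M N v w k) +
   J k * ((1 - chi M k) ^+ 2 * vnsq (v k)) + J k * ((1 - chi N k) ^+ 2 * vnsq (w k)))) _.
  have e1 := cutoff_diff_dist M N (fun k => (v k).1) (fun k => (w k).1) k.
  have e2 := cutoff_diff_dist M N (fun k => (v k).2) (fun k => (w k).2) k.
  rewrite -!mulrDr mulrCA ler_wpM2l ?J_ge0//.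
  by rewrite /vnsq /vcutoff_diff/=; move: e1 e2; lra.
rewrite ler_wpM2l// !lerD ?t//.
rewrite -curl_hat_cutoff nsq_curl_hat; last exact: freq_dot_cutoff.
have [->|k0] := eqVneq k 0.
  rewrite /vcutoff_diff /cutoff_diff v0 w0 /rscale /vnsq /nsq/=.
  by rewrite !mulr0 subrr expr0n/= !addr0 !mulr0.
rewrite mulrA ler_wpM2r ?vnsq_ge0// JksqE mulr_natl mulr2n lerD2r ksq_ge1//.
Qed.

End FourierSolutions.

(** * Initial energy and time regularity of truncated differences *)

Section CutoffEnergy.
Context {R : realType}.
Implicit Types (k l m : int * int) (M N al : R) (z y : R * R).
Implicit Types (v w : int * int -> (R * R) * (R * R)).

Lemma rscale1 z : rscale 1 z = z.
Proof. by rewrite /rscale !mul1r -surjective_pairing. Qed.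

Lemma cutoff_le_tails (r : R) M N (th1 th2 : int * int -> R * R) W A1 A2 F : 0 <= r -> 0 < M -> 0 < N -> uniq F ->
  fin_le (fun k => nsq (th1 k - th2 k)) W ->
  fin_le (fun k => J k `^ r * nsq (th1 k)) A1 ->
  fin_le (fun k => J k `^ r * nsq (th2 k)) A2 ->
  \sum_(k <- F) nsq (cutoff_diff M N th1 th2 k) <=
   3 * (W + (4 / M ^+ 2) `^ r * A1 + (4 / N ^+ 2) `^ r * A2).
Proof.
move=> r0 M0 N0 uF HW HA1 HA2.
have c0 M' : 0 <= (4 / M' ^+ 2) `^ r :> R by exact: powR_ge0.
have H := fin_leZ (ler0n R 3) (fin_leD (fin_leD HW (fin_leZ (c0 M) HA1)) (fin_leZ (c0 N) HA2)).
apply: le_trans (H F uF); apply: ler_sum => k _.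
have t M' x : 0 < M' -> (1 - chi M' k) ^+ 2 * nsq x <= (4 / M' ^+ 2) `^ r * (J k `^ r * nsq x).
  move=> M'0; rewrite [leRHS]mulrA ler_wpM2r ?nsq_ge0//.
  by apply: (le_trans (chi_tail k r0 M'0)); rewrite ler_wpM2r ?powR_ge0 ?invsq_le.
have -> : cutoff_diff M N th1 th2 k = (th1 k - th2 k) + rscale (-1 * (1 - chi M k)) (th1 k) +
    rscale (1 - chi N k) (th2 k).
  rewrite /cutoff_diff /rscale; move: (th1 k) (th2 k) => [a b] [c d].
  by apply/pair_equal_spec; split => /=; ring.
apply: le_trans (nsq_add3 _ _ _) _.
by rewrite !nsq_rscale mulN1r sqrrN ler_wpM2l// !lerD ?t.
Qed.

Lemma nsq_cutoff_le M N (th1 th2 : int * int -> R * R) k :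
  nsq (cutoff_diff M N th1 th2 k) <= 2 * (nsq (th1 k) + nsq (th2 k)).
Proof.
have h M' : chi M' k ^+ 2 <= 1 by rewrite expr_le1 ?chi_ge0 ?chi_le1.
apply: (@le_trans _ _ (2 * (nsq (rscale (chi M k) (th1 k)) + nsq (rscale (chi N k) (th2 k))))).
  rewrite /cutoff_diff; move: (rscale (chi M k) (th1 k)) (rscale (chi N k) (th2 k)) => [a b] [c d]; rewrite /nsq/= -subr_ge0.
  have -> : 2 * (a ^+ 2 + b ^+ 2 + (c ^+ 2 + d ^+ 2)) - ((a - c) ^+ 2 + (b - d) ^+ 2) =
    (a + c) ^+ 2 + (b + d) ^+ 2 by ring.
  by rewrite addr_ge0 ?sqr_ge0.
by rewrite ler_wpM2l// !nsq_rscale lerD// ler_piMl ?nsq_ge0.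
Qed.

(** Only the unweighted part of the energy is compared with the initial difference. The gradient
    part has the factor [al], so the gradients of the two data are bounded separately. *)
Lemma weighted_energy_init (r : R) al M N (th1 th2 : int * int -> R * R) W A1 A2 G1 G2 F :
  0 <= r -> 0 <= al -> 0 < M -> 0 < N -> uniq F ->
  fin_le (fun k => nsq (th1 k - th2 k)) W ->
  fin_le (fun k => J k `^ r * nsq (th1 k)) A1 ->
  fin_le (fun k => J k `^ r * nsq (th2 k)) A2 ->
  fin_le (fun k => ksq k * nsq (th1 k)) G1 ->
  fin_le (fun k => ksq k * nsq (th2 k)) G2 ->
  weighted_energy al F (cutoff_diff M N th1 th2) <=
  3 * (W + (4 / M ^+ 2) `^ r * A1 + (4 / N ^+ 2) `^ r * A2) + 2 * al * (G1 + G2).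
Proof.
move=> r0 al0 M0 N0 uF HW HA1 HA2 HG1 HG2.
rewrite /weighted_energy; under eq_bigr do rewrite mulrDl mul1r.
rewrite big_split/= lerD//; first exact: cutoff_le_tails.
apply: le_trans (fin_leZ (_ : 0 <= 2 * al) (fin_leD HG1 HG2) uF); last by rewrite mulr_ge0.
apply: ler_sum => k _.
apply: (@le_trans _ _ (al * ksq k * (2 * (nsq (th1 k) + nsq (th2 k))))).
  by rewrite ler_wpM2l ?mulr_ge0 ?ksq_ge0// nsq_cutoff_le.
by rewrite le_eqVlt; apply/orP; left; apply/eqP; ring.
Qed.

Lemma weighted_energy_ge al F eta : 0 <= al -> \sum_(k <- F) nsq (eta k) <= weighted_energy al F eta.
Proof.
move=> al0; apply: ler_sum => k _; rewrite mulrDl mul1r lerDl.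
by rewrite !mulr_ge0 ?ksq_ge0 ?nsq_ge0.
Qed.

Lemma powJ_mono (a b : R) k : a <= b -> J k `^ a <= J k `^ b.
Proof. by move=> ab; rewrite ler_powR// J_ge1. Qed.

Lemma fin_le_comp (a b A : R) v (f : (R * R) * (R * R) -> R) : a <= b ->
  (forall x, 0 <= f x <= vnsq x) ->
  fin_le (fun k => J k `^ b * vnsq (v k)) A -> fin_le (fun k => J k `^ a * f (v k)) A.
Proof.
move=> ab fv; apply: fin_le_le => k; have /andP[f0 f1] := fv (v k).
by apply: ler_pM; rewrite ?powR_ge0 ?powJ_mono.
Qed.

Lemma nsq1_vnsq (x : (R * R) * (R * R)) : 0 <= nsq x.1 <= vnsq x.
Proof. by rewrite nsq_ge0 /vnsq lerDl nsq_ge0. Qed.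

Lemma nsq2_vnsq (x : (R * R) * (R * R)) : 0 <= nsq x.2 <= vnsq x.
Proof. by rewrite nsq_ge0 /vnsq lerDr nsq_ge0. Qed.

Lemma cutoff_component_cont (A : set R) M N (th1 th2 : R -> int * int -> R * R) k :
  {within A, continuous (fun t => (th1 t k).1)} -> {within A, continuous (fun t => (th1 t k).2)} ->
  {within A, continuous (fun t => (th2 t k).1)} -> {within A, continuous (fun t => (th2 t k).2)} ->
  {within A, continuous (fun t => (cutoff_diff M N (th1 t) (th2 t) k).1)} /\
  {within A, continuous (fun t => (cutoff_diff M N (th1 t) (th2 t) k).2)}.
Proof.
have cst (c : R) := @within_continuous_cst R A c.
have E (f g : R -> R) (a b : R) : {within A, continuous f} -> {within A, continuous g} ->
    {within A, continuous (fun t => a * f t - b * g t)}.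
  move=> cf cg; rewrite (_ : (fun t => _) = (fun t => a * f t + (- b) * g t)); last first.
    by apply/funext => t; rewrite mulNr.
  exact: (within_continuousD (within_continuousM (cst a) cf) (within_continuousM (cst (- b)) cg)).
by move=> c1 c2 c3 c4; split; exact: E.
Qed.

Lemma cutoff_component_der M N (th1 th2 : R -> int * int -> R * R) (d1 d2 : int * int -> R * R) (t : R) k :
  is_derive t 1 (fun t => (th1 t k).1) (d1 k).1 -> is_derive t 1 (fun t => (th1 t k).2) (d1 k).2 ->
  is_derive t 1 (fun t => (th2 t k).1) (d2 k).1 -> is_derive t 1 (fun t => (th2 t k).2) (d2 k).2 ->
  is_derive t 1 (fun t => (cutoff_diff M N (th1 t) (th2 t) k).1) (cutoff_diff M N d1 d2 k).1 /\
  is_derive t 1 (fun t => (cutoff_diff M N (th1 t) (th2 t) k).2) (cutoff_diff M N d1 d2 k).2.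
Proof.
move=> h1 h2 h3 h4; split.
  exact: (is_deriveB (is_deriveZ (chi M k) h1) (is_deriveZ (chi N k) h3)).
exact: (is_deriveB (is_deriveZ (chi M k) h2) (is_deriveZ (chi N k) h4)).
Qed.

(** The frequency is moved from the pressure to [eta]; summed over the two components this produces
    [k . eta], which is zero. *)
Lemma cpair_pressure M N (P1 P2 p q : int * int -> R * R) (eta : R * R) (c : R) k :
  cpair eta (rscale (chi M k) (P1 k + rscale c (p k)) - rscale (chi N k) (P2 k + rscale c (q k))) =
  cpair eta (rscale (chi M k) (P1 k) - rscale (chi N k) (P2 k)) +
  cpair (rscale c eta) (rscale (chi M k) (p k) - rscale (chi N k) (q k)).
Proof.
rewrite /cpair /rscale; move: eta (P1 k) (P2 k) (p k) (q k) => [? ?] [? ?] [? ?] [? ?] [? ?] /=.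
ring.
Qed.

End CutoffEnergy.

(** * Stability of the velocity *)

Section VelocityEstimate.
Context {R : realType}.
Implicit Types (k l m : int * int) (M N al : R) (z y : R * R).
Implicit Types (v w : int * int -> (R * R) * (R * R)).

Lemma vcutoff_sum M N v w F :
  \sum_(k <- F) vnsq (vcutoff_diff M N v w k) =
  \sum_(k <- F) nsq (cutoff_diff M N (fun k => (v k).1) (fun k => (w k).1) k) +
  \sum_(k <- F) nsq (cutoff_diff M N (fun k => (v k).2) (fun k => (w k).2) k).
Proof. by rewrite -big_split. Qed.

(** The constant depends on [r], on [T] and on the bounds of the Euler coefficients, hence not on
    [al]. The two components are estimated together because the pressure disappears only from the
    sum of their energies. *)
Lemma velocity_estimate (r T : R) (w dw : R -> int * int -> (R * R) * (R * R)) :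
  1 < r -> 0 < T -> fsol 0 (r + 1) T w dw ->
  exists2 C, 0 < C & forall al (v dv : R -> int * int -> (R * R) * (R * R)), 0 < al -> fsol al (r + 1) T v dv ->
    forall M1 W0, fin_le (fun k => ksq k * vnsq (v 0 k)) M1 ->
    fin_le (fun k => vnsq (v 0 k - w 0 k)) W0 ->
    forall t, t \in `[0, T] -> fin_le (fun k => vnsq (v t k - w t k)) (C * (al + W0 + al * M1)).
Proof.
move=> r1 T0 fw; have r1' := ltW r1; have r0 : 0 < r by lra. have r0' := ltW r0.
have [Z Z0 HZ] := @J_summable R r r1.
have [K HK] := fs_bnd fw; have [K1 HK1] := fs_dbnd fw.
have T00 : 0 \in `[0, T] by rewrite in_itv/= lexx ltW.
have K0 : 0 <= K := fin_le_ge0 (HK 0 T00).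
have K10 : 0 <= K1.
  by apply: (fin_le_ge0 (HK1 (T / 2) _)); rewrite in_itv/=; apply/andP; split; lra.
(* Twice the flux, summed over the components, gives 4 Z from the commutators and Z + 6 K from the
   transport of the Euler field; the 1 comes from the Young splitting of the Voigt term. The terms
   of size [al] are collected in [d']. *)
pose c := 5 * Z + 1 + 6 * K; pose d' := 2 + 2 * K * K + 6 * K * (1 + K) + 2 * K1.
have c0 : 0 < c by rewrite /c; nra.
have c1 : 1 <= c by rewrite /c; nra.
have d0 : 0 <= d' by rewrite /d'; nra.
pose g := expR (c * T).
have g1 : 1 <= g.
  by rewrite -[1](expR0) ler_expR mulr_ge0// ltW.
exists (3 * g * (10 + 12 * K + d')); first by rewrite !mulr_gt0//; lra.
move=> al v dv al0 fv M1 W0 HM1 HW0 t tT.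
have [A1 HA1] := fs_bnd fv.
have A10 : 0 <= A1 := fin_le_ge0 (HA1 0 T00).
have W00 := fin_le_ge0 HW0; have M10 := fin_le_ge0 HM1.
have [N N0 HN] := exists_cutoff r0 al0.
(* The bound [A1] of the Voigt coefficients may depend on [al]; the denominator [1 + A1 + A1 * A1]
   pays for both places where it enters. *)
have [M M0 HM] : exists2 M, 0 < M & (4 / M ^+ 2) `^ r * A1 <= al /\ (4 / M ^+ 2) `^ r * (A1 * A1) <= al.
  have a0 : 0 < al / (1 + A1 + A1 * A1) by rewrite divr_gt0//; nra.
  have [M M0 HM] := exists_cutoff r0 a0; exists M => //; rewrite HM.
  have x0 : 0 < 1 + A1 + A1 * A1 by nra.
  rewrite ![al / _ * _]mulrAC !ler_pdivrMr//; split; rewrite ler_wpM2l ?(ltW al0)//; nra.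
case: HM => HM1' HM2'.
have [n0 [Mn Nn]] := nat_ge (2 * M) (2 * N).
pose F := box n0; have uF : uniq F := uniq_box n0.
pose th1 j t k : R * R := if j then (v t k).1 else (v t k).2.
pose th2 j t k : R * R := if j then (w t k).1 else (w t k).2.
pose eta (j : bool) t := cutoff_diff M N (th1 j t) (th2 j t).
have eta0 j t' k : k \notin F -> eta j t' k = 0.
  by move=> kF; apply: (cutoff_box0 _ _ M0 N0 Mn Nn kF).
have thA (j : bool) t' : t' \in `[0, T] -> fin_le (fun k => J k `^ (r + 1) * nsq (th1 j t' k)) A1 /\
    fin_le (fun k => J k `^ (r + 1) * nsq (th2 j t' k)) K.
  move=> t'T; case: j; split; first [exact: (fin_le_comp (lexx _) nsq1_vnsq (HA1 _ t'T))|
   exact: (fin_le_comp (lexx _) nsq1_vnsq (HK _ t'T))|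
   exact: (fin_le_comp (lexx _) nsq2_vnsq (HA1 _ t'T))|
   exact: (fin_le_comp (lexx _) nsq2_vnsq (HK _ t'T))].
have rr1 : r <= r + 1 by lra.
have thB (j : bool) t' : t' \in `[0, T] -> fin_le (fun k => J k `^ r * nsq (th1 j t' k)) A1 /\
    fin_le (fun k => J k `^ r * nsq (th2 j t' k)) K.
  move=> t'T; case: j; split; first [exact: (fin_le_comp rr1 nsq1_vnsq (HA1 _ t'T))|
   exact: (fin_le_comp rr1 nsq1_vnsq (HK _ t'T))|
   exact: (fin_le_comp rr1 nsq2_vnsq (HA1 _ t'T))|
   exact: (fin_le_comp rr1 nsq2_vnsq (HK _ t'T))].
pose E t := weighted_energy al F (eta true t) + weighted_energy al F (eta false t).
pose deta j t := cutoff_diff M N (fun k => if j then (dv t k).1 else (dv t k).2)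
   (fun k => if j then (dw t k).1 else (dw t k).2).
pose dE t := \sum_(k <- F) (1 + al * ksq k) * (2 * cdot (eta true t k) (deta true t k)) +
   \sum_(k <- F) (1 + al * ksq k) * (2 * cdot (eta false t k) (deta false t k)).
have cE : {within `[0, T], continuous E}.
  have H j k := @cutoff_component_cont R [set` `[0, T]] M N (th1 j) (th2 j) k.
  have Hj j k : {within `[0, T], continuous (fun t => (eta j t k).1)} /\
     {within `[0, T], continuous (fun t => (eta j t k).2)}.
    have [a1 a2 a3 a4] := fs_cont fv k; have [b1 b2 b3 b4] := fs_cont fw k.
    by apply: H; case: j.
  by apply: within_continuousD; apply: within_continuous_weighted_energy => k; case: (Hj true k); case: (Hj false k).
have DE t' : t' \in `]0, T[ -> is_derive t' 1 E (dE t').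
  move=> t'T.
  have Hj j k : is_derive t' 1 (fun t => (eta j t k).1) (deta j t' k).1 /\
     is_derive t' 1 (fun t => (eta j t k).2) (deta j t' k).2.
    have [a1 a2 a3 a4] := fs_der fv t'T k; have [b1 b2 b3 b4] := fs_der fw t'T k.
    by apply: (@cutoff_component_der _ M N (th1 j) (th2 j)); case: j.
  by apply: is_deriveD; apply: is_derive_weighted_energy => k; case: (Hj true k); case: (Hj false k).
have oc t' : t' \in `]0, T[ -> t' \in `[0, T].
  by rewrite !in_itv/= => /andP[/ltW -> /ltW ->].
have HE t' : t' \in `]0, T[ -> dE t' <= c * E t' + al * d'.
  move=> t'o; have t'T := oc _ t'o.
  have [P1 [P2 [p [Pe1 Pe2 Pc1 Pc2]]]] := fs_vel fv t'o.
  have [Q1 [Q2 [q [Qe1 Qe2 Qc1 Qc2]]]] := fs_vel fw t'o.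
  have HdK j : fin_le (fun k => ksq k * chi N k ^+ 2 * nsq (if j then (dw t' k).1 else (dw t' k).2)) K1.
    apply: fin_le_le (HK1 _ t'o) => k; apply: ler_pM.
    - by rewrite mulr_ge0 ?ksq_ge0 ?sqr_ge0.
    - by case: j; exact: nsq_ge0.
    - rewrite (_ : r + 1 - 1 = r); last by ring.
      apply: (@le_trans _ _ (J k)); last exact: le1r_powR (J_ge1 k) r1'.
      apply: le_trans (ksq_leJ k); rewrite ler_piMr ?ksq_ge0//.
      by rewrite expr_le1 ?chi_ge0 ?chi_le1.
    - by case: j; [case/andP: (nsq1_vnsq (dw t' k))|case/andP: (nsq2_vnsq (dw t' k))].
  pose H := \sum_(k <- F) nsq (eta true t' k) + \sum_(k <- F) nsq (eta false t' k).
  have F0 k : k \notin F -> vcutoff_diff M N (v t') (w t') k = 0.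
    move=> kF; exact/pair_equal_spec/(conj (eta0 true t' k kF) (eta0 false t' k kF)).
  have HA : fin_le (fun k => vnsq (v t' k - w t' k)) (3 * (H + al + al * K)).
    apply: fin_leW (vnsq_dist_le r0' M0 N0 uF F0 (HA1 _ t'T) (HK _ t'T)) _.
    by rewrite vcutoff_sum HN ler_wpM2l// !lerD.
  have flux (j : bool) (P Q : int * int -> R * R) : flux_cvg (v t') (th1 j t') P ->
      flux_cvg (w t') (th2 j t') Q ->
      \sum_(k <- F) cpair (eta j t' k) (rscale (chi M k) (P k) - rscale (chi N k) (Q k)) <=
      2 * Z * (\sum_(k <- F) nsq (eta j t' k)) + 2^-1 * al + 2^-1 * (al * (K * K)) +
      2^-1 * (Z * (\sum_(k <- F) nsq (eta j t' k)) + 3 * (H + al + al * K) * K).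
    move=> Pc Qc; have [th1A th2A] := thA j _ t'T; have [th1B th2B] := thB j _ t'T.
    have := @flux_energy R r Z r1' HZ (v t') (w t') (th1 j t') (th2 j t') P Q M N F A1 A1 K K
      (2^-1 * (Z * (\sum_(k <- F) nsq (eta j t' k)) + 3 * (H + al + al * K) * K)) n0
      (fs_herm fv t'o) (fs_div fv t'o) M0 N0 erefl (eta0 j t')
      (fun k => (Pc k).1) (fun k => (Pc k).2) (fun k => (Qc k).1) (fun k => (Qc k).2)
      (HA1 _ t'T) th1B (HK _ t'T) th2B.
    move=> /(_ (fun n => product_bound_velocity _ r1' HZ uF (uniq_box n) N0 HA th2A)).
    move/le_trans; apply; rewrite lerD2r HN lerD// lerD2l ler_wpM2l ?invr_ge0//.
  have D (j : bool) (P Q pp qq : int * int -> R * R) : flux_cvg (v t') (th1 j t') P ->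
      flux_cvg (w t') (th2 j t') Q ->
      (forall k, rscale (1 + al * ksq k) (if j then (dv t' k).1 else (dv t' k).2) = cminusi (P k + pp k)) ->
      (forall k, rscale (1 + 0 * ksq k) (if j then (dw t' k).1 else (dw t' k).2) = cminusi (Q k + qq k)) ->
    \sum_(k <- F) (1 + al * ksq k) * (2 * cdot (eta j t' k) (deta j t' k)) <=
     2 * \sum_(k <- F) cpair (eta j t' k) (rscale (chi M k) (P k + pp k) - rscale (chi N k) (Q k + qq k)) +
     weighted_energy al F (eta j t') + al * K1.
    move=> Pc Qc Pe Qe.
    apply: (@weighted_energy_rate R al M N F (th1 j t') (th2 j t') _ _ _ _ K1 (ltW al0) uF Pe _ (HdK j)).
    by move=> k; rewrite -Qe mul0r addr0 rscale1.
  have D1 := D true P1 Q1 (fun k => rscale k.1%:~R (p k)) (fun k => rscale k.1%:~R (q k)) Pc1 Qc1 Pe1 Qe1.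
  have D2 := D false P2 Q2 (fun k => rscale k.2%:~R (p k)) (fun k => rscale k.2%:~R (q k)) Pc2 Qc2 Pe2 Qe2.
  have F1 := flux true _ _ Pc1 Qc1; have F2 := flux false _ _ Pc2 Qc2.
  (* The cutoffs are scalar multipliers in frequency, so the truncated difference stays
     divergence-free and the pressures cancel at each frequency, although the two are cut off
     differently. *)
  have press : \sum_(k <- F) cpair (rscale k.1%:~R (eta true t' k)) (rscale (chi M k) (p k) - rscale (chi N k) (q k)) +
     \sum_(k <- F) cpair (rscale k.2%:~R (eta false t' k)) (rscale (chi M k) (p k) - rscale (chi N k) (q k)) = 0.
    rewrite -big_split/= big1// => k _.
    have : freq_dot k (eta true t' k, eta false t' k) = 0 :=
      freq_dot_cutoff M N (fs_div fv t'o k) (fs_div fw t'o k).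
    rewrite /freq_dot; move: (eta true t' k) (eta false t' k) => [a b] [a' b'] /= /pair_equal_spec[e1 e2].
    move: (rscale (chi M k) (p k) - rscale (chi N k) (q k)) => [x y]; rewrite /cpair /rscale/=.
    rewrite (_ : _ + _ = (k.1%:~R * a + k.2%:~R * a') * y - (k.1%:~R * b + k.2%:~R * b') * x); last by ring.
    by rewrite e1 e2 !mul0r subrr.
  have s1 : \sum_(k <- F) cpair (eta true t' k) (rscale (chi M k) (P1 k + rscale k.1%:~R (p k)) - rscale (chi N k) (Q1 k + rscale k.1%:~R (q k))) =
    \sum_(k <- F) cpair (eta true t' k) (rscale (chi M k) (P1 k) - rscale (chi N k) (Q1 k)) +
    \sum_(k <- F) cpair (rscale k.1%:~R (eta true t' k)) (rscale (chi M k) (p k) - rscale (chi N k) (q k)).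
    by rewrite -big_split/=; apply: eq_bigr => k _; rewrite cpair_pressure.
  have s2 : \sum_(k <- F) cpair (eta false t' k) (rscale (chi M k) (P2 k + rscale k.2%:~R (p k)) - rscale (chi N k) (Q2 k + rscale k.2%:~R (q k))) =
    \sum_(k <- F) cpair (eta false t' k) (rscale (chi M k) (P2 k) - rscale (chi N k) (Q2 k)) +
    \sum_(k <- F) cpair (rscale k.2%:~R (eta false t' k)) (rscale (chi M k) (p k) - rscale (chi N k) (q k)).
    by rewrite -big_split/=; apply: eq_bigr => k _; rewrite cpair_pressure.
  rewrite s1 in D1; rewrite s2 in D2.
  have HEt : H <= E t' by rewrite /H /E lerD ?weighted_energy_ge ?(ltW al0).
  have cH : (5 * Z + 6 * K) * H <= (5 * Z + 6 * K) * E t' by rewrite ler_wpM2l//; nra.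
  rewrite /dE /c /d'; apply: le_trans (lerD D1 D2) _.
  move: cH; rewrite -/(E t') /E.
  move: F1 F2 press.
  rewrite /H.
  move: (\sum_(k <- F) nsq (eta true t' k)) (\sum_(k <- F) nsq (eta false t' k)) => h1 h2.
  move: (weighted_energy al F (eta true t')) (weighted_energy al F (eta false t')) => e1 e2.
  move: (\sum_(k <- F) _) (\sum_(k <- F) _) (\sum_(k <- F) _) (\sum_(k <- F) _) => f1 f2 f3 f4.
  lra.
have init (j : bool) : weighted_energy al F (eta j 0) <= 3 * (W0 + al + al * K) + 2 * al * (M1 + K).
  have hW : fin_le (fun k => nsq (th1 j 0 k - th2 j 0 k)) W0.
    apply: fin_le_le HW0 => k; rewrite /th1 /th2.
    by case: (j); [case/andP: (nsq1_vnsq (v 0 k - w 0 k))|case/andP: (nsq2_vnsq (v 0 k - w 0 k))].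
  have hG1 : fin_le (fun k => ksq k * nsq (th1 j 0 k)) M1.
    apply: fin_le_le HM1 => k; rewrite ler_wpM2l ?ksq_ge0// /th1.
    by case: (j); [case/andP: (nsq1_vnsq (v 0 k))|case/andP: (nsq2_vnsq (v 0 k))].
  have hG2 : fin_le (fun k => ksq k * nsq (th2 j 0 k)) K.
    apply: fin_le_le (HK _ T00) => k; apply: ler_pM; rewrite ?ksq_ge0 ?nsq_ge0//.
      apply: (le_trans (ksq_leJ k)); apply: le1r_powR (J_ge1 k) _; lra.
    by rewrite /th2; case: (j); [case/andP: (nsq1_vnsq (w 0 k))|case/andP: (nsq2_vnsq (w 0 k))].
  have [B1 B2] := thB j _ T00.
  apply: le_trans (weighted_energy_init r0' (ltW al0) M0 N0 uF hW B1 B2 hG1 hG2) _.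
  by rewrite lerD2r HN ler_wpM2l// lerD2r lerD2l.
have E00 : 0 <= E 0.
  by rewrite addr_ge0// sumr_ge0// => k _; rewrite mulr_ge0 ?nsq_ge0// addr_ge0// mulr_ge0 ?ksq_ge0 ?(ltW al0).
have Et := gronwall c0 (mulr_ge0 (ltW al0) d0) cE DE HE E00 tT.
have F0 k : k \notin F -> vcutoff_diff M N (v t) (w t) k = 0.
  by move=> kF; exact/pair_equal_spec/(conj (eta0 true t k kF) (eta0 false t k kF)).
apply: fin_leW (vnsq_dist_le r0' M0 N0 uF F0 (HA1 _ tT) (HK _ tT)) _.
have H1 : \sum_(k <- F) vnsq (vcutoff_diff M N (v t) (w t) k) <= E t.
  by rewrite vcutoff_sum lerD// weighted_energy_ge ?(ltW al0).
rewrite -!mulrA ler_wpM2l// HN.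
have i1 := init true; have i2 := init false.
have E0b : E 0 + al * d' / c <= 6 * (W0 + al + al * K) + 4 * al * (M1 + K) + al * d'.
  have : al * d' / c <= al * d' by rewrite ler_pdivrMr// ler_peMr// mulr_ge0// ltW.
  by rewrite /E; move: i1 i2; lra.
have al0' := ltW al0.
have S0 : 0 <= al + al * K by rewrite addr_ge0 ?mulr_ge0.
apply: (@le_trans _ _ (g * ((6 * (W0 + al + al * K) + 4 * al * (M1 + K) + al * d') + (al + al * K)))).
  rewrite mulrDr; apply: (@le_trans _ _ (E t + (al + al * K))); first by move: H1 HM1'; lra.
  apply: lerD; last by rewrite ler_peMl.
  by apply: (le_trans Et); rewrite mulrC ler_wpM2l// (le_trans ler01).
rewrite ler_wpM2l ?(le_trans ler01 g1)//.
have p1 : 0 <= al * M1 by rewrite mulr_ge0.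
have p2 : 0 <= K * W0 by rewrite mulr_ge0.
have p3 : 0 <= K * (al * M1) by rewrite mulr_ge0.
have p4 : 0 <= d' * W0 by rewrite mulr_ge0.
have p5 : 0 <= d' * (al * M1) by rewrite mulr_ge0.
have p6 : 0 <= K * al by rewrite mulr_ge0.
move: d' d0 p4 p5 {HE Et E0b} => D D0 p4 p5; nra.
Qed.

End VelocityEstimate.

(** * Stability of the vorticity *)

Section VorticityEstimate.
Context {R : realType}.
Implicit Types (k l m : int * int) (M N al : R) (z y : R * R).
Implicit Types (v w : int * int -> (R * R) * (R * R)).

Lemma cutoff_dist_le (r : R) M N (th1 th2 : int * int -> R * R) A1 A2 F : 0 <= r -> 0 < M -> 0 < N -> uniq F ->
  (forall k, k \notin F -> cutoff_diff M N th1 th2 k = 0) ->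
  fin_le (fun k => J k `^ r * nsq (th1 k)) A1 ->
  fin_le (fun k => J k `^ r * nsq (th2 k)) A2 ->
  fin_le (fun k => nsq (th1 k - th2 k)) (3 * (\sum_(k <- F) nsq (cutoff_diff M N th1 th2 k) +
     (4 / M ^+ 2) `^ r * A1 + (4 / N ^+ 2) `^ r * A2)).
Proof.
move=> r0 M0 N0 uF F0 HA1 HA2.
have h1 : fin_le (fun k => nsq (cutoff_diff M N th1 th2 k))
    (\sum_(k <- F) nsq (cutoff_diff M N th1 th2 k)).
  apply: fin_le_supp => // k; first exact: nsq_ge0.
  by move=> /F0 ->; rewrite /nsq/= expr0n/= addr0.
have c0 M' : 0 <= (4 / M' ^+ 2) `^ r :> R by exact: powR_ge0.
apply: fin_le_le (fin_leZ (ler0n R 3) (fin_leD (fin_leD h1 (fin_leZ (c0 M) HA1)) (fin_leZ (c0 N) HA2))) => k.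
have t M' x : 0 < M' -> (1 - chi M' k) ^+ 2 * nsq x <= (4 / M' ^+ 2) `^ r * (J k `^ r * nsq x).
  move=> M'0; rewrite [leRHS]mulrA ler_wpM2r ?nsq_ge0//.
  by apply: (le_trans (chi_tail k r0 M'0)); rewrite ler_wpM2r ?powR_ge0 ?invsq_le.
apply: le_trans (cutoff_diff_dist M N th1 th2 k) _.
by rewrite ler_wpM2l// !lerD ?t.
Qed.

Lemma powJD1 (r : R) k : J k `^ (r + 1) = J k `^ r * J k.
Proof. by rewrite powRD ?powRr1 ?J_ge0//; apply/implyP => _; exact: J_neq0. Qed.

Lemma curl_hat_bnd (r A : R) v : fin_le (fun k => J k `^ (r + 1) * vnsq (v k)) A ->
  fin_le (fun k => J k `^ r * nsq (curl_hat v k)) A.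
Proof.
apply: fin_le_le => k; rewrite powJD1 -mulrA ler_wpM2l ?powR_ge0//.
by apply: le_trans (nsq_curl_hat_le v k) _; rewrite ler_wpM2r ?vnsq_ge0 ?ksq_leJ.
Qed.

Lemma ksq_curl_hat_bnd (r A : R) v : 1 <= r -> fin_le (fun k => J k `^ (r + 1) * vnsq (v k)) A ->
  fin_le (fun k => ksq k * nsq (curl_hat v k)) A.
Proof.
move=> r1 HA; apply: fin_le_le (curl_hat_bnd HA) => k; rewrite ler_wpM2r ?nsq_ge0//.
exact: le_trans (ksq_leJ k) (le1r_powR (J_ge1 k) r1).
Qed.

Lemma curl_hat_cont (A : set R) (v : R -> int * int -> (R * R) * (R * R)) k :
  [/\ {within A, continuous (fun t => (v t k).1.1)},
    {within A, continuous (fun t => (v t k).1.2)},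
    {within A, continuous (fun t => (v t k).2.1)} &
    {within A, continuous (fun t => (v t k).2.2)}] ->
  {within A, continuous (fun t => (curl_hat (v t) k).1)} /\
  {within A, continuous (fun t => (curl_hat (v t) k).2)}.
Proof.
have cst (c : R) := @within_continuous_cst R A c.
move=> [c1 c2 c3 c4]; split.
  rewrite (_ : (fun t => _) = (fun t => - k.1%:~R * (v t k).2.2 + k.2%:~R * (v t k).1.2)); last first.
    by apply/funext => t; rewrite /curl_hat/=; ring.
  exact: (within_continuousD (within_continuousM (cst _) c4) (within_continuousM (cst _) c2)).
rewrite (_ : (fun t => _) = (fun t => k.1%:~R * (v t k).2.1 + - k.2%:~R * (v t k).1.1)); last first.
  by apply/funext => t; rewrite /curl_hat/=; ring.
exact: (within_continuousD (within_continuousM (cst _) c3) (within_continuousM (cst _) c1)).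
Qed.

Lemma curl_hat_der (v : R -> int * int -> (R * R) * (R * R)) dv (t : R) k :
  [/\ is_derive t 1 (fun t => (v t k).1.1) (dv k).1.1,
    is_derive t 1 (fun t => (v t k).1.2) (dv k).1.2,
    is_derive t 1 (fun t => (v t k).2.1) (dv k).2.1 &
    is_derive t 1 (fun t => (v t k).2.2) (dv k).2.2] ->
  is_derive t 1 (fun t => (curl_hat (v t) k).1) (curl_hat dv k).1 /\
  is_derive t 1 (fun t => (curl_hat (v t) k).2) (curl_hat dv k).2.
Proof.
move=> [c1 c2 c3 c4]; split.
  exact: (is_deriveN (is_deriveB (is_deriveZ k.1%:~R c4) (is_deriveZ k.2%:~R c2))).
exact: (is_deriveB (is_deriveZ k.1%:~R c3) (is_deriveZ k.2%:~R c1)).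
Qed.

(* The second bound gains the factor 1 / al from al |k|^2 >= al for k != 0; it is the
   useful one for large al, where the first grows like al. *)
Lemma vorticity_estimate (r T : R) (w dw : R -> int * int -> (R * R) * (R * R)) :
  1 < r -> 0 < T -> fsol 0 (r + 1) T w dw ->
  exists2 C, 0 < C & forall al (v dv : R -> int * int -> (R * R) * (R * R)), 0 < al ->
    fsol al (r + 1) T v dv ->
    forall N S G1 W0, 0 < N ->
    (forall t, t \in `]0, T[ -> fin_le (fun k => ksq k * chi N k ^+ 2 * nsq (curl_hat (dw t) k)) S) ->
    fin_le (fun k => ksq k * nsq (curl_hat (v 0) k)) G1 ->
    fin_le (fun k => nsq (curl_hat (v 0) k - curl_hat (w 0) k)) W0 ->
    forall t, t \in `[0, T] ->
    fin_le (fun k => nsq (curl_hat (v t) k - curl_hat (w t) k))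
      (C * (W0 + (4 / N ^+ 2) `^ r + al * (G1 + 1 + S))) /\
    fin_le (fun k => nsq (curl_hat (v t) k - curl_hat (w t) k))
      (C * ((W0 + (4 / N ^+ 2) `^ r + al * (G1 + 1 + S)) / al + (4 / N ^+ 2) `^ r)).
Proof.
move=> r1 T0 fw; have r1' := ltW r1; have r0 : 0 < r by lra. have r0' := ltW r0.
have [Z Z0 HZ] := @J_summable R r r1.
have [K HK] := fs_bnd fw.
have T00 : 0 \in `[0, T] by rewrite in_itv/= lexx ltW.
have K0 : 0 <= K := fin_le_ge0 (HK 0 T00).
(* Twice the flux: 4 Z from the commutators, 2 Z and 6 K from the product bound; the 1 is again the
   Young splitting of the Voigt term. The forcing [al * S] is kept apart because [S] depends on the
   cutoff. *)
pose c := 6 * Z + 1 + 6 * K; pose d' := 1 + K * K + 3 * K * (1 + K).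
have c0 : 0 < c by rewrite /c; nra.
have c1 : 1 <= c by rewrite /c; nra.
have d0 : 0 <= d' by rewrite /d'; nra.
pose g := expR (c * T).
have g1 : 1 <= g by rewrite -[1](expR0) ler_expR mulr_ge0// ltW.
exists (3 * g * (10 + 6 * K + d')); first by rewrite !mulr_gt0//; lra.
move=> al v dv al0 fv N S G1 W0 N0 HS HG1 HW0 t tT.
have [A1 HA1] := fs_bnd fv.
have A10 : 0 <= A1 := fin_le_ge0 (HA1 0 T00).
have W00 := fin_le_ge0 HW0; have G10 := fin_le_ge0 HG1.
have S0 : 0 <= S.
  by apply: (fin_le_ge0 (HS (T / 2) _)); rewrite in_itv/=; apply/andP; split; lra.
pose nu := (4 / N ^+ 2) `^ r; rewrite -/nu.
have nu0 : 0 < nu by rewrite powR_gt0// divr_gt0// exprn_gt0.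
have [M M0 HM] : exists2 M, 0 < M & (4 / M ^+ 2) `^ r * A1 <= nu /\ (4 / M ^+ 2) `^ r * (A1 * A1) <= nu.
  have a0 : 0 < nu / (1 + A1 + A1 * A1) by rewrite divr_gt0//; nra.
  have [M M0 HM] := exists_cutoff r0 a0; exists M => //; rewrite HM.
  have x0 : 0 < 1 + A1 + A1 * A1 by nra.
  rewrite ![nu / _ * _]mulrAC !ler_pdivrMr//; split; rewrite ler_wpM2l ?(ltW nu0)//; nra.
case: HM => HM1' HM2'.
have [n0 [Mn Nn]] := nat_ge (2 * M) (2 * N).
pose F := box n0; have uF : uniq F := uniq_box n0.
pose th1 t := curl_hat (v t); pose th2 t := curl_hat (w t).
pose eta t := cutoff_diff M N (th1 t) (th2 t).
have eta0 t' k : k \notin F -> eta t' k = 0.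
  by move=> kF; apply: (cutoff_box0 _ _ M0 N0 Mn Nn kF).
pose E t := weighted_energy al F (eta t).
pose dE t := \sum_(k <- F) (1 + al * ksq k) *
  (2 * cdot (eta t k) (cutoff_diff M N (curl_hat (dv t)) (curl_hat (dw t)) k)).
have cE : {within `[0, T], continuous E}.
  have Hj k : {within `[0, T], continuous (fun t => (eta t k).1)} /\
     {within `[0, T], continuous (fun t => (eta t k).2)}.
    have [a1 a2] := curl_hat_cont (fs_cont fv k); have [b1 b2] := curl_hat_cont (fs_cont fw k).
    exact: (@cutoff_component_cont R [set` `[0, T]] M N th1 th2 k).
  by apply: within_continuous_weighted_energy => k; case: (Hj k).
have DE t' : t' \in `]0, T[ -> is_derive t' 1 E (dE t').
  move=> t'T.
  have Hj k : is_derive t' 1 (fun t => (eta t k).1) (cutoff_diff M N (curl_hat (dv t')) (curl_hat (dw t')) k).1 /\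
     is_derive t' 1 (fun t => (eta t k).2) (cutoff_diff M N (curl_hat (dv t')) (curl_hat (dw t')) k).2.
    have [a1 a2] := curl_hat_der (fs_der fv t'T k); have [b1 b2] := curl_hat_der (fs_der fw t'T k).
    exact: (@cutoff_component_der _ M N th1 th2).
  by apply: is_derive_weighted_energy => k; case: (Hj k).
have oc t' : t' \in `]0, T[ -> t' \in `[0, T].
  by rewrite !in_itv/= => /andP[/ltW -> /ltW ->].
have HE t' : t' \in `]0, T[ -> dE t' <= c * E t' + (nu * d' + al * S).
  move=> t'o; have t'T := oc _ t'o.
  have [P Pe Pc] := fs_vort fv t'o.
  have [Q Qe Qc] := fs_vort fw t'o.
  pose H := \sum_(k <- F) nsq (eta t' k).
  have F0 k : k \notin F -> vcutoff_diff M N (v t') (w t') k = 0.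
    by move=> kF; apply/pair_equal_spec; split; exact: (cutoff_box0 _ _ M0 N0 Mn Nn kF).
  have HA : fin_le (fun k => J k * vnsq (v t' k - w t' k)) (3 * (2 * H + nu + nu * K)).
    apply: fin_leW (Jvnsq_dist_le r0' M0 N0 uF F0 (fs_div fv t'o) (fs_div fw t'o) (fs_mean fv t'o)
      (fs_mean fw t'o) (HA1 _ t'T) (HK _ t'T)) _.
    by rewrite -/nu ler_wpM2l// !lerD.
  have th1B := curl_hat_bnd (HA1 _ t'T); have th2B := curl_hat_bnd (HK _ t'T).
  have flux : \sum_(k <- F) cpair (eta t' k) (rscale (chi M k) (P k) - rscale (chi N k) (Q k)) <=
      2 * Z * H + 2^-1 * nu + 2^-1 * (nu * (K * K)) +
      2^-1 * (2 * Z * H + 3 * (2 * H + nu + nu * K) * K).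
    have := @flux_energy R r Z r1' HZ (v t') (w t') (th1 t') (th2 t') P Q M N F A1 A1 K K
      (2^-1 * (2 * Z * H + 3 * (2 * H + nu + nu * K) * K)) n0
      (fs_herm fv t'o) (fs_div fv t'o) M0 N0 erefl (eta0 t')
      (fun k => (Pc k).1) (fun k => (Pc k).2) (fun k => (Qc k).1) (fun k => (Qc k).2)
      (HA1 _ t'T) th1B (HK _ t'T) th2B.
    move=> /(_ (fun n => product_bound_vorticity _ r1' HZ uF (uniq_box n) N0 HA th2B)).
    by move/le_trans; apply; rewrite lerD2r -/nu lerD// lerD2l ler_wpM2l ?invr_ge0//.
  have D : dE t' <= 2 * \sum_(k <- F) cpair (eta t' k) (rscale (chi M k) (P k) - rscale (chi N k) (Q k)) +
     weighted_energy al F (eta t') + al * S.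
    apply: (@weighted_energy_rate R al M N F (th1 t') (th2 t') _ _ _ _ S (ltW al0) uF Pe _ (HS _ t'o)).
    by move=> k; rewrite -Qe mul0r addr0 rscale1.
  have HEt : H <= E t' by rewrite weighted_energy_ge ?(ltW al0).
  have cH : (6 * Z + 6 * K) * H <= (6 * Z + 6 * K) * E t'.
    by rewrite ler_wpM2l// addr_ge0 ?mulr_ge0.
  apply: (le_trans D); rewrite /c /d' -/(E t').
  move: cH flux; rewrite /H; move: (\sum_(k <- F) nsq (eta t' k)) (E t') (\sum_(k <- F) _) => h e f.
  lra.
have init : E 0 <= 3 * (W0 + nu + nu * K) + 2 * al * (G1 + K).
  have hG2 := ksq_curl_hat_bnd r1' (HK _ T00).
  apply: le_trans (weighted_energy_init r0' (ltW al0) M0 N0 uF HW0 (curl_hat_bnd (HA1 _ T00))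
    (curl_hat_bnd (HK _ T00)) HG1 hG2) _.
  by rewrite lerD2r ler_wpM2l// lerD2r lerD2l.
have al0' := ltW al0; have nu0' := ltW nu0.
have E00 : 0 <= E 0.
  by rewrite sumr_ge0// => k _; rewrite mulr_ge0 ?nsq_ge0// addr_ge0// mulr_ge0 ?ksq_ge0.
have dd0 : 0 <= nu * d' + al * S by rewrite addr_ge0 ?mulr_ge0.
have Et := gronwall c0 dd0 cE DE HE E00 tT.
have F0 k : k \notin F -> cutoff_diff M N (th1 t) (th2 t) k = 0 by exact: eta0.
have dist := cutoff_dist_le r0' M0 N0 uF F0 (curl_hat_bnd (HA1 _ tT)) (curl_hat_bnd (HK _ tT)).
pose X := W0 + nu + al * (G1 + 1 + S).
have Etb : E t <= g * ((9 + 5 * K + d') * X).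
  apply: (le_trans Et); rewrite mulrC ler_wpM2l ?(le_trans ler01 g1)//.
  have h : (nu * d' + al * S) / c <= nu * d' + al * S by rewrite ler_pdivrMr// ler_peMr.
  apply: (@le_trans _ _ (3 * (W0 + nu + nu * K) + 2 * al * (G1 + K) + (nu * d' + al * S))).
    by rewrite lerD.
  have q1 : 0 <= al * G1 by rewrite mulr_ge0. have q2 : 0 <= al * S by rewrite mulr_ge0.
  have q3 : 0 <= K * (al * G1) by rewrite mulr_ge0. have q4 : 0 <= K * (al * S) by rewrite mulr_ge0.
  have q5 : 0 <= K * W0 by rewrite mulr_ge0. have q6 : 0 <= K * nu by rewrite mulr_ge0.
  have q7 : 0 <= d' * W0 by rewrite mulr_ge0. have q8 : 0 <= K * al by rewrite mulr_ge0.
  have q9 : 0 <= d' * (al * (G1 + 1 + S)) by rewrite !mulr_ge0// !addr_ge0.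
  rewrite /X; move: d' d0 q7 q9 {HE Et dd0 h} => D D0 q7 q9; lra.
have X0 : 0 <= X by rewrite /X !addr_ge0// mulr_ge0// !addr_ge0.
have gK : (9 + 5 * K + d') <= 10 + 6 * K + d' by lra.
(* Common end of the two bounds: passing from [9 + 5 * K + d'] to [10 + 6 * K + d'] leaves
   [(1 + K) * Y] for the tails of [M] and [N], which are at most [nu] and [nu * K]. *)
have tail Y : 0 <= Y -> nu <= Y -> \sum_(k <- F) nsq (cutoff_diff M N (th1 t) (th2 t) k) <= g * ((9 + 5 * K + d') * Y) ->
    3 * (\sum_(k <- F) nsq (cutoff_diff M N (th1 t) (th2 t) k) + (4 / M ^+ 2) `^ r * A1 + (4 / N ^+ 2) `^ r * K) <=
    3 * g * (10 + 6 * K + d') * Y.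
  move=> Y0 nY h; rewrite -!mulrA ler_wpM2l// -/nu.
  have g0 := le_trans ler01 g1.
  have -> : g * ((10 + 6 * K + d') * Y) = g * ((9 + 5 * K + d') * Y) + g * ((1 + K) * Y) by ring.
  rewrite -addrA lerD//; apply: (@le_trans _ _ ((1 + K) * Y)); last by rewrite ler_peMl// mulr_ge0// addr_ge0.
  rewrite [leRHS]mulrDl mul1r [K * Y]mulrC lerD ?(le_trans HM1')// ler_wpM2r//.
split.
  apply: fin_leW dist _; apply: tail => //; rewrite -/X.
    by rewrite /X addrAC lerDr addr_ge0// mulr_ge0// !addr_ge0.
  by apply: le_trans Etb; rewrite weighted_energy_ge.
apply: fin_leW dist _; apply: tail => //; rewrite -/X.
- by rewrite addr_ge0// divr_ge0.
- by rewrite lerDr divr_ge0.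
(* The mode [k = 0] does not contribute since a curl has no mean; at all others the energy weight is
   at least [al]. *)
apply: (@le_trans _ _ (E t / al)).
  rewrite ler_pdivlMr// mulr_suml; apply: ler_sum => k _.
  have [->|k0] := eqVneq k 0.
    rewrite /cutoff_diff /th1 /th2 /curl_hat /rscale /nsq/= !mul0r !subrr oppr0 !mulr0 !subrr expr0n/= !addr0 mul0r.
    by rewrite mulr0.
  rewrite mulrC ler_wpM2r ?nsq_ge0//.
  by rewrite ler_wpDl// ler_peMr// ksq_ge1.
apply: (@le_trans _ _ (g * ((9 + 5 * K + d') * (X / al)))).
  by rewrite ler_pdivrMr// -!mulrA mulVf ?mulr1// gt_eqF.
rewrite ler_wpM2l ?(le_trans ler01 g1)// ler_wpM2l ?lerDl//.
by apply: addr_ge0 => //; lra.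
Qed.

End VorticityEstimate.

(** * From fields to coefficients *)

Section FourierOfFields.
Context {R : realType}.
Implicit Types (f g h : R * R -> R) (u : R * R -> R * R) (k l : int * int) (x : R * R).

Definition fhat f k : R * R := (cc f k, - sc f k).
Definition uhat u k : (R * R) * (R * R) := (fhat (fst \o u) k, fhat (snd \o u) k).

Lemma nsq_fhat f k : nsq (fhat f k) = fourier_sq f k.
Proof. by rewrite /nsq /= sqrrN fourier_sqE. Qed.

Lemma vnsq_uhat u k : vnsq (uhat u k) = fourier_sq (fst \o u) k + fourier_sq (snd \o u) k.
Proof. by rewrite /vnsq !nsq_fhat. Qed.

Lemma sum_box_oppr n (F : int * int -> R) : \sum_(l <- box n) F (- l) = \sum_(l <- box n) F l.
Proof.
rewrite -(big_map (fun l => - l) xpredT F); apply: perm_big; apply: uniq_perm.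
- by rewrite map_inj_uniq ?uniq_box//; exact: oppr_inj.
- exact: uniq_box.
- move=> l; apply/mapP/idP => [[l' l'n ->]|ln]; first by rewrite box_oppr.
  by exists (- l); rewrite ?box_oppr ?opprK.
Qed.

Lemma cc_Mecos f k l : continuous f ->
  cc (fun x => f x * ecos k x) l = 2^-1 * (cc f (k - l) + cc f (k + l)).
Proof.
move=> cf; have ce := @continuous_ecos R.
rewrite /cc -mulrDr mulrCA; congr (_ * _).
rewrite -tintD; [|exact: continuousMR|exact: continuousMR].
rewrite -tintZ; last by apply: continuousDR; exact: continuousMR.
by apply: eq_tint => x; rewrite /ecos phaseB phaseD cosB cosD; field.
Qed.

Lemma sc_Mecos f k l : continuous f ->
  sc (fun x => f x * ecos k x) l = 2^-1 * (sc f (k + l) - sc f (k - l)).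
Proof.
move=> cf; have ce := @continuous_esin R.
rewrite /sc -mulrBr mulrCA; congr (_ * _).
rewrite -tintB; [|exact: continuousMR|exact: continuousMR].
rewrite -tintZ; last by apply: continuousBR; exact: continuousMR.
by apply: eq_tint => x; rewrite /ecos /esin phaseB phaseD sinB sinD; field.
Qed.

Lemma cc_Mesin f k l : continuous f ->
  cc (fun x => f x * esin k x) l = 2^-1 * (sc f (k - l) + sc f (k + l)).
Proof.
move=> cf; have ce := @continuous_esin R.
rewrite /cc /sc -mulrDr mulrCA; congr (_ * _).
rewrite -tintD; [|exact: continuousMR|exact: continuousMR].
rewrite -tintZ; last by apply: continuousDR; exact: continuousMR.
by apply: eq_tint => x; rewrite /ecos /esin phaseB phaseD sinB sinD; field.
Qed.

Lemma sc_Mesin f k l : continuous f ->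
  sc (fun x => f x * esin k x) l = 2^-1 * (cc f (k - l) - cc f (k + l)).
Proof.
move=> cf; have ce := @continuous_ecos R.
rewrite /cc /sc -mulrBr mulrCA; congr (_ * _).
rewrite -tintB; [|exact: continuousMR|exact: continuousMR].
rewrite -tintZ; last by apply: continuousBR; exact: continuousMR.
by apply: eq_tint => x; rewrite /ecos /esin phaseB phaseD cosB cosD; field.
Qed.

(** The product with a finite sum is an exact convolution. The product-to-sum formulas produce both
    [k - l] and [k + l]; the reflection of the box merges them into one complex product. *)
Lemma cc_Mpsum f g n k : continuous f -> continuous g ->
  cc (fun x => f x * psum n g x) k = \sum_(l <- box n) (cmul (fhat f (k - l)) (fhat g l)).1.
Proof.
move=> cf cg; have ce := @continuous_ecos R k.
have -> : cc (fun x => f x * psum n g x) k = (2 * pi) ^- 2 * tint (fun x => psum n g x * (f x * ecos k x)).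
  by congr (_ * _); apply: eq_tint => x; ring.
rewrite tint_trigM; last exact: continuousMR.
rewrite mulrA mulVf ?twopi_sq_neq0// mul1r.
rewrite (eq_bigr (fun l => 2^-1 * (cc g l * cc f (k - l) - sc g l * sc f (k - l)) +
   2^-1 * (cc g l * cc f (k + l) + sc g l * sc f (k + l)))); last first.
  by move=> l _; rewrite cc_Mecos// sc_Mecos//; ring.
rewrite big_split/= -[X in _ + X]sum_box_oppr -big_split/=.
by apply: eq_bigr => l _; rewrite ccN scN//; field.
Qed.

Lemma sc_Mpsum f g n k : continuous f -> continuous g ->
  - sc (fun x => f x * psum n g x) k = \sum_(l <- box n) (cmul (fhat f (k - l)) (fhat g l)).2.
Proof.
move=> cf cg; have ce := @continuous_esin R k.
have -> : sc (fun x => f x * psum n g x) k = (2 * pi) ^- 2 * tint (fun x => psum n g x * (f x * esin k x)).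
  by congr (_ * _); apply: eq_tint => x; ring.
rewrite tint_trigM; last exact: continuousMR.
rewrite mulrA mulVf ?twopi_sq_neq0// mul1r.
rewrite (eq_bigr (fun l => 2^-1 * (cc g l * sc f (k - l) + sc g l * cc f (k - l)) +
   2^-1 * (cc g l * sc f (k + l) - sc g l * cc f (k + l)))); last first.
  by move=> l _; rewrite cc_Mesin// sc_Mesin//; ring.
rewrite big_split/= -[X in _ + X]sum_box_oppr -big_split/= -sumrN.
by apply: eq_bigr => l _; rewrite ccN scN//=; field.
Qed.

Lemma tint_young f g (e : R) : continuous f -> continuous g -> 0 < e ->
  `|tint (fun x => f x * g x)| <= 2^-1 * (e * tint (fun x => f x ^+ 2) + e^-1 * tint (fun x => g x ^+ 2)).
Proof.
move=> cf cg e0.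
have cf2 : continuous (fun x => f x ^+ 2) := continuousMR cf cf.
have cg2 : continuous (fun x => g x ^+ 2) := continuousMR cg cg.
have cfg := continuousMR cf cg.
rewrite -!tintZ// -tintD; [|exact: continuousZR|exact: continuousZR].
rewrite -tintZ; last by apply: continuousDR; exact: continuousZR.
have cB : continuous (fun x => 2^-1 * (e * f x ^+ 2 + e^-1 * g x ^+ 2)).
  by apply: continuousZR; apply: continuousDR; exact: continuousZR.
have key a b : a * b <= 2^-1 * (e * a ^+ 2 + e^-1 * b ^+ 2).
  rewrite -subr_ge0 (_ : _ - _ = 2^-1 * e^-1 * (e * a - b) ^+ 2); last by field; rewrite gt_eqF.
  by rewrite mulr_ge0 ?sqr_ge0// mulr_ge0 ?invr_ge0 ?ltW.
rewrite ler_norml; apply/andP; split; last by apply: le_tint => // x _; exact: key.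
rewrite lerNl -mulN1r -tintZ//; apply: le_tint => //; first exact: continuousZR.
by move=> x _; have := key (- f x) (g x); rewrite sqrrN mulN1r mulNr.
Qed.

(** The truncated convolution is the coefficient of [f] times a partial sum of [g], so convergence
    of these partial sums in mean square is enough and no absolute summability is involved. *)
Lemma product_cvg f g k : continuous f -> continuous g -> torus_periodic g ->
  (fun n => \sum_(l <- box n) (cmul (fhat f (k - l)) (fhat g l)).1) @ \oo --> (fhat (fun x => f x * g x) k).1 /\
  (fun n => \sum_(l <- box n) (cmul (fhat f (k - l)) (fhat g l)).2) @ \oo --> (fhat (fun x => f x * g x) k).2.
Proof.
move=> cf cg pg.
have main (b : R * R -> R) (A : R) : continuous b -> (forall x, `|b x| <= 1) ->
    A = (2 * pi) ^- 2 * tint (fun x => f x * g x * b x) ->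
    (fun n => (2 * pi) ^- 2 * tint (fun x => f x * psum n g x * b x)) @ \oo --> A.
  move=> cb b1 ->; apply/cvgrPdist_le => e e0.
  have pi2 := @twopi_sq_gt0 R.
  pose I := tint (fun x => f x ^+ 2).
  have I0 : 0 <= I by apply: tint_ge0 => x _; exact: sqr_ge0.
  (* Weight for Young's inequality: [d * I] is at most (2 pi)^2 e, and the mean-square error is then
     made at most [d] times this quantity. *)
  pose d := (2 * pi) ^+ 2 * e / (1 + I).
  have I1 : 0 < 1 + I by rewrite ltr_pwDl.
  have d0 : 0 < d := divr_gt0 (mulr_gt0 pi2 e0) I1.
  have e'0 : 0 < d * ((2 * pi) ^+ 2 * e) := mulr_gt0 d0 (mulr_gt0 pi2 e0).
  have [n0 Hn] := psum_L2_cvg cg pg e'0.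
  near=> n.
  have nn : (n0 <= n)%N by near: n; exact: nbhs_infty_ge.
  have cS := @continuous_psum R n g; have cgS := continuousBR cg cS.
  rewrite -mulrBr -(tintB (continuousMR (continuousMR cf cg) cb) (continuousMR (continuousMR cf cS) cb)).
  rewrite normrM gtr0_norm ?invr_gt0// -ler_pdivlMl ?invr_gt0// invrK.
  have -> : tint (fun x => f x * g x * b x - f x * psum n g x * b x) =
    tint (fun x => (f x * b x) * (g x - psum n g x)) by apply: eq_tint => x; ring.
  apply: le_trans (tint_young (continuousMR cf cb) cgS d0) _.
  have h1 : tint (fun x => (f x * b x) ^+ 2) <= I.
    apply: le_tint.
    - exact: (continuousMR (continuousMR cf cb) (continuousMR cf cb)).
    - exact: (continuousMR cf cf).
    - move=> x _; rewrite exprMn ler_piMr ?sqr_ge0//.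
      by rewrite -real_normK ?num_real// expr_le1.
  have h2 := Hn n nn.
  have h3 : d * I <= (2 * pi) ^+ 2 * e.
    rewrite /d mulrAC ler_pdivrMr ?ltr_pwDl// ler_wpM2l ?(ltW (mulr_gt0 pi2 e0))//; lra.
  have h4 : d^-1 * tint (fun x => (g x - psum n g x) ^+ 2) <= (2 * pi) ^+ 2 * e.
    by rewrite ler_pdivrMl.
  have h5 : d * tint (fun x => (f x * b x) ^+ 2) <= d * I by rewrite ler_wpM2l// ltW.
  move: h3 h4 h5; move: (_ * e) (d * _) (d * _) (d^-1 * _) => a b' c' d' *; lra.
split.
  under eq_fun => n do rewrite -cc_Mpsum//.
  apply: main => //; first exact: continuous_ecos.
  by move=> x; exact: cos_max.
under eq_fun => n do rewrite -sc_Mpsum//.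
rewrite /=; apply: cvgN; apply: main => //; first exact: continuous_esin.
by move=> x; exact: sin_max.
Unshelve. all: by end_near. Qed.

Lemma bessel f : continuous f -> fin_le (fourier_sq f) ((2 * pi) ^- 2 * tint (fun x => f x ^+ 2)).
Proof.
move=> cf; apply: fin_le_box => [k|n]; first by rewrite -nsq_fhat nsq_ge0.
rewrite ler_pdivlMl ?twopi_sq_gt0// -subr_ge0 -tint_err//.
by apply: tint_ge0 => x _; exact: sqr_ge0.
Qed.

(** By convergence in mean square, the integral exceeds the sum of the squared coefficients over
    some box by an arbitrarily small amount. *)
Lemma parseval_le f (A : R) : continuous f -> torus_periodic f -> fin_le (fourier_sq f) A ->
  tint (fun x => f x ^+ 2) <= (2 * pi) ^+ 2 * A.
Proof.
move=> cf pf HA; apply/ler_addgt0Pr => e e0.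
have [n Hn] := psum_L2_cvg cf pf e0.
have := Hn n (leqnn n); rewrite tint_err// lerBlDl => /le_trans; apply.
by rewrite lerD2r ler_wpM2l ?(ltW (@twopi_sq_gt0 R))// HA// uniq_box.
Qed.

End FourierOfFields.

(** * The equations at a fixed frequency *)

Section Equation.
Context {R : realType}.
Implicit Types (f g h p : R * R -> R) (u du : R * R -> R * R) (k l : int * int) (x : R * R).

Lemma Cn1_continuous f : Cn 1 f -> continuous f.
Proof. by case=> df _ _ x; exact: differentiable_continuous. Qed.

Lemma d1M f g : Cn 1 f -> Cn 1 g -> d1 (fun x => f x * g x) = (fun x => d1 f x * g x + f x * d1 g x).
Proof.
move=> [df _ _] [dg _ _]; apply/funext => x.
rewrite /d1 deriveM; [|exact: diff_derivable|exact: diff_derivable].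
by rewrite /GRing.scale/= addrC mulrC [X in _ + X]mulrC mulrC [X in _ + X]mulrC mulrC.
Qed.

Lemma d2M f g : Cn 1 f -> Cn 1 g -> d2 (fun x => f x * g x) = (fun x => d2 f x * g x + f x * d2 g x).
Proof.
move=> [df _ _] [dg _ _]; apply/funext => x.
rewrite /d2 deriveM; [|exact: diff_derivable|exact: diff_derivable].
by rewrite /GRing.scale/= addrC mulrC [X in _ + X]mulrC mulrC [X in _ + X]mulrC mulrC.
Qed.

Lemma Cn1M f g : Cn 1 f -> Cn 1 g -> Cn 1 (fun x => f x * g x).
Proof.
move=> cf cg; have cf0 := Cn1_continuous cf; have cg0 := Cn1_continuous cg.
have E1 := d1M cf cg; have E2 := d2M cf cg.
case: cf cg => df cf1 cf2 [dg cg1 cg2]; split.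
- by move=> x; exact: differentiableM.
- by rewrite E1; apply: continuousDR; exact: continuousMR.
- by rewrite E2; apply: continuousDR; exact: continuousMR.
Qed.

Lemma periodicM f g : torus_periodic f -> torus_periodic g -> torus_periodic (fun x => f x * g x).
Proof. by move=> pf pg x; rewrite (pf x).1 (pf x).2 (pg x).1 (pg x).2. Qed.

Lemma derive_shift_invariant f (v c x : R * R) : (forall x, f (x + c) = f x) ->
  'D_v f (x + c) = 'D_v f x.
Proof.
move=> fc; rewrite /derive.
have -> : (fun h : R => h^-1 *: ((f \o shift (x + c)) (h *: v) - f (x + c))) =
          (fun h : R => h^-1 *: ((f \o shift x) (h *: v) - f x)); last by [].
by apply/funext => h; rewrite fc /= addrA fc.
Qed.

Lemma periodic_derive f (v : R * R) : torus_periodic f -> torus_periodic (fun x => 'D_v f x).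
Proof.
move=> pf x.
have e1 (y : R * R) : (y.1 + 2 * pi, y.2) = y + (2 * pi, 0).
  by rewrite [in RHS](surjective_pairing y); apply/pair_equal_spec; rewrite /= addr0.
have e2 (y : R * R) : (y.1, y.2 + 2 * pi) = y + (0, 2 * pi).
  by rewrite [in RHS](surjective_pairing y); apply/pair_equal_spec; rewrite /= addr0.
rewrite e1 e2; split; apply: derive_shift_invariant => y.
  by rewrite -e1 (pf y).1.
by rewrite -e2 (pf y).2.
Qed.

Lemma periodic_d1 f : torus_periodic f -> torus_periodic (d1 f).
Proof. exact: periodic_derive. Qed.

Lemma periodic_d2 f : torus_periodic f -> torus_periodic (d2 f).
Proof. exact: periodic_derive. Qed.

Section FixedTime.
Context (u : R * R -> R * R) (pu : torus_periodic u) (cu : vC1 u).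
Let u1 := fst \o u.
Let u2 := snd \o u.

Lemma periodic_fst : torus_periodic u1.
Proof. by move=> x; rewrite /u1/= (pu x).1 (pu x).2. Qed.

Lemma periodic_snd : torus_periodic u2.
Proof. by move=> x; rewrite /u2/= (pu x).1 (pu x).2. Qed.

Lemma continuous_curl : continuous (curl u).
Proof. by case: cu => -[_ _ c12] [_ c21 _]; apply: continuousBR. Qed.

Lemma periodic_curl : torus_periodic (curl u).
Proof.
move=> x; rewrite /curl /=.
by split; congr (_ - _); first [apply: (periodic_d1 periodic_snd x).1|apply: (periodic_d2 periodic_fst x).1
 |apply: (periodic_d1 periodic_snd x).2|apply: (periodic_d2 periodic_fst x).2].
Qed.

Lemma curl_hatE k : curl_hat (uhat u) k = fhat (curl u) k.
Proof.
case: cu => c1 c2; have [_ _ c12] := c1; have [_ c21 _] := c2.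
apply/pair_equal_spec; rewrite /curl_hat /fhat/=; split.
  rewrite (ccB _ c21 c12) (cc_d1 _ periodic_snd c2) (cc_d2 _ periodic_fst c1).
  by rewrite -/u1 -/u2; ring.
rewrite (scB _ c21 c12) (sc_d1 _ periodic_snd c2) (sc_d2 _ periodic_fst c1).
by rewrite -/u1 -/u2; ring.
Qed.

Lemma uhat_herm k : uhat u (- k) = (((uhat u k).1.1, - (uhat u k).1.2), ((uhat u k).2.1, - (uhat u k).2.2)).
Proof.
case: cu => /Cn1_continuous c1 /Cn1_continuous c2.
by rewrite /uhat /fhat/= !ccN !scN.
Qed.

Context (du0 : div_free u).

Lemma uhat_div k : freq_dot k (uhat u k) = 0.
Proof.
case: cu => c1 c2; have [_ c11 _] := c1; have [_ _ c22] := c2.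
have d0 : (fun x => d1 u1 x + d2 u2 x) = (fun=> 0) by apply/funext => x; exact: du0.
have z0 b : tint (fun x => (fun=> 0 : R) x * b x) = 0 :> R.
  by rewrite (@eq_tint _ _ (fun=> 0)) ?tint_cst ?mul0r// => x; rewrite mul0r.
apply/pair_equal_spec; rewrite /freq_dot/=; split.
  have : sc (fun x => d1 u1 x + d2 u2 x) k = 0 by rewrite d0 /sc z0 mulr0.
  rewrite (scD _ c11 c22) (sc_d1 _ periodic_fst c1) (sc_d2 _ periodic_snd c2).
  by rewrite -/u1 -/u2 => e; apply/eqP; rewrite -oppr_eq0 -e; apply/eqP; ring.
have : cc (fun x => d1 u1 x + d2 u2 x) k = 0 by rewrite d0 /cc z0 mulr0.
rewrite (ccD _ c11 c22) (cc_d1 _ periodic_fst c1) (cc_d2 _ periodic_snd c2).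
by rewrite -/u1 -/u2 => e; apply/eqP; rewrite -oppr_eq0 -e; apply/eqP; ring.
Qed.

(** The coefficient of div (u th) divided by i. The divergence form puts no derivative on [th],
    which will be the merely continuous vorticity. *)
Definition flux_hat (th : R * R -> R) k : R * R :=
  (k.1%:~R * cc (fun x => u1 x * th x) k + k.2%:~R * cc (fun x => u2 x * th x) k,
   - (k.1%:~R * sc (fun x => u1 x * th x) k + k.2%:~R * sc (fun x => u2 x * th x) k)).

(** Since [u] is divergence-free, [l] and [k] have the same product with its coefficient at [k - l].
    The advective form in [transport] thus agrees with the divergence form, whose products
    converge. *)
Lemma flux_hat_cvg (th : R * R -> R) : continuous th -> torus_periodic th ->
  flux_cvg (uhat u) (fhat th) (flux_hat th).
Proof.
move=> cth pth k; case: cu => /Cn1_continuous c1 /Cn1_continuous c2.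
have [a1 a2] := product_cvg k c1 cth pth; have [b1 b2] := product_cvg k c2 cth pth.
have E l : transport (uhat u) (fhat th) k l =
    rscale k.1%:~R (cmul (fhat u1 (k - l)) (fhat th l)) +
    rscale k.2%:~R (cmul (fhat u2 (k - l)) (fhat th l)).
  rewrite /transport.
  have -> : freq_dot l (uhat u (k - l)) = freq_dot k (uhat u (k - l)).
    have /pair_equal_spec[] := uhat_div (k - l).
    rewrite /freq_dot/= !intrD !intrN => e1 e2; apply/pair_equal_spec; split.
      by apply/eqP; rewrite -subr_eq0 -oppr_eq0 -e1; apply/eqP; ring.
    by apply/eqP; rewrite -subr_eq0 -oppr_eq0 -e2; apply/eqP; ring.
  rewrite /freq_dot /uhat -/u1 -/u2 /cmul /rscale/=.
  by apply/pair_equal_spec; split => /=; ring.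
split.
  under eq_fun do under eq_bigr do rewrite E.
  rewrite (_ : (fun n => _) = (fun n => k.1%:~R * (\sum_(l <- box n) (cmul (fhat u1 (k - l)) (fhat th l)).1) +
    k.2%:~R * (\sum_(l <- box n) (cmul (fhat u2 (k - l)) (fhat th l)).1))); last first.
    by apply/funext => n; rewrite !mulr_sumr -big_split/=.
  by apply: cvgD; apply: cvgMl_tmp.
under eq_fun do under eq_bigr do rewrite E.
rewrite (_ : (fun n => _) = (fun n => k.1%:~R * (\sum_(l <- box n) (cmul (fhat u1 (k - l)) (fhat th l)).2) +
  k.2%:~R * (\sum_(l <- box n) (cmul (fhat u2 (k - l)) (fhat th l)).2))); last first.
  by apply/funext => n; rewrite !mulr_sumr -big_split/=.
rewrite (_ : (flux_hat th k).2 = k.1%:~R * (fhat (fun x => u1 x * th x) k).2 +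
  k.2%:~R * (fhat (fun x => u2 x * th x) k).2); last by rewrite /flux_hat/=; ring.
by apply: cvgD; apply: cvgMl_tmp.
Qed.

Lemma convect_hat (th : R * R -> R) k : Cn 1 th -> torus_periodic th ->
  cc (fun x => u1 x * d1 th x + u2 x * d2 th x) k = - (flux_hat th k).2 /\
  sc (fun x => u1 x * d1 th x + u2 x * d2 th x) k = - (flux_hat th k).1.
Proof.
move=> cth pth; case: cu => c1 c2.
have -> : (fun x => u1 x * d1 th x + u2 x * d2 th x) =
    (fun x => d1 (fun x => u1 x * th x) x + d2 (fun x => u2 x * th x) x).
  rewrite (d1M c1 cth) (d2M c2 cth); apply/funext => x.
  have : d1 u1 x + d2 u2 x = 0 := du0 x.
  move=> /eqP; rewrite addr_eq0 => /eqP ->; ring.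
have m1 := Cn1M c1 cth; have m2 := Cn1M c2 cth.
have q1 := periodicM periodic_fst pth; have q2 := periodicM periodic_snd pth.
have [_ m11 _] := m1; have [_ _ m22] := m2.
rewrite (ccD _ m11 m22) (scD _ m11 m22).
rewrite (cc_d1 _ q1 m1) (sc_d1 _ q1 m1) (cc_d2 _ q2 m2) (sc_d2 _ q2 m2) /flux_hat/=.
by split; ring.
Qed.

Context (al : R) (du : R * R -> R * R) (D : R * R -> R * R) (p : R * R -> R).
Context (pp : torus_periodic p) (cp : Cn 1 p).
Context (cD1 : continuous (fst \o D)) (cD2 : continuous (snd \o D)).
Context (hD1 : forall k, fhat (fst \o D) k = rscale (1 + al * ksq k) (fhat (fst \o du) k)).
Context (hD2 : forall k, fhat (snd \o D) k = rscale (1 + al * ksq k) (fhat (snd \o du) k)).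
Context (eqn : forall x, D x + convect u x = - grad p x).

Let c1 : Cn 1 u1. Proof. by case: cu. Qed.
Let c2 : Cn 1 u2. Proof. by case: cu. Qed.

Let conv (th : R * R -> R) x := u1 x * d1 th x + u2 x * d2 th x.

Let cconv th : Cn 1 th -> continuous (conv th).
Proof.
move=> [_ h1 h2]; apply: continuousDR; apply: continuousMR => //; exact: Cn1_continuous.
Qed.

Let eq1 : (fun x => (fst \o D) x + conv u1 x) = (fun x => -1 * d1 p x).
Proof. by apply/funext => x; rewrite mulN1r; case: (eqn x). Qed.

Let eq2 : (fun x => (snd \o D) x + conv u2 x) = (fun x => -1 * d2 p x).
Proof. by apply/funext => x; rewrite mulN1r; case: (eqn x). Qed.

(** [D] stands for the whole time-derivative term, [du] for Euler and [du - al * laplace du] for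
    Voigt. It enters through its continuity and its coefficients, so one argument serves both
    systems. *)
Lemma velocity_equation_hat :
  (forall k, rscale (1 + al * ksq k) (uhat du k).1 = cminusi (flux_hat u1 k + rscale k.1%:~R (fhat p k))) /\
  (forall k, rscale (1 + al * ksq k) (uhat du k).2 = cminusi (flux_hat u2 k + rscale k.2%:~R (fhat p k))).
Proof.
have [_ p1 p2] := cp.
split=> k; rewrite /uhat /=.
  rewrite -hD1 /cminusi /rscale/=; have [e1 e2] := convect_hat k c1 periodic_fst.
  have E1 : cc (fst \o D) k + cc (conv u1) k = - 1 * cc (d1 p) k.
    by rewrite -(ccD k cD1 (cconv c1)) eq1 ccZ.
  have E2 : sc (fst \o D) k + sc (conv u1) k = - 1 * sc (d1 p) k.
    by rewrite -(scD k cD1 (cconv c1)) eq1 scZ.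
  rewrite (cc_d1 _ pp cp) /conv e1 in E1; rewrite (sc_d1 _ pp cp) /conv e2 in E2.
  move: E1 E2; rewrite /flux_hat/= => E1 E2.
  by apply/pair_equal_spec; split; lra.
rewrite -hD2 /cminusi /rscale/=; have [e1 e2] := convect_hat k c2 periodic_snd.
have E1 : cc (snd \o D) k + cc (conv u2) k = - 1 * cc (d2 p) k.
  by rewrite -(ccD k cD2 (cconv c2)) eq2 ccZ.
have E2 : sc (snd \o D) k + sc (conv u2) k = - 1 * sc (d2 p) k.
  by rewrite -(scD k cD2 (cconv c2)) eq2 scZ.
rewrite (cc_d2 _ pp cp) /conv e1 in E1; rewrite (sc_d2 _ pp cp) /conv e2 in E2.
move: E1 E2; rewrite /flux_hat/= => E1 E2.
by apply/pair_equal_spec; split; lra.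
Qed.

(* The Lamb form u . grad u = curl u * u^perp + grad (|u|^2 / 2) puts the curl of the
   convective term in divergence form without a second derivative of u. *)
Lemma vorticity_equation_hat k :
  rscale (1 + al * ksq k) (curl_hat (uhat du) k) = cminusi (flux_hat (curl u) k).
Proof.
have [_ p1 p2] := cp.
have cc1 := Cn1_continuous c1; have cc2 := Cn1_continuous c2; have cw := continuous_curl.
pose q x := u1 x * u1 x + u2 x * u2 x.
have cq1 := Cn1M c1 c1; have cq2 := Cn1M c2 c2.
have pq1 := periodicM periodic_fst periodic_fst; have pq2 := periodicM periodic_snd periodic_snd.
have [dq1 q11 q12] := cq1; have [dq2 q21 q22] := cq2.
have L1 : (fun x => (fst \o D) x + 2^-1 * (d1 (fun x => u1 x * u1 x) x + d1 (fun x => u2 x * u2 x) x)) =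
    (fun x => u2 x * curl u x + -1 * d1 p x).
  apply/funext => x; have := congr1 (fun F => F x) eq1; rewrite /conv (d1M c1 c1) (d1M c2 c2) /curl /=.
  rewrite -/u1 -/u2 => E.
  by rewrite -E /u1 /u2/=; field.
have L2 : (fun x => (snd \o D) x + 2^-1 * (d2 (fun x => u1 x * u1 x) x + d2 (fun x => u2 x * u2 x) x)) =
    (fun x => -1 * (u1 x * curl u x) + -1 * d2 p x).
  apply/funext => x; have := congr1 (fun F => F x) eq2; rewrite /conv (d2M c1 c1) (d2M c2 c2) /curl /=.
  rewrite -/u1 -/u2 => E.
  by rewrite -E /u1 /u2/=; field.
have cuw1 : continuous (fun x => u1 x * curl u x) := continuousMR cc1 cw.
have cuw2 : continuous (fun x => u2 x * curl u x) := continuousMR cc2 cw.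
have h1 := hD1 k; have h2 := hD2 k; move/pair_equal_spec: h1 => [h1 h1']; move/pair_equal_spec: h2 => [h2 h2'].
have E1 : cc (fst \o D) k + 2^-1 * (k.1%:~R * sc (fun x => u1 x * u1 x) k + k.1%:~R * sc (fun x => u2 x * u2 x) k) =
   cc (fun x => u2 x * curl u x) k - k.1%:~R * sc p k.
  rewrite -(cc_d1 _ pq1 cq1) -(cc_d1 _ pq2 cq2) -(ccD k q11 q21) -ccZ; last exact: continuousDR.
  rewrite -(ccD k cD1); last exact/continuousZR/continuousDR.
  by rewrite L1 (ccD k cuw2 (continuousZR p1)) ccZ// (cc_d1 _ pp cp) mulN1r.
have E1' : sc (fst \o D) k + 2^-1 * (- k.1%:~R * cc (fun x => u1 x * u1 x) k + - k.1%:~R * cc (fun x => u2 x * u2 x) k) =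
   sc (fun x => u2 x * curl u x) k + k.1%:~R * cc p k.
  rewrite -(sc_d1 _ pq1 cq1) -(sc_d1 _ pq2 cq2) -(scD k q11 q21) -scZ; last exact: continuousDR.
  rewrite -(scD k cD1); last exact/continuousZR/continuousDR.
  by rewrite L1 (scD k cuw2 (continuousZR p1)) scZ// (sc_d1 _ pp cp) mulN1r mulNr opprK.
have E2 : cc (snd \o D) k + 2^-1 * (k.2%:~R * sc (fun x => u1 x * u1 x) k + k.2%:~R * sc (fun x => u2 x * u2 x) k) =
   - cc (fun x => u1 x * curl u x) k - k.2%:~R * sc p k.
  rewrite -(cc_d2 _ pq1 cq1) -(cc_d2 _ pq2 cq2) -(ccD k q12 q22) -ccZ; last exact: continuousDR.
  rewrite -(ccD k cD2); last exact/continuousZR/continuousDR.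
  by rewrite L2 (ccD k (continuousZR cuw1) (continuousZR p2)) !ccZ// (cc_d2 _ pp cp) !mulN1r.
have E2' : sc (snd \o D) k + 2^-1 * (- k.2%:~R * cc (fun x => u1 x * u1 x) k + - k.2%:~R * cc (fun x => u2 x * u2 x) k) =
   - sc (fun x => u1 x * curl u x) k + k.2%:~R * cc p k.
  rewrite -(sc_d2 _ pq1 cq1) -(sc_d2 _ pq2 cq2) -(scD k q12 q22) -scZ; last exact: continuousDR.
  rewrite -(scD k cD2); last exact/continuousZR/continuousDR.
  by rewrite L2 (scD k (continuousZR cuw1) (continuousZR p2)) !scZ// (sc_d2 _ pp cp) !mulN1r mulNr opprK.
move: h1 h1' h2 h2' => /= h1 h1' h2 h2'.
apply/pair_equal_spec; rewrite /curl_hat /rscale /cminusi /uhat /fhat /flux_hat/=.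
rewrite h1 in E1; rewrite h2 in E2.
have s1 : sc (fst \o D) k = (1 + al * ksq k) * sc (fst \o du) k by apply: oppr_inj; rewrite h1' mulrN.
have s2 : sc (snd \o D) k = (1 + al * ksq k) * sc (snd \o du) k by apply: oppr_inj; rewrite h2' mulrN.
rewrite s1 in E1'; rewrite s2 in E2'.
have {}E1 := canRL (addrK _) E1; have {}E1' := canRL (addrK _) E1'.
have {}E2 := canRL (addrK _) E2; have {}E2' := canRL (addrK _) E2'.
(* In k_1 times the second equation minus k_2 times the first, the coefficients of [p] and of |u|^2
   / 2 cancel. *)
split.
  transitivity (k.1%:~R * ((1 + al * ksq k) * sc (snd \o du) k) - k.2%:~R * ((1 + al * ksq k) * sc (fst \o du) k)); first by ring.
  by rewrite E1' E2'; ring.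
transitivity (k.1%:~R * ((1 + al * ksq k) * cc (snd \o du) k) - k.2%:~R * ((1 + al * ksq k) * cc (fst \o du) k)); first by ring.
by rewrite E1 E2; ring.
Qed.

End FixedTime.

End Equation.

(** * Norms and integrability *)

Section Norms.
Context {R : realType}.
Implicit Types (f g h : R * R -> R) (u v : R * R -> R * R) (k l : int * int) (x : R * R).

Lemma poweR_half_sq (e : \bar R) : (0 <= e)%E -> ((e `^ 2^-1) `^ 2 = e)%E.
Proof. by move=> e0; rewrite -poweRrM mulVf// poweRe1. Qed.

Lemma fin_le_esum (a : int * int -> R) (A : R) : (forall k, 0 <= a k) ->
  (\esum_(k in [set: int * int]) (a k)%:E <= A%:E)%E -> fin_le a A.
Proof.
move=> a0 H s us; rewrite -lee_fin; apply: le_trans H.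
apply: esum_ge; exists [set` s]; first by split => //; exact: finite_seq.
rewrite -fsbig_seq// sumEFin//.
Qed.

Lemma Hnorm_fin_le (s M : R) u : 0 <= M -> (Hnorm s u <= M%:E)%E ->
  fin_le (fun k => J k `^ s * vnsq (uhat u k)) (M ^+ 2).
Proof.
move=> M0 H.
have a0 k : 0 <= J k `^ s * vnsq (uhat u k) by rewrite mulr_ge0 ?powR_ge0 ?vnsq_ge0.
apply: fin_le_esum => //.
under eq_esum => k _ do rewrite vnsq_uhat.
have e0 : (0 <= \esum_(k in [set: int * int])
   ((1 + k.1%:~R ^+ 2 + k.2%:~R ^+ 2) `^ s * (fourier_sq (fst \o u) k + fourier_sq (snd \o u) k))%:E :> \bar R)%E.
  by apply: esum_ge0 => k _; rewrite lee_fin mulr_ge0 ?powR_ge0 ?addr_ge0 ?sqr_ge0.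
rewrite -(poweR_half_sq e0).
have -> : (M ^+ 2)%:E = (M%:E `^ 2)%E by rewrite poweR_EFin powR_mulrn.
by apply: gt0_ler_poweR => //; rewrite in_itv/= leey andbT ?poweR_ge0 ?lee_fin.
Qed.

Lemma Hnorm_lty_fin_le (s : R) u : (Hnorm s u < +oo)%E ->
  exists A, fin_le (fun k => J k `^ s * vnsq (uhat u k)) A.
Proof.
move=> H; have H0 : (0 <= Hnorm s u)%E by exact: poweR_ge0.
exists (fine (Hnorm s u) ^+ 2); apply: Hnorm_fin_le; first exact: fine_ge0.
by rewrite fineK// ge0_fin_numE.
Qed.

Lemma L2norm_sq f : (L2norm f `^ 2 = \int[leb2]_(x in cell) ((f x) ^+ 2)%:E)%E.
Proof.
rewrite /L2norm poweR_Lnorm// [RHS]integral_mkcond; apply: eq_integral => x _.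
rewrite !patchE; case: ifPn => _; first by rewrite /= powR_mulrn// real_normK ?num_real.
by rewrite abse0 poweR0r.
Qed.

Lemma L2norm_ge0 f : (0 <= L2norm f)%E.
Proof. exact: Lnorm_ge0. Qed.

Lemma L2norm_continuous f : continuous f -> L2norm f = (Num.sqrt (tint (fun x => f x ^+ 2)))%:E.
Proof.
move=> cf; have cf2 : continuous (fun x => f x ^+ 2) := continuousMR cf cf.
have h := L2norm_sq f.
have i0 : 0 <= tint (fun x => f x ^+ 2) by apply: tint_ge0 => x _; exact: sqr_ge0.
have E : (L2norm f `^ 2 = (tint (fun x => f x ^+ 2))%:E)%E.
  by rewrite h /tint /Rintegral fineK//; exact: (integrable_fin_num cell_measurable (continuous_integrable cf2)).
rewrite -[LHS]poweRe1 ?L2norm_ge0// -(@mulfV _ 2)// poweRrM E poweR_EFin powR12_sqrt//.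
Qed.

Lemma vL2norm_sq u : (vL2norm u `^ 2 = \int[leb2]_(x in cell) ((u x).1 ^+ 2 + (u x).2 ^+ 2)%:E)%E.
Proof.
rewrite /vL2norm L2norm_sq; apply: eq_integral => x _.
by rewrite /= sqr_sqrtr// addr_ge0 ?sqr_ge0.
Qed.

Definition tintegrable f := leb2.-integrable cell (EFin \o f).

(** On a set of finite measure L^2 lies in L^1, here through |a| <= 1 + a^2 + b^2. *)
Lemma vL2_integrable u : vL2 u -> tintegrable (fst \o u) /\ tintegrable (snd \o u).
Proof.
move=> [_ mu nu].
have mc := @cell_measurable R.
have m1 : measurable_fun setT (fst \o u) by apply: measurableT_comp mu; exact: measurable_fst.
have m2 : measurable_fun setT (snd \o u) by apply: measurableT_comp mu; exact: measurable_snd.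
pose q x := (u x).1 ^+ 2 + (u x).2 ^+ 2.
have mq : measurable_fun setT q.
  by apply: measurable_funD; apply: measurable_funX.
have iq : tintegrable q.
  apply/integrableP; split; first by apply/measurable_EFinP/measurable_funTS.
  have : (vL2norm u `^ 2 < +oo)%E by exact: poweR_lty.
  rewrite vL2norm_sq; apply: le_lt_trans; rewrite le_eqVlt; apply/orP; left; apply/eqP.
  by apply: eq_integral => x _; rewrite /= ger0_norm// addr_ge0 ?sqr_ge0.
have i1 : tintegrable (fun=> 1).
  by apply: continuous_integrable; exact: cst_continuous.
have ig : leb2.-integrable cell (EFin \o (fun x => 1 + q x)).
  rewrite (_ : EFin \o _ = (EFin \o (fun=> 1)) \+ (EFin \o q)); last by apply/funext.
  exact: integrableD.
have bnd (a b : R) : `|a| <= `|1 + (a ^+ 2 + b ^+ 2)|.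
  rewrite [leRHS]ger0_norm ?addr_ge0 ?sqr_ge0// -[a ^+ 2]real_normK ?num_real//.
  have := sqr_ge0 b; have := sqr_ge0 (`|a| - 1); nra.
split.
  apply: le_integrable ig => //; first by apply/measurable_EFinP/measurable_funTS.
  by move=> x _ /=; rewrite lee_fin bnd.
apply: le_integrable ig => //; first by apply/measurable_EFinP/measurable_funTS.
by move=> x _ /=; rewrite lee_fin /q addrC [_ ^+ 2 + _]addrC addrC bnd.
Qed.

Lemma tintegrableM f b : tintegrable f -> continuous b -> (forall x, `|b x| <= 1) ->
  tintegrable (fun x => f x * b x).
Proof.
move=> fi cb b1; have mc := @cell_measurable R.
have /integrableP[mf _] := fi; apply: le_integrable fi => //.
  apply/measurable_EFinP/measurable_funM; first exact/measurable_EFinP.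
  by apply: measurable_funTS; exact: continuous_measurable_plane.
by move=> x _ /=; rewrite lee_fin normrM ler_piMr.
Qed.

(** Linearity for integrable functions: the time derivatives are known only as L^2 fields, so the
    version for continuous functions does not cover the difference quotients. *)
Lemma fhatB f g k : tintegrable f -> tintegrable g ->
  fhat (fun x => f x - g x) k = fhat f k - fhat g k.
Proof.
move=> fi gi; have mc := @cell_measurable R.
have E b : continuous b -> (forall x, `|b x| <= 1) ->
    tint (fun x => (f x - g x) * b x) = tint (fun x => f x * b x) - tint (fun x => g x * b x).
  move=> cb b1; rewrite (@eq_tint _ _ (fun x => f x * b x - g x * b x)); last by move=> x; ring.
  by apply: RintegralB => //; exact: tintegrableM.
have e1 := E _ (@continuous_ecos R k) (fun x => cos_max _).
have e2 := E _ (@continuous_esin R k) (fun x => sin_max _).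
apply/pair_equal_spec; rewrite /fhat /cc /sc/= e1 e2; split; ring.
Qed.

Lemma fhatZ (c : R) f k : tintegrable f -> fhat (fun x => c * f x) k = rscale c (fhat f k).
Proof.
move=> fi; have mc := @cell_measurable R.
have E b : continuous b -> (forall x, `|b x| <= 1) ->
    tint (fun x => (c * f x) * b x) = c * tint (fun x => f x * b x).
  move=> cb b1; rewrite (@eq_tint _ _ (fun x => c * (f x * b x))); last by move=> x; ring.
  by apply: RintegralZl => //; exact: tintegrableM.
have e1 := E _ (@continuous_ecos R k) (fun x => cos_max _).
have e2 := E _ (@continuous_esin R k) (fun x => sin_max _).
apply/pair_equal_spec; rewrite /fhat /rscale /cc /sc/= e1 e2; split; ring.
Qed.

Lemma tintegrableB f g : tintegrable f -> tintegrable g -> tintegrable (fun x => f x - g x).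
Proof.
move=> fi gi; have mc := @cell_measurable R.
rewrite /tintegrable (_ : EFin \o _ = ((EFin \o f) \- (EFin \o g))%E); last by apply/funext.
exact: integrableB.
Qed.

Lemma tintegrableZ (c : R) f : tintegrable f -> tintegrable (fun x => c * f x).
Proof.
move=> fi; have mc := @cell_measurable R.
rewrite /tintegrable (_ : EFin \o _ = (fun x => c%:E * (EFin \o f) x)%E); last by apply/funext.
exact: integrableZl.
Qed.

End Norms.

(** * Regularity in time of the coefficients *)

Section TimeRegularity.
Context {R : realType}.
Implicit Types (f g h : R * R -> R) (k l : int * int).
Implicit Types (u dtu : R -> R * R -> R * R) (s T t : R).

Lemma cvge0_near (F : set_system R) (FF : Filter F) (f : R -> \bar R) (e : R) :
  (forall y, (0 <= f y)%E) -> f @ F --> 0%E -> 0 < e -> \forall y \near F, (f y <= e%:E)%E.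
Proof.
move=> f0 /fine_cvgP[fin cf] e0.
have /cvgrPdist_le /(_ e e0) := cf.
move: fin; apply: filterS2 => x fx; rewrite sub0r normrN /= => h.
rewrite -(fineK fx) lee_fin; apply: le_trans h; exact: ler_norm.
Qed.

Lemma Hnorm_ge0 s (v : R * R -> R * R) : (0 <= Hnorm s v)%E.
Proof. exact: poweR_ge0. Qed.

Lemma contHs_near s T u t (e : R) : contHs s T u -> t \in `[0, T] -> 0 < e ->
  exists2 d, 0 < d & forall t', t' \in `[0, T] -> `|t' - t| < d ->
    (Hnorm s (fun x => (u t' x - u t x)%R) <= e%:E)%E.
Proof.
move=> cu tT e0; have [_ cv] := cu t tT.
have H0 := cvge0_near _ (fun t' => Hnorm_ge0 s (fun x => u t' x - u t x)) cv e0.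
have /nbhs_ballP[d /= d0 H] : nbhs t [set t' | t' \in `[0, T] ->
    (Hnorm s (fun x => (u t' x - u t x)%R) <= e%:E)%E] by exact: H0.
exists d => // t' t'T t't.
by apply: H => //; rewrite /ball/= distrC.
Qed.

Lemma derivHs_near s T u dtu t (e : R) : derivHs s T u dtu -> t \in `[0, T] -> 0 < e ->
  exists2 d, 0 < d & forall t', t' \in `[0, T] -> t' != t -> `|t' - t| < d ->
    (Hnorm s (fun x => ((t' - t)^-1 * ((u t' x).1 - (u t x).1) - (dtu t x).1,
                       (t' - t)^-1 * ((u t' x).2 - (u t x).2) - (dtu t x).2)%R) <= e%:E)%E.
Proof.
move=> du tT e0.
have H0 := cvge0_near _ (fun t' => Hnorm_ge0 s (fun x => ((t' - t)^-1 * ((u t' x).1 - (u t x).1) - (dtu t x).1,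
    (t' - t)^-1 * ((u t' x).2 - (u t x).2) - (dtu t x).2)%R)) (du t tT) e0.
have /nbhs_ballP[d /= d0 H] : nbhs t [set t' | t' != t -> t' \in `[0, T] ->
    (Hnorm s (fun x => ((t' - t)^-1 * ((u t' x).1 - (u t x).1) - (dtu t x).1,
    (t' - t)^-1 * ((u t' x).2 - (u t x).2) - (dtu t x).2)%R) <= e%:E)%E].
  exact: H0.
exists d => // t' t'T tt' t't.
by apply: H => //; rewrite /ball/= distrC.
Qed.

Lemma within_continuous_eps (T : R) (phi : R -> R) :
  (forall t, t \in `[0, T] -> forall e, 0 < e -> exists2 d, 0 < d &
    forall t', t' \in `[0, T] -> `|t' - t| < d -> `|phi t' - phi t| <= e) ->
  {within `[0, T], continuous phi}.
Proof.
move=> H; apply/subspace_continuousP => t tT; apply/cvgrPdist_le => e e0.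
have [d d0 Hd] := H t tT e e0.
apply/nbhs_ballP; exists d => //= t' tt' t'T.
by rewrite distrC; apply: Hd => //; rewrite distrC.
Qed.

Lemma fin_le_component (s A : R) (v : int * int -> (R * R) * (R * R)) k : 0 <= s ->
  fin_le (fun k => J k `^ s * vnsq (v k)) A -> vnsq (v k) <= A.
Proof.
move=> s0 /(_ [:: k] isT); rewrite big_seq1; apply: le_trans.
by rewrite ler_peMl ?vnsq_ge0// -[leLHS](powRr0 (J k)) powJ_mono.
Qed.

Lemma vnsq_components (v : (R * R) * (R * R)) (e : R) : 0 <= e -> vnsq v <= e ^+ 2 ->
  [/\ `|v.1.1| <= e, `|v.1.2| <= e, `|v.2.1| <= e & `|v.2.2| <= e].
Proof.
move=> e0 H.
have h (a : R) : a ^+ 2 <= vnsq v -> `|a| <= e.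
  move=> ha; rewrite -(ler_pXn2r (n := 2)) ?nnegrE//.
  by rewrite real_normK ?num_real// (le_trans ha).
have s (a : R) := sqr_ge0 a.
move: h; rewrite /vnsq /nsq => h; split; apply: h.
- by have := s v.1.2; have := s v.2.1; have := s v.2.2; lra.
- by have := s v.1.1; have := s v.2.1; have := s v.2.2; lra.
- by have := s v.1.2; have := s v.1.1; have := s v.2.2; lra.
- by have := s v.1.2; have := s v.2.1; have := s v.1.1; lra.
Qed.

Lemma uhatB (v w : R * R -> R * R) k : vL2 v -> vL2 w ->
  uhat (fun x => v x - w x) k = uhat v k - uhat w k.
Proof.
move=> /vL2_integrable[v1 v2] /vL2_integrable[w1 w2].
apply/pair_equal_spec; split; first exact: (fhatB k v1 w1).
exact: (fhatB k v2 w2).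
Qed.

Section Cont.
Context (s T : R) (s0 : 0 <= s) (u : R -> R * R -> R * R) (cu : contHs s T u).

Lemma contHs_vL2 t : t \in `[0, T] -> vL2 (u t).
Proof. by move=> tT; have [[]] := cu tT. Qed.

Lemma contHs_hat_near t (e : R) : t \in `[0, T] -> 0 < e ->
  exists2 d, 0 < d & forall t', t' \in `[0, T] -> `|t' - t| < d ->
    fin_le (fun k => J k `^ s * vnsq (uhat (u t') k - uhat (u t) k)) (e ^+ 2).
Proof.
move=> tT e0; have [d d0 H] := contHs_near cu tT e0; exists d => // t' t'T t't.
have := Hnorm_fin_le (ltW e0) (H t' t'T t't).
by apply: fin_le_le => k; rewrite uhatB//; exact: contHs_vL2.
Qed.

Lemma contHs_hat_continuous k :
  [/\ {within `[0, T], continuous (fun t => (uhat (u t) k).1.1)},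
    {within `[0, T], continuous (fun t => (uhat (u t) k).1.2)},
    {within `[0, T], continuous (fun t => (uhat (u t) k).2.1)} &
    {within `[0, T], continuous (fun t => (uhat (u t) k).2.2)}].
Proof.
have H t : t \in `[0, T] -> forall e, 0 < e -> exists2 d, 0 < d &
    forall t', t' \in `[0, T] -> `|t' - t| < d -> vnsq (uhat (u t') k - uhat (u t) k) <= e ^+ 2.
  move=> tT e e0; have [d d0 Hd] := contHs_hat_near tT e0; exists d => // t' t'T t't.
  exact: (fin_le_component k s0 (Hd t' t'T t't)).
split; apply: within_continuous_eps => t tT e e0; have [d d0 Hd] := H t tT e e0;
  by exists d => // t' t'T t't; have [] := vnsq_components (ltW e0) (Hd t' t'T t't).
Qed.

(** A bound at one time persists nearby by continuity in H^s, and compactness of the time interval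
    makes it uniform. *)
Lemma contHs_bounded : exists A, forall t, t \in `[0, T] ->
  fin_le (fun k => J k `^ s * vnsq (uhat (u t) k)) A.
Proof.
have /compact_near_coveringP/(_ R +oo (fun A t => t \in `[0, T] ->
    fin_le (fun k => J k `^ s * vnsq (uhat (u t) k)) A) _) := @segment_compact R 0 T.
case.
  move=> t tT.
  have [A HA] := Hnorm_lty_fin_le (proj2 (proj1 (cu tT))).
  have [d d0 Hd] := contHs_hat_near tT ltr01.
  (* From |a|^2 <= 2 |a - b|^2 + 2 |b|^2, where the H^s distance to the value at [t] is at most
     1. *)
  exists ([set t' | `|t' - t| < d], [set B | 2 * (1 ^+ 2 + A) <= B]).
    split => /=; last by apply: nbhs_pinfty_ge; exact: num_real.
    by apply/nbhs_ballP; exists d => //= t'; rewrite /ball/= distrC.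
  move=> [t' B] /= [t't AB] t'T.
  apply: fin_leW AB.
  apply: fin_le_le (fin_leZ (ler0n R 2) (fin_leD (Hd t' t'T t't) HA)) => k.
  rewrite -mulrDr mulrCA ler_wpM2l ?powR_ge0//.
  move: (uhat (u t') k) (uhat (u t) k) => [[a b] [c e]] [[a' b'] [c' e']].
  rewrite /vnsq /nsq/= -subr_ge0.
  rewrite (_ : _ - _ = (a - 2 * a') ^+ 2 + (b - 2 * b') ^+ 2 + (c - 2 * c') ^+ 2 + (e - 2 * e') ^+ 2); last by ring.
  by rewrite !addr_ge0 ?sqr_ge0.
move=> M [_ HM]; exists (M + 1) => t tT; apply: (HM (M + 1)) => //.
by rewrite ltrDl.
Qed.

End Cont.

(** For [s >= 0] each coefficient is bounded by the H^s norm and thus inherits the convergence of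
    the difference quotients. *)
Lemma derivHs_hat_derive s T u dtu t k : 0 <= s -> (forall t, t \in `[0, T] -> vL2 (u t)) ->
  vL2 (dtu t) -> derivHs s T u dtu -> t \in `]0, T[ ->
    [/\ is_derive t 1 (fun t => (uhat (u t) k).1.1) (uhat (dtu t) k).1.1,
    is_derive t 1 (fun t => (uhat (u t) k).1.2) (uhat (dtu t) k).1.2,
    is_derive t 1 (fun t => (uhat (u t) k).2.1) (uhat (dtu t) k).2.1 &
    is_derive t 1 (fun t => (uhat (u t) k).2.2) (uhat (dtu t) k).2.2].
Proof.
move=> s0 u2 du2 du to.
have tT : t \in `[0, T] by move: to; rewrite !in_itv/= => /andP[/ltW -> /ltW ->].
have [i1 i2] := vL2_integrable du2; have [j1 j2] := vL2_integrable (u2 t tT).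
have H e : 0 < e -> exists2 d, 0 < d & forall t', t' \in `[0, T] -> t' != t -> `|t' - t| < d ->
    vnsq ((rscale (t' - t)^-1 ((uhat (u t') k).1 - (uhat (u t) k).1) - (uhat (dtu t) k).1,
           rscale (t' - t)^-1 ((uhat (u t') k).2 - (uhat (u t) k).2) - (uhat (dtu t) k).2)) <= e ^+ 2.
  move=> e0; have [d d0 Hd] := derivHs_near du tT e0; exists d => // t' t'T tt' t't.
  have := Hnorm_fin_le (ltW e0) (Hd t' t'T tt' t't).
  move=> /(fin_le_component k s0); rewrite /uhat/=.
  have [k1 k2] := vL2_integrable (u2 t' t'T).
  have E1 : fhat (fst \o (fun x => ((t' - t)^-1 * ((u t' x).1 - (u t x).1) - (dtu t x).1,
                       (t' - t)^-1 * ((u t' x).2 - (u t x).2) - (dtu t x).2))) k =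
     rscale (t' - t)^-1 (fhat (fst \o u t') k - fhat (fst \o u t) k) - fhat (fst \o dtu t) k.
    rewrite -(fhatB k k1 j1) -(fhatZ _ k (tintegrableB k1 j1)) -(fhatB k _ i1)//.
    exact/tintegrableZ/tintegrableB.
  have E2 : fhat (snd \o (fun x => ((t' - t)^-1 * ((u t' x).1 - (u t x).1) - (dtu t x).1,
                       (t' - t)^-1 * ((u t' x).2 - (u t x).2) - (dtu t x).2))) k =
     rscale (t' - t)^-1 (fhat (snd \o u t') k - fhat (snd \o u t) k) - fhat (snd \o dtu t) k.
    rewrite -(fhatB k k2 j2) -(fhatZ _ k (tintegrableB k2 j2)) -(fhatB k _ i2)//.
    exact/tintegrableZ/tintegrableB.
  by rewrite E1 E2.
have main (phi : R -> R) (D : R) : (forall e, 0 < e -> exists2 d, 0 < d &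
    forall t', t' \in `[0, T] -> t' != t -> `|t' - t| < d -> `|(t' - t)^-1 * (phi t' - phi t) - D| <= e) ->
    is_derive t 1 phi D.
  move=> Hp.
  have cv : (fun h : R => h^-1 *: ((phi \o shift t) (h *: (1 : R)) - phi t)) @ 0^' --> D.
    apply/cvgrPdist_le => e e0; have [d d0 Hd] := Hp e e0.
    move: to; rewrite in_itv/= => /andP[t0 tT'].
    (* Keeps [h + t] inside the time interval, so that the limit is two-sided at an interior
       time. *)
    pose d' := Num.min d (Num.min t (T - t)).
    have d'0 : 0 < d' by rewrite !lt_min d0 t0 subr_gt0.
    apply/nbhs_ballP; exists d' => //= h; rewrite /ball/= sub0r normrN => hd hn.
    have [hd1 [hd2 hd3]] : `|h| < d /\ `|h| < t /\ `|h| < T - t.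
      by move: hd; rewrite /d' !lt_min => /andP[-> /andP[-> ->]].
    have := Hd (h + t); rewrite addrK => Hh.
    rewrite distrC /GRing.scale/= mulr1; apply: Hh => //.
      have := ler_norm h; have := ler_norm (- h); rewrite normrN in_itv/= => a b.
      by apply/andP; split; lra.
    by rewrite -subr_eq0 addrK.
  split; first by apply/cvg_ex; exists D.
  exact/cvg_lim.
split; apply: main => e e0; have [d d0 Hd] := H e e0;
  by exists d => // t' t'T tt' t't; have [] := vnsq_components (ltW e0) (Hd t' t'T tt' t't).
Qed.

End TimeRegularity.

(** * Solutions as systems of coefficients *)

Section Solutions.
Context {R : realType}.
Implicit Types (f g h : R * R -> R) (k l : int * int).

Lemma within_const_on (T : R) (phi : R -> R) : {within `[0, T], continuous phi} ->
  (forall t, t \in `]0, T[ -> is_derive t 1 phi 0) ->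
  forall t, t \in `]0, T[ -> phi t = phi 0.
Proof.
move=> cp dp t; rewrite in_itv/= => /andP[t0 tT].
have [|||c _ H] := @MVT_segment R phi (fun=> 0) 0 t.
- exact: ltW.
- move=> x; rewrite in_itv/= => /andP[x0 xt]; apply: dp; rewrite in_itv/= x0/=; exact: lt_trans tT.
- apply: continuous_subspaceW cp => x /=; rewrite !in_itv/= => /andP[-> xt]/=.
  exact: le_trans xt (ltW tT).
- by apply/eqP; rewrite -subr_eq0 H mul0r.
Qed.

Lemma fhat0 f : tint f = 0 -> fhat f 0 = 0.
Proof.
move=> f0; apply/pair_equal_spec; rewrite /cc /sc; split.
  rewrite (@eq_tint _ _ f) ?f0 ?mulr0// => x.
  by rewrite /ecos /phase /= !mul0r addr0 cos0 mulr1.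
rewrite (@eq_tint _ _ (fun=> 0)) ?tint_cst ?mul0r ?mulr0 ?oppr0// => x.
by rewrite /esin /phase /= !mul0r addr0 sin0 mulr0.
Qed.

Lemma fhat_laplace f k : smooth f -> torus_periodic f ->
  fhat (laplace f) k = rscale (- ksq k) (fhat f k).
Proof.
move=> sf pf; have [df f1 f2] := sf 2; have := sf 1 => c1.
have p1 := periodic_d1 pf; have p2 := periodic_d2 pf.
have [_ c11 _] := f1; have [_ _ c22] := f2.
have C1 : cc (d1 (d1 f)) k = - k.1%:~R ^+ 2 * cc f k.
  by rewrite (cc_d1 k p1 f1) (sc_d1 k pf c1); ring.
have C2 : cc (d2 (d2 f)) k = - k.2%:~R ^+ 2 * cc f k.
  by rewrite (cc_d2 k p2 f2) (sc_d2 k pf c1); ring.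
have S1 : sc (d1 (d1 f)) k = - k.1%:~R ^+ 2 * sc f k.
  by rewrite (sc_d1 k p1 f1) (cc_d1 k pf c1); ring.
have S2 : sc (d2 (d2 f)) k = - k.2%:~R ^+ 2 * sc f k.
  by rewrite (sc_d2 k p2 f2) (cc_d2 k pf c1); ring.
have C : cc (laplace f) k = - ksq k * cc f k.
  apply: etrans (ccD k c11 c22) _; apply: etrans (congr2 +%R C1 C2) _.
  by rewrite /ksq; ring.
have S : sc (laplace f) k = - ksq k * sc f k.
  apply: etrans (scD k c11 c22) _; apply: etrans (congr2 +%R S1 S2) _.
  by rewrite /ksq; ring.
by rewrite /fhat /rscale /= C S mulrN.
Qed.

Lemma fsol_of_field (al s T : R) (u dtu : R -> R * R -> R * R) :
  1 <= s -> contHs s T u -> contHs (s - 1) T dtu -> derivHs (s - 1) T u dtu ->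
  zero_average (u 0) -> (forall t, t \in `[0, T] -> vC1 (u t)) ->
  (forall t, t \in `]0, T[ -> div_free (u t) /\
     exists p D, [/\ torus_periodic p, Cn 1 p, continuous (fst \o D), continuous (snd \o D) &
       [/\ forall k, fhat (fst \o D) k = rscale (1 + al * ksq k) (fhat (fst \o dtu t) k),
           forall k, fhat (snd \o D) k = rscale (1 + al * ksq k) (fhat (snd \o dtu t) k) &
           forall x, D x + convect (u t) x = - grad p x]]) ->
  fsol al s T (fun t => uhat (u t)) (fun t => uhat (dtu t)).
Proof.
move=> s1 cu cdu du za cu1 eqs.
have s0 : 0 <= s by lra.
have s10 : 0 <= s - 1 by lra.
have tT t : t \in `]0, T[ -> t \in `[0, T].
  by rewrite !in_itv/= => /andP[/ltW -> /ltW ->].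
have pu t : t \in `]0, T[ -> torus_periodic (u t).
  by move=> /tT h; have [] := contHs_vL2 cu h.
have cont k := contHs_hat_continuous s0 cu k.
have der t : t \in `]0, T[ -> forall k, [/\ is_derive t 1 (fun t => (uhat (u t) k).1.1) (uhat (dtu t) k).1.1,
    is_derive t 1 (fun t => (uhat (u t) k).1.2) (uhat (dtu t) k).1.2,
    is_derive t 1 (fun t => (uhat (u t) k).2.1) (uhat (dtu t) k).2.1 &
    is_derive t 1 (fun t => (uhat (u t) k).2.2) (uhat (dtu t) k).2.2].
  move=> h k; exact: (derivHs_hat_derive k s10 (contHs_vL2 cu) (contHs_vL2 cdu (tT _ h)) du h).
(* At frequency zero the flux and the pressure term carry a factor [k = 0], so the mean velocity is
   conserved; it vanishes initially. *)
have mean_der t : t \in `]0, T[ -> uhat (dtu t) 0 = 0.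
  move=> h; have [dv [p [D [pp cp c1 c2 [h1 h2 e]]]]] := eqs t h.
  have [e1 e2] := velocity_equation_hat (pu t h) (cu1 t (tT t h)) dv pp cp c1 c2 h1 h2 e.
  have k0 : ksq (0 : int * int) = 0 :> R by rewrite /ksq/= expr0n/= addr0.
  have f0 th : flux_hat (u t) th 0 = 0.
    by apply/pair_equal_spec; rewrite /flux_hat/=; split; ring.
  have h0 (z y : R * R) th : rscale (1 + al * ksq 0) z =
      cminusi (flux_hat (u t) th 0 + rscale (0 : int)%:~R y) -> z = 0.
    rewrite k0 f0 /rscale /cminusi/= mulr0 addr0 !mul1r !mul0r addr0 oppr0.
    by case: z => a b /= [-> ->].
  by rewrite [LHS]surjective_pairing (h0 _ _ _ (e1 0)) (h0 _ _ _ (e2 0)).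
split.
- exact: cont.
- exact: der.
- move=> t h k; exact: (uhat_herm (cu1 t (tT t h))).
- by move=> t h k; have [dv _] := eqs t h; apply: (uhat_div (pu t h) (cu1 t (tT t h)) dv).
- move=> t h; have [z1 z2] := za.
  have u00 : uhat (u 0) 0 = 0.
    by apply/pair_equal_spec; split; apply: fhat0.
  have [c1 c2 c3 c4] := cont 0.
  rewrite -[RHS]u00.
  have d0 t' : t' \in `]0, T[ -> _ := fun j => der t' j 0.
  have E := fun phi c d => @within_const_on T phi c d t h.
  rewrite [LHS]surjective_pairing [RHS]surjective_pairing.
  apply/pair_equal_spec; split.
    rewrite [LHS]surjective_pairing [RHS]surjective_pairing.
    apply/pair_equal_spec; split.
      by apply: E c1 _ => t' h'; have := d0 t' h'; rewrite mean_der// => -[].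
    by apply: E c2 _ => t' h'; have := d0 t' h'; rewrite mean_der// => -[].
  rewrite [LHS]surjective_pairing [RHS]surjective_pairing.
  apply/pair_equal_spec; split.
    by apply: E c3 _ => t' h'; have := d0 t' h'; rewrite mean_der// => -[].
  by apply: E c4 _ => t' h'; have := d0 t' h'; rewrite mean_der// => -[].
- exact: contHs_bounded cu.
- by have [A HA] := contHs_bounded cdu; exists A => t /tT; exact: HA.
- move=> t h; have [dv [p [D [pp cp c1 c2 [h1 h2 e]]]]] := eqs t h.
  have [e1 e2] := velocity_equation_hat (pu t h) (cu1 t (tT t h)) dv pp cp c1 c2 h1 h2 e.
  have [a1 a2] := cu1 t (tT t h).
  exists (flux_hat (u t) (fst \o u t)), (flux_hat (u t) (snd \o u t)), (fhat p).
  split; [exact: e1|exact: e2| | ].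
    exact: (flux_hat_cvg (pu t h) (cu1 t (tT t h)) dv (Cn1_continuous a1) (periodic_fst (pu t h))).
  exact: (flux_hat_cvg (pu t h) (cu1 t (tT t h)) dv (Cn1_continuous a2) (periodic_snd (pu t h))).
- move=> t h; have [dv [p [D [pp cp c1 c2 [h1 h2 e]]]]] := eqs t h.
  exists (flux_hat (u t) (curl (u t))).
    exact: (vorticity_equation_hat (pu t h) (cu1 t (tT t h)) pp cp c1 c2 h1 h2 e).
  rewrite (_ : curl_hat (uhat (u t)) = fhat (curl (u t))); last first.
    by apply/funext => k; rewrite (curl_hatE (pu t h) (cu1 t (tT t h))).
  apply: (flux_hat_cvg (pu t h) (cu1 t (tT t h)) dv).
    exact: continuous_curl (cu1 t (tT t h)).
  exact: periodic_curl (pu t h).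
Qed.

Lemma Euler_fsol (s T : R) (u0 : R * R -> R * R) (u dtu : R -> R * R -> R * R) :
  1 <= s -> zero_average u0 ->
  [/\ contHs s T u, contHs (s - 1) T dtu & derivHs (s - 1) T u dtu] ->
  u 0 = u0 -> (forall t, t \in `[0, T] -> vC1 (u t)) ->
  (forall t, t \in `]0, T[ -> div_free (u t) /\
     exists p, [/\ torus_periodic p, Cn 1 p &
            forall x, dtu t x + convect (u t) x = - grad p x]) ->
  fsol 0 s T (fun t => uhat (u t)) (fun t => uhat (dtu t)).
Proof.
move=> s1 za [c1 c2 d] u00 cu eqs; apply: fsol_of_field => //; first by rewrite u00.
move=> t h; have [dv [p [pp cp e]]] := eqs t h; split => //.
have [b1 b2] : vC1 (u t).
  by apply: cu; move: h; rewrite !in_itv/= => /andP[/ltW -> /ltW ->].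
have [b10 b11 b12] := b1; have [b20 b21 b22] := b2; have [p0 p1 p2] := cp.
have u1 := Cn1_continuous b1; have u2 := Cn1_continuous b2.
(* The time derivative of the Euler solution is given as an H^(s-1) field; the equation expresses it
   through continuous functions and so supplies its continuity. *)
have E1 : fst \o dtu t = (fun x => -1 * d1 p x - (convect (u t) x).1).
  apply/funext => x; rewrite mulN1r.
  by have := congr1 fst (e x) => /= <-; rewrite addrK.
have E2 : snd \o dtu t = (fun x => -1 * d2 p x - (convect (u t) x).2).
  apply/funext => x; rewrite mulN1r.
  by have := congr1 snd (e x) => /= <-; rewrite addrK.
have F k (z : R * R) : z = rscale (1 + 0 * ksq k) z.
  by rewrite /rscale mul0r addr0 !mul1r -surjective_pairing.
exists p, (dtu t); split; [exact: pp|exact: cp| | |].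
- rewrite E1.
  exact: (continuousBR (continuousZR p1) (continuousDR (continuousMR u1 b11) (continuousMR u2 b12))).
- rewrite E2.
  exact: (continuousBR (continuousZR p2) (continuousDR (continuousMR u1 b21) (continuousMR u2 b22))).
- by split; [move=> k; exact: F|move=> k; exact: F|exact: e].
Qed.

Lemma Euler_Voigt_fsol (al s T : R) (u0 : R * R -> R * R) (u dtu : R -> R * R -> R * R) :
  1 <= s -> zero_average u0 ->
  [/\ contHs s T u, contHs (s - 1) T dtu & derivHs (s - 1) T u dtu] ->
  u 0 = u0 -> (forall t, t \in `[0, T] -> vsmooth (u t) /\ vsmooth (dtu t)) ->
  (forall t, t \in `]0, T[ -> div_free (u t) /\
     exists p, [/\ torus_periodic p, Cn 1 p &
            forall x, dtu t x - (al * (vlaplace (dtu t) x).1, al * (vlaplace (dtu t) x).2)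
              + convect (u t) x = - grad p x]) ->
  fsol al s T (fun t => uhat (u t)) (fun t => uhat (dtu t)).
Proof.
move=> s1 za [c1 c2 d] u00 cu eqs; apply: fsol_of_field => //; first by rewrite u00.
  by move=> t /cu[[h1 h2] _]; split; [exact: h1|exact: h2].
move=> t h; have [dv [p [pp cp e]]] := eqs t h; split => //.
have tT : t \in `[0, T] by move: h; rewrite !in_itv/= => /andP[/ltW -> /ltW ->].
have [_ [b1 b2]] := cu t tT.
have pd : torus_periodic (dtu t) by have [] := contHs_vL2 c2 tT.
have cl f : smooth f -> continuous (laplace f).
  by move=> sf; have [_ [_ h1 _] [_ _ h2]] := sf 2; exact: (continuousDR h1 h2).
have key f k : smooth f -> torus_periodic f ->
    fhat (fun x => f x - al * laplace f x) k = rscale (1 + al * ksq k) (fhat f k).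
  move=> sf pf; have lc := cl f sf; have cf := sf 0.
  have lc' : continuous (fun x => al * laplace f x) by exact: continuousZR.
  have := fhat_laplace k sf pf; rewrite /fhat /rscale /= => -[L1 L2].
  rewrite (ccB _ cf lc') (scB _ cf lc') (ccZ _ _ lc) (scZ _ _ lc).
  rewrite L1 (_ : sc (laplace f) k = - ksq k * sc f k); last by lra.
  by apply/pair_equal_spec; split; ring.
have k1 k := key (fst \o dtu t) k b1 (periodic_fst pd).
have k2 k := key (snd \o dtu t) k b2 (periodic_snd pd).
exists p, (fun x => dtu t x - (al * (vlaplace (dtu t) x).1, al * (vlaplace (dtu t) x).2)).
split; [exact: pp|exact: cp| | |by split].
- exact: (continuousBR (b1 0) (continuousZR (cl _ b1))).
- exact: (continuousBR (b2 0) (continuousZR (cl _ b2))).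
Qed.

End Solutions.

(** * Rates *)

Section Rates.
Context {R : realType}.
Implicit Types (k l : int * int) (v dv w dw : R -> int * int -> (R * R) * (R * R)).

Lemma ksq_nsq_curl_hat_le (z : int * int -> (R * R) * (R * R)) k :
  ksq k * nsq (curl_hat z k) <= J k `^ 2 * vnsq (z k).
Proof.
rewrite powR_mulrn ?J_ge0// expr2 -mulrA; apply: ler_pM (ksq_leJ k) _.
- exact: ksq_ge0.
- exact: nsq_ge0.
by apply: le_trans (nsq_curl_hat_le z k) _; rewrite ler_wpM2r ?vnsq_ge0 ?ksq_leJ.
Qed.

(** The gradient of the curl costs [J] squared, which is within the available weight because
    [s - 1 >= 2]. *)
Lemma forcing_le_smooth (s K N : R) (z : int * int -> (R * R) * (R * R)) : 3 <= s ->
  fin_le (fun k => J k `^ (s - 1) * vnsq (z k)) K ->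
  fin_le (fun k => ksq k * chi N k ^+ 2 * nsq (curl_hat z k)) K.
Proof.
move=> s3; apply: fin_le_le => k.
have c1 : chi N k ^+ 2 <= 1 by rewrite expr_le1// ?chi_ge0// chi_le1.
apply: (@le_trans _ _ (ksq k * nsq (curl_hat z k))).
  by rewrite mulrAC -[leRHS]mulr1 ler_wpM2l// mulr_ge0 ?ksq_ge0 ?nsq_ge0.
apply: le_trans (ksq_nsq_curl_hat_le z k) _.
by rewrite ler_wpM2r ?vnsq_ge0 ?powJ_mono//; lra.
Qed.

(** The time derivative lacks [3 - s] powers of [J]; they are paid by the cutoff, whose support lies
    in [J k <= 4 * N ^+ 2]. *)
Lemma forcing_le_rough (s K N : R) (z : int * int -> (R * R) * (R * R)) : s <= 3 -> 0 < N ->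
  fin_le (fun k => J k `^ (s - 1) * vnsq (z k)) K ->
  fin_le (fun k => ksq k * chi N k ^+ 2 * nsq (curl_hat z k)) ((4 * N ^+ 2) `^ (3 - s) * K).
Proof.
move=> s3 N0 zK; apply: fin_le_le (fin_leZ (powR_ge0 _ _) zK) => k.
have B0 : 0 <= (4 * N ^+ 2) `^ (3 - s) * (J k `^ (s - 1) * vnsq (z k)).
  by rewrite mulr_ge0 ?powR_ge0// mulr_ge0 ?powR_ge0 ?vnsq_ge0.
have [jN|Nj] := leP (2 * N) (jb k).
  by rewrite (chi0 N0 jN) expr0n/= mulr0 mul0r.
have JN : J k <= 4 * N ^+ 2.
  have : jb k ^+ 2 <= (2 * N) ^+ 2 by rewrite ler_pXn2r ?nnegrE ?sqrtr_ge0 ?(ltW Nj)//; lra.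
  rewrite sqr_sqrtr ?J_ge0// => h; apply: le_trans h _; lra.
have c1 : chi N k ^+ 2 <= 1 by rewrite expr_le1// ?chi_ge0// chi_le1.
apply: (@le_trans _ _ (ksq k * nsq (curl_hat z k))).
  by rewrite mulrAC -[leRHS]mulr1 ler_wpM2l// mulr_ge0 ?ksq_ge0 ?nsq_ge0.
apply: le_trans (ksq_nsq_curl_hat_le z k) _.
rewrite mulrA ler_wpM2r ?vnsq_ge0//.
rewrite (_ : J k `^ 2 = J k `^ (3 - s) * J k `^ (s - 1)); last first.
  rewrite -powRD; last by apply/implyP => _; exact: J_neq0.
  by congr (_ `^ _); ring.
rewrite ler_wpM2r ?powR_ge0//; apply: ge0_ler_powR => //; rewrite ?nnegrE ?J_ge0//.
  by rewrite subr_ge0.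
exact: le_trans (J_ge0 k) JN.
Qed.

Lemma vorticity_rate_smooth (s T : R) w dw : 3 <= s -> 0 < T -> fsol 0 s T w dw ->
  exists2 C, 0 < C & forall al v dv, 0 < al -> fsol al s T v dv ->
    forall G W, fin_le (fun k => ksq k * nsq (curl_hat (v 0) k)) G ->
    fin_le (fun k => nsq (curl_hat (v 0) k - curl_hat (w 0) k)) W ->
    forall t, t \in `[0, T] ->
    fin_le (fun k => nsq (curl_hat (v t) k - curl_hat (w t) k)) (C * (al + W + al * G)).
Proof.
move=> s3 T0 fw; have [K HK] := fs_dbnd fw.
have r1 : 1 < s - 1 by lra.
have er : s - 1 + 1 = s by ring.
have [C C0 HC] : exists2 C, 0 < C & _ := vorticity_estimate (r := s - 1) r1 T0 (eq_ind_r (fun q => fsol 0 q T w dw) fw er).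
rewrite er in HC.
have K0 : 0 <= `|K| by exact: normr_ge0.
exists (C * (2 + `|K|)); first by nra.
move=> al v dv al0 fv G W hG hW t tT.
have [N N0 EN] := exists_cutoff (lt_trans ltr01 r1) al0.
have [] := HC al v dv al0 fv N `|K| G W N0 _ hG hW t tT.
  move=> t' t'T; apply: fin_leW (ler_norm K); exact: forcing_le_smooth s3 (HK t' t'T).
rewrite EN => h _; apply: fin_leW h _.
have G0 := fin_le_ge0 hG; have W0 := fin_le_ge0 hW.
rewrite -[leRHS]mulrA ler_wpM2l ?(ltW C0)//.
have m1 : 0 <= al * G by rewrite mulr_ge0// ltW.
have m2 : 0 <= al * `|K| by rewrite mulr_ge0// ltW.
have m3 : 0 <= `|K| * W by rewrite mulr_ge0.
have m4 : 0 <= `|K| * (al * G) by rewrite mulr_ge0.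
lra.
Qed.

(** The weight [Num.min al 1] of [G] stays below both [al] and the rate. The former is used for the
    gradient of the initial difference, the latter for the fixed gradient of the limit, which [al]
    would not allow for large [al]. *)
Lemma vorticity_rate_rough (s T : R) w dw : 2 < s -> s < 3 -> 0 < T -> fsol 0 s T w dw ->
  exists2 C, 0 < C & forall al v dv, 0 < al -> fsol al s T v dv ->
    forall G W, fin_le (fun k => ksq k * nsq (curl_hat (v 0) k)) G ->
    fin_le (fun k => nsq (curl_hat (v 0) k - curl_hat (w 0) k)) W ->
    forall t, t \in `[0, T] ->
    fin_le (fun k => nsq (curl_hat (v t) k - curl_hat (w t) k))
      (C * (al `^ ((s - 1) / 2) + W + Num.min al 1 * G)).
Proof.
move=> s2 s3 T0 fw; have [K HK] := fs_dbnd fw.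
have r1 : 1 < s - 1 by lra.
have er : s - 1 + 1 = s by ring.
have [C C0 HC] : exists2 C, 0 < C & _ := vorticity_estimate (r := s - 1) r1 T0 (eq_ind_r (fun q => fsol 0 q T w dw) fw er).
rewrite er in HC.
have K0 : 0 <= `|K| by exact: normr_ge0.
pose B : R := 16 `^ (3 - s).
have B0 : 0 <= B by exact: powR_ge0.
have BK : 0 <= B * `|K| by exact: mulr_ge0.
exists (C * (3 + B * `|K|)); first by apply: mulr_gt0 => //; lra.
move=> al v dv al0 fv G W hG hW t tT.
have G0 := fin_le_ge0 hG; have W0 := fin_le_ge0 hW.
set q := al `^ ((s - 1) / 2).
have q0 : 0 <= q by exact: powR_ge0.
have forc N : 0 < N -> forall t', t' \in `]0, T[ ->
    fin_le (fun k => ksq k * chi N k ^+ 2 * nsq (curl_hat (dw t') k)) ((4 * N ^+ 2) `^ (3 - s) * `|K|).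
  move=> N0 t' t'T; apply: fin_leW (forcing_le_rough (ltW s3) N0 (HK t' t'T)) _.
  by rewrite ler_wpM2l ?powR_ge0 ?ler_norm.
have [al1|al1] := leP al 1.
  have aG0 : 0 <= al * G by rewrite mulr_ge0// ltW.
  (* Here 4/N^2 = al^(1/2) and 4 N^2 = 16 al^(-1/2), so the commutator error is [q] and [al] times
     the forcing is [B * q]. *)
  pose N := 2 * al `^ (- 4^-1).
  have N0 : 0 < N by rewrite mulr_gt0 ?powR_gt0.
  have N2 : N ^+ 2 = 4 * al `^ (- 2^-1).
    rewrite exprMn -(powR_mulrn 2 (powR_ge0 _ _)) -powRrM.
    by rewrite (_ : - 4^-1 * 2 = - 2^-1); [congr (_ * _); ring|field].
  have EN : (4 / N ^+ 2) `^ (s - 1) = q.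
    rewrite N2 invfM mulrA mulfV// mul1r powRN invrK -powRrM.
    by congr (_ `^ _); rewrite mulrC.
  have ES : al * (4 * N ^+ 2) `^ (3 - s) = B * q.
    rewrite N2 mulrA powRM ?powR_ge0// (_ : 4 * 4 = 16); last by ring.
    rewrite -powRrM mulrCA -[X in B * (X * _)]powRr1 ?(ltW al0)//.
    rewrite -powRD; last by apply/implyP => _; rewrite gt_eqF.
    by congr (_ * _ `^ _); field.
  have alq : al <= q.
    rewrite -[leLHS]powRr1 ?(ltW al0)// /q; apply: ger_powR; last lra.
    by rewrite al0 al1.
  have [h _] := HC al v dv al0 fv N _ G W N0 (forc N N0) hG hW t tT.
  apply: fin_leW h _; rewrite EN -[leRHS]mulrA ler_wpM2l ?(ltW C0)//.
  rewrite 2!mulrDr mulr1 mulrA ES.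
  have m1 : 0 <= B * `|K| * W by exact: mulr_ge0.
  have m2 : 0 <= B * `|K| * (al * G) by exact: mulr_ge0.
  lra.
have q1 : 1 <= q.
  rewrite /q -[leLHS](powRr0 al) ler_powR ?(ltW al1)//; lra.
have h4 : (4 / 2 ^+ 2 : R) = 1 by field.
have h16 : (4 * 2 ^+ 2 : R) = 16 by ring.
(* For [al > 1] the second bound is used with [N = 2], which makes 4/N^2 equal to 1; after division
   by [al] all constants are absorbed by [q >= 1]. *)
have [_ h] := HC al v dv al0 fv 2 _ G W (ltr0Sn R 1) (forc 2 (ltr0Sn R 1)) hG hW t tT.
apply: fin_leW h _; rewrite h4 h16 powR1 -/B -[leRHS]mulrA ler_wpM2l ?(ltW C0)//.
have E : (W + 1 + al * (G + 1 + B * `|K|)) / al = (W + 1) / al + (G + 1 + B * `|K|).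
  by field; rewrite gt_eqF.
have d : (W + 1) / al <= W + 1 by rewrite ler_pdivrMr// ler_peMr ?(ltW al1)//; lra.
rewrite E mul1r.
have m1 : 0 <= B * `|K| * W by exact: mulr_ge0.
have m2 : 0 <= B * `|K| * G by exact: mulr_ge0.
have m3 : B * `|K| <= B * `|K| * q by rewrite ler_peMr.
lra.
Qed.

End Rates.

(** * Norms of fields and of the weak gradient *)

Section FinalNorms.
Context {R : realType}.
Implicit Types (f g : R * R -> R) (u v w : R * R -> R * R) (k l : int * int) (x : R * R).

Lemma expe2_poweR (y : \bar R) : (0 <= y)%E -> (y ^+ 2 = y `^ 2)%E.
Proof.
case: y => [r r0|_|//]; last by rewrite poweRyr ?pnatr_eq0//; exact: mulyy.
by rewrite -EFin_expe poweR_EFin powR_mulrn.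
Qed.

Lemma continuous_enorm v : continuous (fst \o v) -> continuous (snd \o v) ->
  continuous (enorm \o v).
Proof.
move=> c1 c2 x; have cq : continuous (fun x => (fst \o v) x * (fst \o v) x + (snd \o v) x * (snd \o v) x).
  exact: (continuousDR (continuousMR c1 c1) (continuousMR c2 c2)).
by have := continuous_comp (cq x) (@sqrt_continuous R _).
Qed.

Lemma L2norm_sq_continuous f : continuous f -> (L2norm f ^+ 2 = (tint (fun x => f x ^+ 2))%:E)%E.
Proof.
move=> cf; rewrite L2norm_continuous// -EFin_expe sqr_sqrtr//.
by apply: tint_ge0 => x _; exact: sqr_ge0.
Qed.

Lemma enorm_sq v x : (enorm \o v) x ^+ 2 = (v x).1 ^+ 2 + (v x).2 ^+ 2.
Proof. by rewrite /= sqr_sqrtr// addr_ge0 ?sqr_ge0. Qed.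

Lemma vL2norm_sq_continuous v : continuous (fst \o v) -> continuous (snd \o v) ->
  (vL2norm v ^+ 2 = (tint (fun x => (v x).1 ^+ 2 + (v x).2 ^+ 2))%:E)%E.
Proof.
move=> c1 c2; rewrite /vL2norm L2norm_sq_continuous; last exact: continuous_enorm.
by congr EFin; apply: eq_tint => x; exact: enorm_sq.
Qed.

Lemma L2norm_le f (c q : R) : continuous f -> 0 <= c -> 0 <= q -> tint (fun x => f x ^+ 2) <= c * q ->
  (L2norm f <= (Num.sqrt c)%:E * q%:E `^ 2^-1)%E.
Proof.
move=> cf c0 q0 H; rewrite L2norm_continuous// poweR_EFin powR12_sqrt// -EFinM lee_fin -sqrtrM//.
exact: ler_wsqrtr.
Qed.

Lemma measurable_vnorm_sq v : measurable_fun setT v ->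
  measurable_fun cell (fun x => ((v x).1 ^+ 2 + (v x).2 ^+ 2)%:E).
Proof.
move=> mv.
have m1 : measurable_fun setT (fst \o v) by apply: measurableT_comp mv; exact: measurable_fst.
have m2 : measurable_fun setT (snd \o v) by apply: measurableT_comp mv; exact: measurable_snd.
apply/measurable_EFinP; apply: measurable_funTS.
by apply: measurable_funD; exact: measurable_funX.
Qed.

Lemma vL2norm_sq_le v u w : measurable_fun setT v -> measurable_fun setT u -> measurable_fun setT w ->
  (forall x, (v x).1 ^+ 2 + (v x).2 ^+ 2 <=
     2 * ((u x).1 ^+ 2 + (u x).2 ^+ 2) + 2 * ((w x).1 ^+ 2 + (w x).2 ^+ 2)) ->
  (vL2norm v ^+ 2 <= 2%:E * vL2norm u ^+ 2 + 2%:E * vL2norm w ^+ 2)%E.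
Proof.
move=> mv mu mw H; rewrite !expe2_poweR ?L2norm_ge0// !vL2norm_sq.
have mc := @cell_measurable R.
have p (z : R * R -> R * R) x : cell x -> (0 <= ((z x).1 ^+ 2 + (z x).2 ^+ 2)%:E)%E.
  by move=> _; rewrite lee_fin addr_ge0 ?sqr_ge0.
have qu := measurable_vnorm_sq mu; have qw := measurable_vnorm_sq mw.
have pz (z : R * R -> R * R) x : cell x -> (0 <= 2%:E * ((z x).1 ^+ 2 + (z x).2 ^+ 2)%:E)%E.
  by move=> cx; rewrite mule_ge0// p.
have mz (z : R * R -> R * R) : measurable_fun setT z -> measurable_fun cell (fun x => 2%:E * ((z x).1 ^+ 2 + (z x).2 ^+ 2)%:E)%E.
  by move=> /measurable_vnorm_sq; exact: measurable_funeM.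
rewrite -!ge0_integralZl_EFin//; [|exact: p|exact: p].
rewrite -ge0_integralD//; [|exact: pz|exact: mz|exact: pz|exact: mz].
apply: ge0_le_integral => //; [exact: p|exact: measurable_vnorm_sq| |].
  by apply: emeasurable_funD; exact: mz.
by move=> x _; rewrite -!EFinM -EFinD lee_fin.
Qed.

(** True in both cases of the choice: a weak gradient is square-integrable by definition, and the
    dummy value is the zero field. *)
Lemma wgrad_L2 f : measurable_fun setT (wgrad f) /\ (vL2norm (wgrad f) < +oo)%E.
Proof.
rewrite /wgrad; case: xgetP => [G -> [[_ mG nG] _]|_]; first by [].
split; first exact: measurable_cst.
rewrite /vL2norm L2norm_continuous ?ltry//.
by apply: continuous_enorm => x; exact: cst_continuous.
Qed.

End FinalNorms.

(** * From coefficients back to the norms of the fields *)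

Section Assembly.
Context {R : realType}.
Implicit Types (f g : R * R -> R) (v w : R * R -> R * R) (k l : int * int) (x : R * R).

Lemma tint_vsq v : continuous (fst \o v) -> continuous (snd \o v) ->
  tint (fun x => (v x).1 ^+ 2 + (v x).2 ^+ 2) =
  tint (fun x => (fst \o v) x ^+ 2) + tint (fun x => (snd \o v) x ^+ 2).
Proof. by move=> c1 c2; exact: (tintD (continuousMR c1 c1) (continuousMR c2 c2)). Qed.

Lemma bessel_field v : continuous (fst \o v) -> continuous (snd \o v) ->
  fin_le (fun k => vnsq (uhat v k)) ((2 * pi) ^- 2 * tint (fun x => (v x).1 ^+ 2 + (v x).2 ^+ 2)).
Proof.
move=> c1 c2; rewrite tint_vsq// mulrDr.
apply: fin_le_le (fin_leD (bessel c1) (bessel c2)) => k.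
by rewrite vnsq_uhat.
Qed.

Lemma parseval_field_le v (A : R) : continuous (fst \o v) -> continuous (snd \o v) ->
  torus_periodic v -> fin_le (fun k => vnsq (uhat v k)) A ->
  tint (fun x => (v x).1 ^+ 2 + (v x).2 ^+ 2) <= 2 * (2 * pi) ^+ 2 * A.
Proof.
move=> c1 c2 pv HA; rewrite tint_vsq//.
have h1 := parseval_le c1 (periodic_fst pv) (A := A).
have h2 := parseval_le c2 (periodic_snd pv) (A := A).
have H1 : fin_le (fourier_sq (fst \o v)) A.
  by apply: fin_le_le HA => k; rewrite vnsq_uhat lerDl -nsq_fhat nsq_ge0.
have H2 : fin_le (fourier_sq (snd \o v)) A.
  by apply: fin_le_le HA => k; rewrite vnsq_uhat lerDr -nsq_fhat nsq_ge0.
by have := h1 H1; have := h2 H2; lra.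
Qed.

Lemma bessel_grad f : Cn 1 f -> torus_periodic f ->
  fin_le (fun k => ksq k * nsq (fhat f k))
    ((2 * pi) ^- 2 * tint (fun x => (grad f x).1 ^+ 2 + (grad f x).2 ^+ 2)).
Proof.
move=> cf pf; have [_ c1 c2] := cf.
apply: fin_le_le (bessel_field (v := grad f) c1 c2) => k.
have e1 := cc_d1 k pf cf; have e2 := sc_d1 k pf cf.
have e3 := cc_d2 k pf cf; have e4 := sc_d2 k pf cf.
rewrite (_ : uhat (grad f) k = ((k.1%:~R * sc f k, k.1%:~R * cc f k), (k.2%:~R * sc f k, k.2%:~R * cc f k))).
  by rewrite /vnsq /nsq /ksq /fhat/= le_eqVlt; apply/orP; left; apply/eqP; ring.
rewrite /uhat /fhat; apply/pair_equal_spec; split; apply/pair_equal_spec; split.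
- exact: e1.
- by apply: (etrans (congr1 -%R e2)); rewrite mulNr opprK.
- exact: e3.
- by apply: (etrans (congr1 -%R e4)); rewrite mulNr opprK.
Qed.

Lemma periodicB (V : zmodType) (a b : R * R -> V) : torus_periodic a -> torus_periodic b ->
  torus_periodic (fun x => a x - b x).
Proof. by move=> pa pb x; rewrite (pa x).1 (pa x).2 (pb x).1 (pb x).2. Qed.

Section Families.
Context (s T : R) (s2 : 2 < s) (T0 : 0 < T).
Context (u dtu : R -> R * R -> R * R) (ua dta : R -> R -> R * R -> R * R).
Context (cu : contHs s T u) (c1u : forall t, t \in `[0, T] -> vC1 (u t)).
Context (fu : fsol 0 s T (fun t => uhat (u t)) (fun t => uhat (dtu t))).
Context (cua : forall al, 0 < al -> contHs s T (ua al)).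
Context (c1ua : forall al, 0 < al -> forall t, t \in `[0, T] -> vC1 (ua al t)).
Context (fua : forall al, 0 < al ->
  fsol al s T (fun t => uhat (ua al t)) (fun t => uhat (dta al t))).

Let zero_in : 0 \in `[0, T].
Proof. by rewrite in_itv/= lexx ltW. Qed.

Let pi2_gt0 : 0 < (2 * pi) ^+ 2 :> R := @twopi_sq_gt0 R.

Lemma velocity_convergence (M : R) :
  (forall al, 0 < al -> fin_le (fun k => ksq k * vnsq (uhat (ua al 0) k)) M) ->
  exists2 C : R, 0 < C & forall al, 0 < al ->
    (ereal_sup [set vL2norm (fun x => (ua al t x - u t x)%R) | t in `[0%R, T]%classic] <=
     C%:E * (al%:E + vL2norm (fun x => (ua al 0 x - u 0 x)%R) ^+ 2) `^ 2^-1)%E.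
Proof.
move=> HM; have M0 : 0 <= M := fin_le_ge0 (HM 1 ltr01).
have r1 : 1 < s - 1 by have := s2; lra.
have er : s - 1 + 1 = s by ring.
have [C C0 HC] := velocity_estimate (r := s - 1) r1 T0
  (eq_ind_r (fun q => fsol 0 q T (fun t => uhat (u t)) (fun t => uhat (dtu t))) fu er).
rewrite er in HC.
pose p : R := (2 * pi) ^- 2.
have p0 : 0 < p by rewrite invr_gt0.
have P0 : 0 < 2 * (2 * pi) ^+ 2 :> R by exact: mulr_gt0.
(* The first factor is the Parseval constant for two components; [1 + M + p] majorizes the
   coefficients of [al], of [al * M] and of the initial difference, on which Bessel's inequality
   costs [p]. *)
pose c : R := 2 * (2 * pi) ^+ 2 * (C * (1 + M + p)).
have c0 : 0 < c by apply: mulr_gt0; [exact: mulr_gt0|apply: mulr_gt0 => //; lra].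
exists (Num.sqrt c); first by rewrite sqrtr_gt0.
move=> al al0; apply: ge_ereal_sup => _ [t tT0 <-]; have tT : t \in `[0, T] := tT0.
pose d t x := ua al t x - u t x.
have cd t' : t' \in `[0, T] -> continuous (fst \o d t') /\ continuous (snd \o d t').
  move=> t'T; have [/Cn1_continuous a1 /Cn1_continuous a2] := c1ua al0 t'T.
  have [/Cn1_continuous b1 /Cn1_continuous b2] := c1u t'T.
  by split; [exact: (continuousBR a1 b1)|exact: (continuousBR a2 b2)].
have [d1t d2t] := cd t tT; have [d10 d20] := cd 0 zero_in.
have hatd t' k : t' \in `[0, T] -> uhat (d t') k = uhat (ua al t') k - uhat (u t') k.
  by move=> t'T; apply: uhatB; [exact: (contHs_vL2 (cua al0) t'T)|exact: (contHs_vL2 cu t'T)].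
have pd : torus_periodic (d t).
  by apply: periodicB; [case: (contHs_vL2 (cua al0) tT)|case: (contHs_vL2 cu tT)].
set W := tint (fun x => (d 0 x).1 ^+ 2 + (d 0 x).2 ^+ 2).
have W0 : 0 <= W by apply: tint_ge0 => x _; rewrite addr_ge0 ?sqr_ge0.
have HW : fin_le (fun k => vnsq (uhat (ua al 0) k - uhat (u 0) k)) (p * W).
  by apply: fin_le_le (bessel_field d10 d20) => k; rewrite hatd.
have H := HC al _ _ al0 (fua al0) M (p * W) (HM al al0) HW t tT.
have {}H : tint (fun x => (d t x).1 ^+ 2 + (d t x).2 ^+ 2) <= 2 * (2 * pi) ^+ 2 * (C * (al + p * W + al * M)).
  by apply: parseval_field_le => //; apply: fin_le_le H => k; rewrite hatd.
rewrite (_ : (vL2norm _ ^+ 2 = W%:E)%E); last exact: (vL2norm_sq_continuous d10 d20).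
rewrite -EFinD; apply: L2norm_le.
- exact: (continuous_enorm d1t d2t).
- exact: ltW.
- by rewrite addr_ge0 ?(ltW al0).
rewrite (@eq_tint _ _ (fun x => (d t x).1 ^+ 2 + (d t x).2 ^+ 2)); last by move=> x; exact: enorm_sq.
apply: le_trans H _; rewrite /c -[leRHS]mulrA (ler_pM2l P0) -[leRHS]mulrA (ler_pM2l C0).
have h1 : 0 <= M * W by exact: mulr_ge0.
have h2 : 0 <= p * al by rewrite mulr_ge0 ?ltW.
lra.
Qed.

(** [X] is the rate and [Y] the weight of the initial Voigt gradient. That gradient is split into
    its distance to the limit gradient, where [Y <= al] is used, and the limit gradient itself, a
    constant absorbed by [X] through [Y <= X]. *)
Lemma vorticity_convergence (X Y : R -> R) (f0 : R * R -> R) :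
  (forall al, 0 < al -> [/\ 0 <= Y al, Y al <= al & Y al <= X al]) ->
  (forall al, 0 < al -> Cn 1 (curl (ua al 0))) ->
  (exists2 C, 0 < C & forall al (v dv : R -> int * int -> (R * R) * (R * R)), 0 < al -> fsol al s T v dv ->
    forall G W, fin_le (fun k => ksq k * nsq (curl_hat (v 0) k)) G ->
    fin_le (fun k => nsq (curl_hat (v 0) k - curl_hat (uhat (u 0)) k)) W ->
    forall t, t \in `[0, T] ->
    fin_le (fun k => nsq (curl_hat (v t) k - curl_hat (uhat (u t)) k))
      (C * (X al + W + Y al * G))) ->
  exists2 C : R, 0 < C & forall al, 0 < al ->
    (ereal_sup [set L2norm (fun x => (curl (ua al t) x - curl (u t) x)%R)
               | t in `[0%R, T]%classic] <=
     C%:E * ((X al)%:E + L2norm (fun x => (curl (ua al 0) x - curl (u 0) x)%R) ^+ 2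
       + al%:E * vL2norm (fun x => (grad (curl (ua al 0)) x - wgrad f0 x)%R) ^+ 2) `^ 2^-1)%E.
Proof.
move=> XY cn [C C0 HC].
have [mw fw] := wgrad_L2 f0.
have [K K0 EK] : exists2 K, 0 <= K & (vL2norm (wgrad f0) ^+ 2 = K%:E)%E.
  have f1 : vL2norm (wgrad f0) \is a fin_num by rewrite ge0_fin_numE// L2norm_ge0.
  by exists (fine (vL2norm (wgrad f0)) ^+ 2); rewrite ?sqr_ge0// EFin_expe fineK.
pose p : R := (2 * pi) ^- 2.
have p0 : 0 < p by rewrite invr_gt0.
(* The four terms belong to the rate, to the initial vorticity difference, to the gradient
   difference and to the squared norm [K] of the limit gradient. *)
pose c1 : R := 1 + p + 2 * p + p * 2 * K.
have k0 : 0 <= p * 2 * K.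
  by apply: mulr_ge0 => //; apply: mulr_ge0 => //; exact: ltW.
have c10 : 0 < c1 by rewrite /c1; lra.
pose c : R := (2 * pi) ^+ 2 * (C * c1).
have c0 : 0 < c by rewrite mulr_gt0// mulr_gt0.
exists (Num.sqrt c); first by rewrite sqrtr_gt0.
move=> al al0; apply: ge_ereal_sup => _ [t tT0 <-]; have tT : t \in `[0, T] := tT0.
have [Y0 Yal YX] := XY al al0.
pose d t x := curl (ua al t) x - curl (u t) x.
have pu t' : t' \in `[0, T] -> torus_periodic (u t') by move=> h; have [] := contHs_vL2 cu h.
have pua t' : t' \in `[0, T] -> torus_periodic (ua al t').
  by move=> h; have [] := contHs_vL2 (cua al0) h.
have cd t' : t' \in `[0, T] -> continuous (d t').
  move=> h; exact: (continuousBR (continuous_curl (c1ua al0 h)) (continuous_curl (c1u h))).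
have hatd t' k : t' \in `[0, T] ->
    fhat (d t') k = curl_hat (uhat (ua al t')) k - curl_hat (uhat (u t')) k.
  move=> h; rewrite (curl_hatE (pua _ h) (c1ua al0 h)) (curl_hatE (pu _ h) (c1u h)).
  by apply: fhatB; apply: continuous_integrable; apply: continuous_curl; [exact: c1ua|exact: c1u].
have pd : torus_periodic (d t).
  by apply: periodicB; [exact: (periodic_curl (pua _ tT))|exact: (periodic_curl (pu _ tT))].
set W := tint (fun x => d 0 x ^+ 2).
have W0 : 0 <= W by apply: tint_ge0 => x _; exact: sqr_ge0.
have HW : fin_le (fun k => nsq (curl_hat (uhat (ua al 0)) k - curl_hat (uhat (u 0)) k)) (p * W).
  by apply: fin_le_le (bessel (cd 0 zero_in)) => k; rewrite -hatd// nsq_fhat.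
have [_ g1 g2] := cn al al0.
set g := grad (curl (ua al 0)).
set G := tint (fun x => (g x).1 ^+ 2 + (g x).2 ^+ 2).
have mg : measurable_fun setT g.
  by apply: measurable_fun_pair; exact: continuous_measurable_plane.
have EG : (vL2norm g ^+ 2 = G%:E)%E := @vL2norm_sq_continuous R g g1 g2.
have mgw : measurable_fun setT (fun x => g x - wgrad f0 x).
  rewrite (_ : (fun x => _) = (fun x => ((g x).1 - (wgrad f0 x).1, (g x).2 - (wgrad f0 x).2))) //.
  have w1 : measurable_fun setT (fst \o wgrad f0) by apply: measurableT_comp mw; exact: measurable_fst.
  have w2 : measurable_fun setT (snd \o wgrad f0) by apply: measurableT_comp mw; exact: measurable_snd.
  have v1 : measurable_fun setT (fst \o g) := continuous_measurable_plane g1.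
  have v2 : measurable_fun setT (snd \o g) := continuous_measurable_plane g2.
  by apply: measurable_fun_pair; [exact: measurable_funB v1 w1|exact: measurable_funB v2 w2].
(* The first inequality shows that the gradient difference has finite norm, so that it can be
   treated as a real number [Q]; the second bounds the Voigt gradient by [Q] and [K]. *)
have young (a b e h : R) : (a - e) ^+ 2 + (b - h) ^+ 2 <= 2 * (a ^+ 2 + b ^+ 2) + 2 * (e ^+ 2 + h ^+ 2).
  by have := sqr_ge0 (a + e); have := sqr_ge0 (b + h); lra.
have young' (a b e h : R) : a ^+ 2 + b ^+ 2 <= 2 * ((a - e) ^+ 2 + (b - h) ^+ 2) + 2 * (e ^+ 2 + h ^+ 2).
  by have := sqr_ge0 (a - 2 * e); have := sqr_ge0 (b - 2 * h); lra.
have L1 := vL2norm_sq_le mgw mg mw (fun x => young _ _ _ _).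
have L2 := vL2norm_sq_le mg mgw mw (fun x => young' _ _ _ _).
rewrite EG EK -!EFinM -EFinD in L1.
set D := (vL2norm _ ^+ 2)%E in L1 L2 *.
have D0 : (0 <= D)%E by rewrite /D expe2_poweR ?L2norm_ge0// poweR_ge0.
have [Q Q0 EQ] : exists2 Q, 0 <= Q & D = Q%:E.
  have fD : D \is a fin_num by rewrite ge0_fin_numE// (le_lt_trans L1)// ltry.
  by exists (fine D); [exact: fine_ge0|rewrite fineK].
rewrite EG EK EQ -!EFinM -EFinD lee_fin in L2.
have HG : fin_le (fun k => ksq k * nsq (curl_hat (uhat (ua al 0)) k)) (p * (2 * Q + 2 * K)).
  apply: fin_leW (ler_wpM2l (ltW p0) L2).
  apply: fin_le_le (bessel_grad (cn al al0) (periodic_curl (pua _ zero_in))) => k.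
  by rewrite (curl_hatE (pua _ zero_in) (c1ua al0 zero_in)).
have H := HC al _ _ al0 (fua al0) _ _ HG HW t tT.
have {}H : tint (fun x => d t x ^+ 2) <=
    (2 * pi) ^+ 2 * (C * (X al + p * W + Y al * (p * (2 * Q + 2 * K)))).
  by apply: (parseval_le (cd t tT) pd); apply: fin_le_le H => k; rewrite -hatd// nsq_fhat.
rewrite (_ : (L2norm _ ^+ 2 = W%:E)%E); last exact: (L2norm_sq_continuous (cd 0 zero_in)).
rewrite EQ (_ : ((X al)%:E + W%:E + al%:E * Q%:E = (X al + W + al * Q)%R%:E)%E) //.
have X0 : 0 <= X al := le_trans Y0 YX.
have aQ : 0 <= al * Q := mulr_ge0 (ltW al0) Q0.
apply: (L2norm_le (cd t tT) (ltW c0)); first by apply: addr_ge0 => //; exact: addr_ge0.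
apply: le_trans H _; rewrite /c -[leRHS]mulrA (ler_pM2l pi2_gt0) -[leRHS]mulrA (ler_pM2l C0).
have h1 : Y al * (p * (2 * Q)) <= 2 * p * (al * Q).
  rewrite (_ : 2 * p * _ = al * (p * (2 * Q))); last by ring.
  by apply: ler_wpM2r => //; apply: mulr_ge0 (ltW p0) _; exact: mulr_ge0.
have h2 : Y al * (p * (2 * K)) <= p * 2 * K * X al.
  rewrite (_ : p * 2 * K * X al = X al * (p * (2 * K))); last by ring.
  by apply: ler_wpM2r => //; apply: mulr_ge0 (ltW p0) _; exact: mulr_ge0.
have k1 := mulr_ge0 k0 W0; have k2 := mulr_ge0 k0 aQ.
have k3 := mulr_ge0 (ltW p0) X0; have k4 := mulr_ge0 (ltW p0) W0.
have k5 := mulr_ge0 (ltW p0) aQ.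
rewrite /c1; lra.
Qed.

End Families.
End Assembly.

Lemma Cn1B (R : realType) (f g : R * R -> R) : Cn 1 f -> Cn 1 g -> Cn 1 (fun x => f x - g x).
Proof.
move=> [df f1 f2] [dg g1 g2].
have E1 : d1 (fun x => f x - g x) = (fun x => d1 f x - d1 g x).
  by apply/funext => x; rewrite /d1 deriveB//; exact: diff_derivable.
have E2 : d2 (fun x => f x - g x) = (fun x => d2 f x - d2 g x).
  by apply/funext => x; rewrite /d2 deriveB//; exact: diff_derivable.
split; first by move=> x; exact: differentiableB.
  by rewrite E1; exact: (continuousBR f1 g1).
by rewrite E2; exact: (continuousBR f2 g2).
Qed.

Theorem theorem1p3 (R : realType) (s T : R) (u0 : R * R -> R * R)
    (u : R -> R * R -> R * R)
    (u0a : R -> R * R -> R * R) (ua : R -> R -> R * R -> R * R) :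
  2 < s -> 0 < T ->
  Hs s u0 -> vC1 u0 -> zero_average u0 -> div_free u0 ->
  Euler_solution s T u0 u ->
  (forall alpha, 0 < alpha ->
    [/\ torus_periodic (u0a alpha), vsmooth (u0a alpha),
        zero_average (u0a alpha) & div_free (u0a alpha)]) ->
  (exists M : R, forall alpha, 0 < alpha ->
    (Hnorm 1 (u0a alpha) <= M%:E)%E) ->
  (exists M : R, forall alpha, 0 < alpha ->
    ((Num.sqrt alpha)%:E * vL2norm (grad (curl (u0a alpha))) <= M%:E)%E) ->
  (forall alpha, 0 < alpha ->
    Euler_Voigt_solution alpha T (u0a alpha) (ua alpha)) ->
  [/\ exists2 C : R, 0 < C & forall alpha, 0 < alpha ->
        (ereal_sup [set vL2norm (fun x => (ua alpha t x - u t x)%R)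
                   | t in `[0%R, T]%classic] <=
         C%:E * (alpha%:E
           + vL2norm (fun x => (u0a alpha x - u0 x)%R) ^+ 2) `^ 2^-1)%E,
      3 <= s ->
      exists2 C : R, 0 < C & forall alpha, 0 < alpha ->
        (ereal_sup [set L2norm (fun x => (curl (ua alpha t) x - curl (u t) x)%R)
                   | t in `[0%R, T]%classic] <=
         C%:E * (alpha%:E
           + L2norm (fun x => (curl (u0a alpha) x - curl u0 x)%R) ^+ 2
           + alpha%:E *
             vL2norm (fun x => (grad (curl (u0a alpha)) x - wgrad (curl u0) x)%R) ^+ 2)
             `^ 2^-1)%E &
      s < 3 ->
      exists2 C : R, 0 < C & forall alpha, 0 < alpha ->
        (ereal_sup [set L2norm (fun x => (curl (ua alpha t) x - curl (u t) x)%R)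
                   | t in `[0%R, T]%classic] <=
         C%:E * ((alpha `^ ((s - 1) / 2))%:E
           + L2norm (fun x => (curl (u0a alpha) x - curl u0 x)%R) ^+ 2
           + alpha%:E *
             vL2norm (fun x => (grad (curl (u0a alpha)) x - wgrad (curl u0) x)%R) ^+ 2)
             `^ 2^-1)%E].
Proof.
move=> s2 T0 _ _ za _ [dtu [[cu cdu du] [u00 c1u eqs]]] Hdat [M HM] _ Hsol.
have s1 : 1 <= s by lra.
have fu := Euler_fsol s1 za (And3 cu cdu du) u00 c1u eqs.
have [dta Hdta] : exists dta : R -> R -> R * R -> R * R, forall al, 0 < al ->
    [/\ contHs s T (ua al), contHs (s - 1) T (dta al) & derivHs (s - 1) T (ua al) (dta al)] /\
    [/\ ua al 0 = u0a al,
        forall t, t \in `[0, T] -> vsmooth (ua al t) /\ vsmooth (dta al t) &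
        forall t, t \in `]0, T[ -> div_free (ua al t) /\
          exists p, [/\ torus_periodic p, Cn 1 p &
            forall x, dta al t x - (al * (vlaplace (dta al t) x).1, al * (vlaplace (dta al t) x).2)
              + convect (ua al t) x = - grad p x]].
  have [|F HF] := @choice R (R -> R * R -> R * R) (fun al d => 0 < al ->
    [/\ contHs s T (ua al), contHs (s - 1) T d & derivHs (s - 1) T (ua al) d] /\
    [/\ ua al 0 = u0a al,
        forall t, t \in `[0, T] -> vsmooth (ua al t) /\ vsmooth (d t) &
        forall t, t \in `]0, T[ -> div_free (ua al t) /\
          exists p, [/\ torus_periodic p, Cn 1 p &
            forall x, d t x - (al * (vlaplace (d t) x).1, al * (vlaplace (d t) x).2)
              + convect (ua al t) x = - grad p x]]).
    (* One time derivative is selected for every [al]; for [al <= 0] nothing is asked and the Euler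
       one serves as default. For [al > 0] the Voigt regularity is taken at the index [s] of the
       Euler solution. *)
    move=> al; have [al0|al0] := ltP 0 al; last by exists dtu => //.
    by have [d [h1 h2]] := Hsol al al0; exists d => _; split; [exact: h1 s2|exact: h2].
  by exists F.
have cua al : 0 < al -> contHs s T (ua al) by move=> /Hdta[[]].
have c1ua al : 0 < al -> forall t, t \in `[0, T] -> vC1 (ua al t).
  move=> al0 t tT; have [_ [_ h _]] := Hdta al al0.
  by have [[h1 h2] _] := h t tT; split; [exact: h1|exact: h2].
have ua0 al : 0 < al -> ua al 0 = u0a al by move=> /Hdta[_ []].
have fua al : 0 < al -> fsol al s T (fun t => uhat (ua al t)) (fun t => uhat (dta al t)).
  move=> al0; have [h1 [h2 h3 h4]] := Hdta al al0; have [_ _ zaa _] := Hdat al al0.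
  exact: (Euler_Voigt_fsol s1 zaa h1 h2 h3 h4).
have M0 : 0 <= M by rewrite -lee_fin; exact: le_trans (Hnorm_ge0 1 _) (HM 1 ltr01).
have cn al : 0 < al -> Cn 1 (curl (ua al 0)).
  move=> al0; rewrite ua0//; have [_ [h1 h2] _ _] := Hdat al al0.
  by have [_ _ k1] := h1 2; have [_ k2 _] := h2 2; exact: (Cn1B k2 k1).
split.
- have [|C C0 HC] := @velocity_convergence _ _ _ s2 T0 _ _ _ _ cu c1u fu cua c1ua fua (M ^+ 2).
    move=> al al0; rewrite ua0//; apply: fin_le_le (Hnorm_fin_le M0 (HM al al0)) => k.
    by rewrite powRr1 ?J_ge0// ler_wpM2r ?vnsq_ge0 ?ksq_leJ.
  exists C; [exact: C0|move=> al al0].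
  by have := HC al al0; rewrite (ua0 _ al0) u00; exact.
- move=> s3.
  have XY (al : R) : 0 < al -> [/\ 0 <= al, al <= al & al <= al].
    by move=> /ltW al0; split.
  have [C C0 HC] := vorticity_convergence T0 cu c1u cua c1ua fua (curl u0) XY cn
    (vorticity_rate_smooth s3 T0 fu).
  exists C; [exact: C0|move=> al al0].
  by have := HC al al0; rewrite (ua0 _ al0) u00; exact.
- move=> s3.
  (* The exponent lies between 0 and 1: for [al <= 1] the power dominates [al], for [al > 1] it
     dominates 1. *)
  have XY (al : R) : 0 < al ->
      [/\ 0 <= Num.min al 1, Num.min al 1 <= al & Num.min al 1 <= al `^ ((s - 1) / 2)].
    move=> al0; split.
    + by rewrite le_min ltW/=.
    + by rewrite ge_min lexx.
    rewrite ge_min; have [al1|al1] := leP al 1.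
      apply/orP; left; rewrite -[leLHS]powRr1 ?(ltW al0)//; apply: ger_powR; last lra.
      by rewrite al0 al1.
    by apply/orP; right; rewrite -[leLHS](powRr0 al) ler_powR ?(ltW al1)//; lra.
  have [C C0 HC] := vorticity_convergence T0 cu c1u cua c1ua fua (curl u0) XY cn
    (vorticity_rate_rough s2 s3 T0 fu).
  exists C; [exact: C0|move=> al al0].
  by have := HC al al0; rewrite (ua0 _ al0) u00; exact.
Qed.
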